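(* Let $\Gamma$ be a finite quiver and $\alpha\in\mathbb{Z}_{\ge 0}^{\Gamma_0}$ a dimension vector. The fixed point locus $\mathcal{M}(\Gamma,\alpha)^T$ of the torus $T=(\mathbb{C}^\times)^{\Gamma_1}$ is, as a $W$-variety, isomorphic to the disjoint union $$\bigsqcup_{\beta}\ \mathcal{M}(\hat{\Gamma},\beta)\times^{W_\beta}W$$ over all dimension vectors $\beta$ of the universal abelian covering quiver $\hat{\Gamma}$, up to equivalence, which are compatible with $\alpha$. This isomorphism commutes with the natural maps to $\mathfrak{t}_\alpha^{\mathrm{gen}}$.
   Context: Everything is over $\mathbb{C}$. Quiver data. $\Gamma$ has finite vertex set $\Gamma_0$ and finite arrow set $\Gamma_1$. The universal abelian covering quiver $\hat\Gamma$ has $\hat\Gamma_0=\Gamma_0\times\mathbb{Z}^{\Gamma_1}$, $\hat\Gamma_1=\Gamma_1\times\mathbb{Z}^{\Gamma_1}$, the arrow $(a,\chi)$ going from $(i,\chi)$ to $(j,\chi+e_a)$ for $a:i\to j$. A dimension vector $\beta=(\beta_{i,\chi})$ of $\hat\Gamma$ (non-negative, finite support) is compatible with $\alpha$ if $\sum_\chi\beta_{i,\chi}=\alpha_i$ for all $i$. The group $\mathbb{Z}^{\Gamma_1}$ acts by $(\xi.\beta)_{i,\chi}=\beta_{i,\chi+\xi}$, and equivalence means being in the same orbit. Groups. $\mathrm{GL}_\alpha=\prod_{i\in\Gamma_0}\mathrm{GL}_{\alpha_i}(\mathbb{C})$ with Lie algebra $\mathfrak{gl}_\alpha$; $T_\alpha\subset\mathrm{GL}_\alpha$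 is the maximal torus of tuples of diagonal matrices, with Lie algebra $\mathfrak{t}_\alpha$; $W=W_\alpha=N_{\mathrm{GL}_\alpha}(T_\alpha)/T_\alpha\cong\prod_iS_{\alpha_i}$. An element $\sigma\in\mathfrak{t}_\alpha$ is regular if its centralizer in $\mathrm{GL}_\alpha$ is $T_\alpha$, and generic if $\mathrm{tr}(\sigma)=\sum_i\mathrm{tr}(\sigma_i)=0$ and $\mathrm{tr}(\sigma|_V)\ne0$ for all $\sigma$-stable $\Gamma_0$-graded subspaces $V\subset\mathbb{C}^\alpha=\bigoplus_i\mathbb{C}^{\alpha_i}$ other than $0$ and $\mathbb{C}^\alpha$. $\mathfrak{t}_\alpha^{\mathrm{gen}}\subset\mathfrak{t}_\alpha$ is the set of regular generic elements. The variety. $R(\bar\Gamma,\alpha)=\bigoplus_{(a:i\to j)\in\Gamma_1}\big(\mathrm{Hom}(\mathbb{C}^{\alpha_i},\mathbb{C}^{\alpha_j})\oplus\mathrm{Hom}(\mathbb{C}^{\alpha_j},\mathbb{C}^{\alpha_i})\big)$ with elements $\phi=(\phi_a,\phi_{a^*})_a$ is the representation space of the double quiver $\bar\Gamma$; $\mathrm{GL}_\alpha$ acts by base change, and $\mu(\phi)=\sum_{a\in\Gamma_1}[\phi_a,\phi_{a^*}]\in\mathfrak{gl}_\alpha$ (i.e. $\phi_a\phi_{a^*}$ is in the component of the target of $a$ and $\phi_{a^*}\phi_a$ in that of the source). Define $$\mathcal{M}(\Gamma,\alpha)=\{(\phi,hT_\alpha,\sigma)\in R(\bar\Gamma,\alpha)\times\mathrm{GL}_\alpha/T_\alpha\times\mathfrak{t}_\alpha^{\mathrm{gen}}\mid\mu(\phi)=h\sigma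 h^{-1}\}/\!\!/\mathrm{GL}_\alpha,$$ with action $g(\phi,hT_\alpha,\sigma)=(g\cdot\phi,ghT_\alpha,\sigma)$ (the induced action of $\mathrm{GL}_\alpha/\mathbb{C}^\times$ is free). The natural map $\pi:\mathcal{M}(\Gamma,\alpha)\to\mathfrak{t}_\alpha^{\mathrm{gen}}$ is $(\phi,hT_\alpha,\sigma)\mapsto\sigma$. $W$ acts by $w.(\phi,hT_\alpha,\sigma)=(\phi,h\dot w^{-1}T_\alpha,\dot w\sigma\dot w^{-1})$ with $\dot w$ the permutation matrix of $w$. The torus $T=(\mathbb{C}^\times)^{\Gamma_1}$ acts by $t.(\phi,hT_\alpha,\sigma)=(t.\phi,hT_\alpha,\sigma)$ with $(t.\phi)_a=t_a\phi_a$, $(t.\phi)_{a^*}=t_a^{-1}\phi_{a^*}$; this commutes with $W$, so $W$ acts on the fixed locus $\mathcal{M}(\Gamma,\alpha)^T$. The covering varieties. For $\beta$ compatible with $\alpha$, fix for each $i$ a decomposition $\mathbb{C}^{\alpha_i}=\bigoplus_\chi\mathbb{C}^{\beta_{i,\chi}}$ into coordinate subspaces (consecutive blocks of unit vectors, for an ordering of the finitely many relevant $\chi$). Then $\mathrm{GL}_\beta=\prod_{i,\chi}\mathrm{GL}_{\beta_{i,\chi}}\subset\mathrm{GL}_\alpha$ with the same maximal torus $T_\alpha$, $W_\beta=N_{\mathrm{GL}_\beta}(T_\alpha)/T_\alpha\subset W$, and $$\mathcal{M}(\hat\Gamma,\beta)=\{(\phi,hT_\alpha,\sigma)\in R(\bar{\hat\Gamma},\beta)\times\mathrm{GL}_\beta/T_\alpha\times\mathfrak{t}_\alpha^{\mathrm{gen}}\mid\mu(\phi)=h\sigma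 h^{-1}\}/\!\!/\mathrm{GL}_\beta,$$ where $R(\bar{\hat\Gamma},\beta)$ is the representation space of the double of $\hat\Gamma$ and $\mu$ the analogous moment map. It has a $W_\beta$-action given by the same formula as for $W$ and a natural map $\pi_\beta:\mathcal{M}(\hat\Gamma,\beta)\to\mathfrak{t}_\alpha^{\mathrm{gen}}$. Associated bundle. $\mathcal{M}(\hat\Gamma,\beta)\times^{W_\beta}W$ is the quotient of $\mathcal{M}(\hat\Gamma,\beta)\times W$ by the $W_\beta$-action $v.(x,w)=(v.x,vw)$, with $W$ acting by $w'.[x,w]=[x,ww'^{-1}]$ and with natural map $[x,w]\mapsto \dot w^{-1}\pi_\beta(x)\dot w$ to $\mathfrak{t}_\alpha^{\mathrm{gen}}$. *)

(* Defs.v *)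
From mathcomp Require Import all_boot all_order all_algebra all_fingroup.
From mathcomp Require Import finmap boolp classical_sets functions fsbigop.
From mathcomp Require Import reals complex.
From mathcomp Require mxred.

Set Implicit Arguments.
Unset Strict Implicit.
Unset Printing Implicit Defensive.

Import GRing.Theory.

Local Open Scope classical_set_scope.
Local Open Scope ring_scope.

Section Spaces.
Variable K : fieldType.

(* Varieties are spaces with functions: a set of points, a topology, and for
   each open set the regular functions on it. A function defined on an open
   set U is a total function of which only the values on U matter. *)
Record space := Space {
  pt :> Type;
  zopen : set (set pt);
  sect : set pt -> set (pt -> K) }.

(* The Zariski topology and regular functions defined by an algebra A of
   functions on P: principal open sets form a basis, and regular functions are
   locally quotients of elements of A. *)
Definition alg_space (P : Type) (A : set (P -> K)) : space := @Space P
  [set U | forall x, U x ->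
     exists q, [/\ A q, q x != 0 & forall y, q y != 0 -> U y]]
  (fun U => [set f | forall x, U x ->
     exists p q, [/\ A p, A q, q x != 0
                   & forall y, U y -> q y != 0 -> f y = p y / q y]]).

Definition subspace (S : space) (Z : set S) : space := @Space {x : S | Z x}
  [set U | exists2 V, zopen V & U = [set x | V (sval x)]]
  (fun U => [set f | forall x, U x ->
     exists V g, [/\ zopen V, V (sval x), sect V g
                   & forall y, U y -> V (sval y) -> f y = g (sval y)]]).

Definition sum_space (I : Type) (S : I -> space) : space :=
  @Space {i : I & S i}
  [set U | forall i, zopen [set x : S i | U (existT _ i x)]]
  (fun U => [set f | forall i,
     sect [set x : S i | U (existT _ i x)] (fun x => f (existT _ i x))]).

Definition class_of (P : Type) (E : P -> P -> Prop) : Type :=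
  {c : set P | exists x, c = E x}.
Definition cls (P : Type) (E : P -> P -> Prop) (x : P) : class_of E :=
  exist _ (E x) (ex_intro _ x erefl).
Definition crepr (P : Type) (E : P -> P -> Prop) (c : class_of E) : P :=
  sval (cid (svalP c)).

Lemma creprK P (E : P -> P -> Prop) (c : class_of E) : cls E (crepr c) = c.
Proof.
case: c => c hc; rewrite /cls /crepr; apply: eq_exist.
by case: cid => x /= ->.
Qed.

Definition quot_space (S : space) (E : S -> S -> Prop) : space :=
  @Space (class_of E)
  [set U | zopen [set x | U (cls E x)]]
  (fun U => [set f | sect [set x | U (cls E x)] (fun x => f (cls E x))]).

Definition is_isomorphism (S S' : space) (f : S -> S') : Prop :=
  [/\ bijective f,
      forall U : set S', zopen U <-> zopen (f @^-1` U)
    & forall (U : set S') (g : S' -> K), zopen U ->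
        (sect U g <-> sect (f @^-1` U) (fun x => g (f x)))].

Inductive polyfun (E : Type) (coord : set (E -> K)) : set (E -> K) :=
| polyfun_cst c : polyfun coord (fun=> c)
| polyfun_coord f : coord f -> polyfun coord f
| polyfun_add f g : polyfun coord f -> polyfun coord g ->
    polyfun coord (fun x => f x + g x)
| polyfun_mul f g : polyfun coord f -> polyfun coord g ->
    polyfun coord (fun x => f x * g x).

Definition locally_closed_space (E : Type) (coord : set (E -> K)) (X : set E) :
    space :=
  alg_space [set f : {x | X x} -> K |
    exists2 p, polyfun coord p & f = p \o sval].

(* Homomorphisms of algebras from A, an algebra of functions on P, to K. *)
Record character (P : Type) (A : set (P -> K)) := Character {
  ev : {f | A f} -> K;
  ev_cst : forall c (f : {f | A f}), (forall x, sval f x = c) -> ev f = c;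
  ev_add : forall f g h : {f | A f},
    (forall x, sval h x = sval f x + sval g x) -> ev h = ev f + ev g;
  ev_mul : forall f g h : {f | A f},
    (forall x, sval h x = sval f x * sval g x) -> ev h = ev f * ev g }.

(* Spec A; for K algebraically closed and A finitely generated its closed
   points are the homomorphisms A -> K. *)
Definition spec (P : Type) (A : set (P -> K)) : space :=
  alg_space [set F : character A -> K | exists f, F = @ev P A ^~ f].

Lemma character_eq P (A : set (P -> K)) (p q : character A) :
  (forall f, ev p f = ev q f) -> p = q.
Proof.
case: p q => [p p1 p2 p3] [q q1 q2 q3] /= /funext pq.
by case: _ / pq q1 q2 q3 => *; congr Character; apply: Prop_irrelevance.
Qed.

Section SpecMap.
Variables (P Q : Type) (A : set (P -> K)) (B : set (Q -> K)) (g : P -> Q).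
Hypothesis gBA : forall f, B f -> A (f \o g).

Definition pullback (f : {f | B f}) : {f | A f} :=
  exist _ (sval f \o g) (gBA (svalP f)).

Definition spec_map (p : spec A) : spec B.
Proof.
exists (fun f => ev p (pullback f)).
- by move=> c f fc; apply: ev_cst => x /=; rewrite fc.
- by move=> f f' h fh; apply: ev_add => x /=; rewrite fh.
- by move=> f f' h fh; apply: ev_mul => x /=; rewrite fh.
Defined.
End SpecMap.

Lemma polyfun_sum (E : Type) (coord : set (E -> K)) (I : finType)
    (F : I -> E -> K) :
  (forall i, polyfun coord (F i)) -> polyfun coord (fun x => \sum_i F i x).
Proof.
move=> FP; elim: (index_enum I) => [|i r IH].
  rewrite (_ : (fun x => _) = fun=> 0); first exact: polyfun_cst.
  by apply/funext => x; rewrite big_nil.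
rewrite (_ : (fun x => _) = fun x => F i x + \sum_(j <- r) F j x).
  exact: polyfun_add.
by apply/funext => x; rewrite big_cons.
Qed.

Lemma polyfun_comp (E E' : Type) (coord : set (E -> K)) (coord' : set (E' -> K))
    (g : E -> E') p :
  (forall c, coord' c -> polyfun coord (c \o g)) ->
  polyfun coord' p -> polyfun coord (p \o g).
Proof.
move=> cg; elim=> [c|f|f f' _ Pf _ Pf'|f f' _ Pf _ Pf'].
- exact: polyfun_cst.
- exact: cg.
- exact: (polyfun_add Pf Pf').
- exact: (polyfun_mul Pf Pf').
Qed.

Lemma regular_comp (E E' : Type) (coord : set (E -> K)) (coord' : set (E' -> K))
    (X : set E) (X' : set E') (g : E -> E') (gX : forall x, X x -> X' (g x)) f :
  (forall c, coord' c -> polyfun coord (c \o g)) ->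
  sect (s := locally_closed_space coord' X') setT f ->
  sect (s := locally_closed_space coord X) setT
    (f \o (fun x => exist X' (g (sval x)) (gX _ (svalP x)))).
Proof.
move=> cg fr x _; set G := fun y : {x | X x} => _.
have [_ [_ [[p pP ->] [q qP ->] qx fE]]] := fr (G x) I.
exists (p \o sval \o G), (q \o sval \o G); split=> //.
- by exists (p \o g) => //; apply: polyfun_comp pP.
- by exists (q \o g) => //; apply: polyfun_comp qP.
- by move=> y _; apply: fE.
Qed.

End Spaces.

Record quiver := Quiver {
  vert : choiceType;
  arr : choiceType;
  src : arr -> vert;
  tgt : arr -> vert }.

Record finite_quiver := FiniteQuiver {
  fvert : finType;
  farr : finType;
  fsrc : farr -> fvert;
  ftgt : farr -> fvert }.

Coercion quiver_of (G : finite_quiver) : quiver := Quiver (@fsrc G) (@ftgt G).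

Section Gl.
Variable K : fieldType.

Definition gl (V : Type) (d : V -> nat) : Type := forall v, 'M[K]_(d v).
Definition in_GL V (d : V -> nat) (g : gl d) : Prop := forall v, g v \in unitmx.
Definition in_t V (d : V -> nat) (s : gl d) : Prop := forall v, is_diag_mx (s v).
Definition in_T V (d : V -> nat) (s : gl d) : Prop := in_GL s /\ in_t s.

Definition gl_conj V (d : V -> nat) (g s : gl d) : gl d :=
  fun v => g v *m s v *m invmx (g v).

Definition regular V (d : V -> nat) (s : gl d) : Prop :=
  forall g : gl d, in_GL g ->
    ((forall v, g v *m s v = s v *m g v) <-> in_T g).

(* A graded subspace is given by matrices U v whose row spaces are its
   components. Row vectors are multiplied by s v on the right, which for a
   diagonal s v is its usual action on C^(d v). *)
Definition generic (V : finType) (d : V -> nat) (s : gl d) : Prop :=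
  \sum_v \tr (s v) = 0 /\
  forall U : gl d, (forall v, stablemx (U v) (s v)) ->
    ~ (forall v, U v = 0) -> ~ (forall v, row_full (U v)) ->
    \sum_v \tr (mxred.restrictmx (U v) (s v)) != 0.

Definition in_tgen (V : finType) (d : V -> nat) (s : gl d) : Prop :=
  [/\ in_t s, regular s & generic s].

(* The product of symmetric groups. The permutation matrices perm_mx multiply
   in the order of the group law of 'S_n, so that w |-> perm_mx w identifies
   this group with N(T)/T. *)
Definition weyl V (d : V -> nat) : Type := forall v, 'S_(d v).
Definition wmul V (d : V -> nat) (v w : weyl d) : weyl d := fun i => (v i * w i)%g.
Definition winv V (d : V -> nat) (w : weyl d) : weyl d := fun i => (w i)^-1%g.
Definition wdot V (d : V -> nat) (w : weyl d) : gl d := fun i => perm_mx (w i).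

Lemma wdot_GL V (d : V -> nat) (w : weyl d) : in_GL (wdot w).
Proof. by move=> v; apply: unitmx_perm. Qed.

Lemma gl_conj_wdotE V (d : V -> nat) (w : weyl d) (s : gl d) v k l :
  gl_conj (wdot w) s v k l = s v (w v k) (w v l).
Proof.
have -> : gl_conj (wdot w) s v = row_perm (w v) (col_perm (w v) (s v)).
  rewrite /gl_conj /wdot col_permE row_permE mulmxA; congr (_ *m _).
  by apply: (can_inj (mulmxK (unitmx_perm K (w v)))); rewrite mulVmx ?unitmx_perm // -perm_mxM mulVg perm_mx1.
by rewrite !mxE.
Qed.

End Gl.

Section Genericity.
Variable K : fieldType.

Lemma trace_conjmx n r r' (B : 'M[K]_(r, n)) (B' : 'M[K]_(r', n)) f :
  (B <= B')%MS -> (B' <= B)%MS -> stablemx B f ->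
  \tr (mxred.conjmx B f) = \tr (mxred.conjmx B' f).
Proof.
move=> BB' B'B stB; rewrite /mxred.conjmx.
have stB' : (B' *m f <= B)%MS by rewrite (submx_trans _ stB) ?submxMr.
move: (mulmxKpV BB') (mulmxKpV stB').
move: (pinvmx B) (pinvmx B') => p p' BE B'E.
transitivity (\tr (B *m p' *m (B' *m f *m p))); first by rewrite !mulmxA BE.
by rewrite mxtrace_mulC !mulmxA B'E.
Qed.

Lemma generic_conj (V : finType) (d : V -> nat) (w : weyl d) (s : gl K d) :
  generic s -> generic (gl_conj (wdot K w) s).
Proof.
case=> s0 sg; split.
  rewrite -[RHS]s0; apply: eq_bigr => v _.
  by rewrite /gl_conj mxtrace_mulC mulKmx ?unitmx_perm.
move=> U stU U0 U1; pose P v := wdot K w v; pose U' v := U v *m P v.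
have uP v : P v \in unitmx by apply: unitmx_perm.
have stU' v : stablemx (U' v) (s v).
  have := submxMr (P v) (stU v).
  by rewrite /gl_conj -!mulmxA mulVmx // mulmx1 !mulmxA.
suff -> : \sum_v \tr (mxred.restrictmx (U v) (gl_conj (wdot K w) s v)) =
          \sum_v \tr (mxred.restrictmx (U' v) (s v)).
  apply: sg => // [U'0|U'1]; [apply: U0 => v|apply: U1 => v].
    by rewrite -[U v](mulmxK (uP v)) [U v *m _]U'0 mul0mx.
  by have := U'1 v; rewrite /row_full mxrankMfree // row_free_unit.
apply: eq_bigr => v _.
have stR := stU v; rewrite -stablemx_row_base in stR.
rewrite /gl_conj -mxred.conjumx // in stR *.
have Rf : row_free (row_base (U v)) by apply: row_base_free.
rewrite -mxred.conjMumx //; apply: trace_conjmx.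
- by rewrite eq_row_base submxMr // eq_row_base.
- by rewrite eq_row_base submxMr // eq_row_base.
- have := submxMr (P v) stR; rewrite mxred.conjumx //.
  by move: (row_base (U v)) => B; rewrite -!mulmxA mulVmx // mulmx1 !mulmxA.
Qed.

Lemma in_t_conj V (d : V -> nat) (w : weyl d) (s : gl K d) :
  in_t s -> in_t (gl_conj (wdot K w) s).
Proof.
move=> st v; apply/is_diag_mxP => k l kl; rewrite gl_conj_wdotE.
have /is_diag_mxP := st v; apply.
by apply: contraNneq kl => /val_inj/perm_inj ->.
Qed.

Lemma in_T_conj V (d : V -> nat) (w : weyl d) (s : gl K d) :
  in_T s -> in_T (gl_conj (wdot K w) s).
Proof.
case=> su st; split; last exact: in_t_conj.
by move=> v; rewrite /gl_conj !unitmx_mul unitmx_inv su unitmx_perm.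
Qed.

Lemma gl_conjK V (d : V -> nat) (w : weyl d) (s : gl K d) :
  gl_conj (wdot K (winv w)) (gl_conj (wdot K w) s) = s.
Proof.
apply: functional_extensionality_dep => v; apply/matrixP => k l.
by rewrite !gl_conj_wdotE !permKV.
Qed.

Lemma gl_conjVK V (d : V -> nat) (w : weyl d) (s : gl K d) :
  gl_conj (wdot K w) (gl_conj (wdot K (winv w)) s) = s.
Proof.
apply: functional_extensionality_dep => v; apply/matrixP => k l.
by rewrite !gl_conj_wdotE !permK.
Qed.

Lemma regular_conj V (d : V -> nat) (w : weyl d) (s : gl K d) :
  regular s -> regular (gl_conj (wdot K w) s).
Proof.
move=> sr g gu; pose g' := gl_conj (wdot K (winv w)) g.
have gE : g = gl_conj (wdot K w) g' by rewrite gl_conjVK.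
have g'u : in_GL g'.
  by move=> v; rewrite /g' /gl_conj !unitmx_mul unitmx_inv gu unitmx_perm.
have comm : (forall v, g v *m gl_conj (wdot K w) s v
                     = gl_conj (wdot K w) s v *m g v)
        <-> (forall v, g' v *m s v = s v *m g' v).
  have uP v : wdot K w v \in unitmx by apply: unitmx_perm.
  have cM (x y : gl K d) v : gl_conj (wdot K w) x v *m gl_conj (wdot K w) y v
                 = wdot K w v *m (x v *m y v) *m invmx (wdot K w v).
    by rewrite /gl_conj -!mulmxA mulKmx // !mulmxA.
  rewrite gE; split=> H v; last by rewrite !cM H.
  have := H v; rewrite !cM => /(congr1 (mulmxr (wdot K w v))) /=.
  rewrite !mulmxKV // => /(congr1 (mulmx (invmx (wdot K w v)))).
  by rewrite !mulKmx.
rewrite comm (sr _ g'u); split=> [/(in_T_conj w)|/(in_T_conj (winv w)) //].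
by rewrite -gE.
Qed.

Lemma tgen_conj (V : finType) (d : V -> nat) (w : weyl d) (s : gl K d) :
  in_tgen s -> in_tgen (gl_conj (wdot K w) s).
Proof.
by case=> ? ? ?; split; [exact: in_t_conj|exact: regular_conj|exact: generic_conj].
Qed.
End Genericity.

Section Moduli.
Variables (K : fieldType) (I : finType) (alpha : I -> nat).

(* A variety with a map to t_alpha, viewed inside gl_alpha, and the operations
   of the elements of W. *)
Record wspace := WSpace {
  wcar :> space K;
  wact : weyl alpha -> wcar -> wcar;
  wproj : wcar -> gl K alpha }.

Definition wspace_isomorphic (X Y : wspace) : Prop :=
  exists f : X -> Y, [/\ is_isomorphism f,
    forall w x, f (wact w x) = wact w (f x)
  & forall x, wproj (f x) = wproj x].

(* The construction is needed for (G, alpha) and for (covering G, beta). The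
   map blk turns an element of t_alpha, T_alpha or GL_alpha that is block
   diagonal into the corresponding element of gl_d. *)
Variables (Q : quiver) (d : vert Q -> nat) (blk : gl K alpha -> gl K d).

(* phi b and phis b are the components at b and at the opposite arrow, frm is
   the group element h, and sig is sigma. *)
Record triple := Triple {
  phi : forall b : arr Q, 'M[K]_(d (tgt b), d (src b));
  phis : forall b : arr Q, 'M[K]_(d (src b), d (tgt b));
  frm : gl K d;
  sig : gl K alpha }.

Definition in_component (v : vert Q) (m : 'M[K]_(d v)) : gl K d :=
  dfwith (fun u => 0 : 'M[K]_(d u)) m.

(* A sum of finite support as soon as only finitely many arrows start or end
   at each vertex. *)
Definition moment (x : triple) : gl K d := fun v =>
  \sum_(b \in [set: arr Q])
    (in_component (phi x b *m phis x b) v - in_component (phis x b *m phi x b) v).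

Definition in_family (x : triple) : Prop :=
  [/\ in_GL (frm x), in_tgen (sig x)
    & forall v, moment x v = gl_conj (frm x) (blk (sig x)) v].

Definition coordinate : set (triple -> K) := [set f |
  [\/ exists b i j, f = fun x => phi x b i j,
      exists b i j, f = fun x => phis x b i j,
      exists v i j, f = fun x => frm x v i j
    | exists v i j, f = fun x => sig x v i j]].

Definition gauge (g : gl K d) (t : gl K alpha) (x : triple) : triple := Triple
  (fun b => g (tgt b) *m phi x b *m invmx (g (src b)))
  (fun b => g (src b) *m phis x b *m invmx (g (tgt b)))
  (fun v => g v *m frm x v *m blk t v)
  (sig x).

(* Regular functions on GL_d/T_alpha are the regular functions on GL_d that
   are invariant under right translation by T_alpha, so the GL_d-invariant
   regular functions on the family are the functions of (phi, h, sigma)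
   invariant under GL_d and T_alpha. *)
Definition invariants : set ({x | in_family x} -> K) := [set f |
  sect (s := locally_closed_space coordinate in_family) setT f /\
  forall g t x y, in_GL g -> in_T t -> sval y = gauge g t (sval x) ->
    f y = f x].

Definition moduli : space K := spec invariants.

Section Map.
Variable g : triple -> triple.
Hypothesis g_family : forall x, in_family x -> in_family (g x).
Hypothesis g_coord : forall c, coordinate c -> polyfun coordinate (c \o g).
Hypothesis g_gauge : forall h t x, in_GL h -> in_T t ->
  exists h' t', [/\ in_GL h', in_T t' & g (gauge h t x) = gauge h' t' (g x)].

Definition family_map (x : {x | in_family x}) : {x | in_family x} :=
  exist _ (g (sval x)) (g_family (svalP x)).

Lemma family_map_invariants f : invariants f -> invariants (f \o family_map).
Proof.
case=> fr fi; split; first exact: (regular_comp g_family g_coord fr).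
move=> h t x y hu tT yE; have [h' [t' [h'u t'T gE]]] := g_gauge (sval x) hu tT.
by apply: (fi h' t') => //=; rewrite yE.
Qed.

Definition moduli_map : moduli -> moduli := spec_map family_map_invariants.
End Map.

Lemma sig_coord v i j :
  invariants (fun x : {x | in_family x} => sig (sval x) v i j).
Proof.
split=> [x _|g t x y _ _ ->] //.
exists (fun x => sig (sval x) v i j), (fun=> 1); split=> //=.
- exists (fun x => sig x v i j) => //; apply: polyfun_coord.
  by apply: Or44; exists v, i, j.
- by exists (fun=> 1) => //; apply: polyfun_cst.
- exact: oner_neq0.
- by move=> y _ _; rewrite divr1.
Qed.

(* The morphism to t_alpha^gen induced by (phi, h, sigma) |-> sigma, given by
   its matrix coefficients. *)
Definition moduli_proj (p : moduli) : gl K alpha := fun v =>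
  \matrix_(i, j) ev p (exist _ _ (sig_coord i j)).

Section Torus.
Variables (t : arr Q -> K) (t_neq0 : forall b, t b != 0).

Definition torus_triple (x : triple) : triple := Triple
  (fun b => t b *: phi x b) (fun b => (t b)^-1 *: phis x b) (frm x) (sig x).

Lemma torus_family x : in_family x -> in_family (torus_triple x).
Proof.
case=> xu xt xm; split=> // v; rewrite -[RHS]xm /moment /=.
apply: eq_fsbigr => b _.
by rewrite -!scalemxAl -!scalemxAr !scalerA divff // mulVf // !scale1r.
Qed.

Lemma torus_coord c : coordinate c -> polyfun coordinate (c \o torus_triple).
Proof.
have cM (f : triple -> K) (a : K) : coordinate f ->
    polyfun coordinate (fun x => a * f x).
  by move=> fc; apply: polyfun_mul; [apply: polyfun_cst | apply: polyfun_coord].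
case=> [] [b [i [j ->]]].
- rewrite (_ : _ \o _ = fun x => t b * phi x b i j).
    by apply: cM; apply: Or41; exists b, i, j.
  by apply/funext => x /=; rewrite mxE.
- rewrite (_ : _ \o _ = fun x => (t b)^-1 * phis x b i j).
    by apply: cM; apply: Or42; exists b, i, j.
  by apply/funext => x /=; rewrite mxE.
- by apply: polyfun_coord; apply: Or43; exists b, i, j.
- by apply: polyfun_coord; apply: Or44; exists b, i, j.
Qed.

Lemma torus_gauge g s x : in_GL g -> in_T s ->
  exists g' s', [/\ in_GL g', in_T s'
    & torus_triple (gauge g s x) = gauge g' s' (torus_triple x)].
Proof.
move=> gu sT; exists g, s; split=> //; rewrite /torus_triple /gauge /=.
by congr Triple; apply: functional_extensionality_dep => b;
  rewrite -?scalemxAl -?scalemxAr -?scalemxAl.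
Qed.

Definition torus_act : moduli -> moduli :=
  moduli_map torus_family torus_coord torus_gauge.
End Torus.

Section Weyl.
Variable w : weyl alpha.
Hypothesis w_unit : in_GL (blk (wdot K w)).
Hypothesis w_conj : forall s, in_t s ->
  blk (gl_conj (wdot K w) s) = gl_conj (blk (wdot K w)) (blk s).

Definition weyl_triple (x : triple) : triple := Triple (phi x) (phis x)
  (fun v => frm x v *m invmx (blk (wdot K w) v))
  (gl_conj (wdot K w) (sig x)).

Lemma weyl_family x : in_family x -> in_family (weyl_triple x).
Proof.
case=> xu xt xm; split=> /= [v||v].
- by rewrite unitmx_mul xu unitmx_inv w_unit.
- exact: tgen_conj.
- have [st _ _] := xt; rewrite w_conj // [LHS]xm /gl_conj.
  have -> : invmx (frm x v *m invmx (blk (wdot K w) v)) =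
            blk (wdot K w) v *m invmx (frm x v).
    set h := frm x v *m _.
    have hu : h \in unitmx by rewrite unitmx_mul xu unitmx_inv w_unit.
    have hE : h *m (blk (wdot K w) v *m invmx (frm x v)) = 1%:M.
      by rewrite mulmxA mulmxKV // mulmxV.
    by rewrite -[RHS](mulKmx hu) hE mulmx1.
  by rewrite !mulmxA !mulmxKV.
Qed.

Lemma weyl_coord c : coordinate c -> polyfun coordinate (c \o weyl_triple).
Proof.
case=> [] [v [i [j ->]]].
- by apply: polyfun_coord; apply: Or41; exists v, i, j.
- by apply: polyfun_coord; apply: Or42; exists v, i, j.
- rewrite (_ : _ \o _ = fun x =>
      \sum_k frm x v i k * invmx (blk (wdot K w) v) k j); last first.
    by apply/funext => x /=; rewrite mxE.
  apply: polyfun_sum => k; apply: polyfun_mul; last exact: polyfun_cst.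
  by apply: polyfun_coord; apply: Or43; exists v, i, k.
- rewrite (_ : _ \o _ = fun x => sig x v (w v i) (w v j)); last first.
    by apply/funext => x /=; rewrite gl_conj_wdotE.
  by apply: polyfun_coord; apply: Or44; exists v, (w v i), (w v j).
Qed.

Lemma weyl_gauge g s x : in_GL g -> in_T s ->
  exists g' s', [/\ in_GL g', in_T s'
    & weyl_triple (gauge g s x) = gauge g' s' (weyl_triple x)].
Proof.
move=> gu sT; have [_ st] := sT.
exists g, (gl_conj (wdot K w) s); split=> //; first exact: in_T_conj.
rewrite /weyl_triple /gauge /=; congr Triple.
apply: functional_extensionality_dep => v; rewrite w_conj // /gl_conj.
by rewrite !mulmxA mulmxKV.
Qed.

Definition weyl_act : moduli -> moduli :=
  moduli_map weyl_family weyl_coord weyl_gauge.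
End Weyl.

Lemma weyl_torus_commute (w : weyl alpha) w_unit w_conj (t : arr Q -> K) t_neq0
    (p : moduli) :
  torus_act (t := t) t_neq0 (weyl_act (w := w) w_unit w_conj p) =
  weyl_act w_unit w_conj (torus_act t_neq0 p).
Proof.
apply: character_eq => f /=; congr (ev p _); apply: eq_exist.
apply/funext => x /=; congr (sval f _); exact: eq_exist.
Qed.

End Moduli.

Section Covering.
Variable G : finite_quiver.

Local Notation lattice := {ffun farr G -> int}.

Definition unit_vector (a : farr G) : lattice := [ffun b => (b == a)%:Z].

Definition covering : quiver :=
  @Quiver (fvert G * lattice)%type (farr G * lattice)%type
    (fun b => (fsrc b.1, b.2))
    (fun b => (ftgt b.1, b.2 + unit_vector b.1)).

Definition covering_dim : Type := {fsfun vert covering -> nat with 0%N}.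

Definition equivalent (beta beta' : covering_dim) : Prop :=
  exists xi : lattice, forall i chi, beta' (i, chi) = beta (i, chi + xi).

Variable alpha : fvert G -> nat.

Definition compatible (beta : covering_dim) : Prop :=
  forall i, (\sum_(v <- finsupp beta | v.1 == i) beta v)%N = alpha i.

Definition representatives (B : set covering_dim) : Prop :=
  B `<=` compatible /\
  forall beta, compatible beta -> exists! beta', B beta' /\ equivalent beta beta'.

(* A decomposition of each C^(alpha i) into consecutive blocks of coordinates
   of sizes beta (i, chi). *)
Record decomposition (beta : covering_dim) := Decomposition {
  block : forall v : vert covering, 'I_(beta v) -> 'I_(alpha v.1);
  block_consecutive : forall v,
    exists o, forall k : 'I_(beta v), block k = (o + k)%N :> nat;
  block_bij : forall i (m : 'I_(alpha i)),
    exists! u : {chi : lattice & 'I_(beta (i, chi))}, block (tagged u) = m }.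

Section Block.
Variables (K : fieldType) (beta : covering_dim) (D : decomposition beta).

Definition to_blocks (g : gl K alpha) : gl K (V := vert covering) beta :=
  fun v => mxsub (@block _ D v) (@block _ D v) (g v.1).

Definition block_diagonal (g : gl K alpha) : Prop :=
  forall i chi chi' (k : 'I_(beta (i, chi))) (l : 'I_(beta (i, chi'))),
    chi != chi' -> g i (block D k) (block D l) = 0.

(* GL_beta as a subgroup of GL_alpha; since T_alpha is contained in it, w has a
   representative in GL_beta if and only if its permutation matrix is there. *)
Definition in_GL_beta (g : gl K alpha) : Prop := in_GL g /\ block_diagonal g.

Definition weyl_beta : Type := {w : weyl alpha | in_GL_beta (wdot K w)}.
Definition WeylBeta w (h : in_GL_beta (wdot K w)) : weyl_beta := exist _ w h.

Lemma block_inj v : injective (@block _ D v).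
Proof.
case: v => i chi k l kl; have [u [_ uU]] := block_bij D (block D l).
have := uU (Tagged _ k) kl; rewrite (uU (Tagged _ l) erefl) => /eqP.
by rewrite eq_Tagged => /eqP.
Qed.

Lemma to_blocksM (g h : gl K alpha) : block_diagonal g \/ block_diagonal h ->
  to_blocks (fun v => g v *m h v) = fun v => to_blocks g v *m to_blocks h v.
Proof.
move=> gD; apply: functional_extensionality_dep => -[i chi].
apply/matrixP => k l; rewrite !mxE /=.
rewrite (bigID (mem [set block D k' | k' : 'I_(beta (i, chi))]%SET)) /= addrC.
rewrite big1 ?add0r => [|m mU].
  rewrite big_imset => [|k' l' _ _ /(@block_inj (i, chi)) //].
  by apply: eq_big => [?|k' _]; rewrite ?mxE // inE.
have [[chi' k'] [/= mE _]] := block_bij D m.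
have [chiE|chiN] := eqVneq chi chi'; last first.
  by rewrite -mE; case: gD => hD; [rewrite hD ?mul0r|rewrite [h _ _ _]hD ?mulr0 // eq_sym].
by case/imsetP: mU; rewrite -mE; move: k' {mE}; rewrite -chiE => k'; exists k'.
Qed.

Lemma to_blocks1 : to_blocks (fun v => 1%:M) = fun v => 1%:M.
Proof.
apply: functional_extensionality_dep => v; apply/matrixP => k l.
by rewrite !mxE (inj_eq (@block_inj v)).
Qed.

Lemma block_diagonal_t (s : gl K alpha) : in_t s -> block_diagonal s.
Proof.
move=> st i chi chi' k l chiN; have /is_diag_mxP := st i; apply.
apply: contraNneq chiN => /val_inj kl.
have [u [_ uU]] := block_bij D (block D l).
by have := uU (Tagged _ k) kl; rewrite (uU (Tagged _ l) erefl) => /(congr1 tag) /= -> .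
Qed.

Lemma to_blocks_unit (g : gl K alpha) : in_GL_beta g -> in_GL (to_blocks g).
Proof.
case=> gu gD v.
have := to_blocksM (g := g) (h := fun v => invmx (g v)) (or_introl gD).
rewrite (_ : (fun v => _ *m _) = fun v => 1%:M); last first.
  by apply: functional_extensionality_dep => u; rewrite mulmxV.
by rewrite to_blocks1 => /(congr1 (@^~ v)) /esym/mulmx1_unit [].
Qed.

Lemma to_blocks_conj (g : gl K alpha) s : in_GL_beta g -> in_t s ->
  to_blocks (gl_conj g s) = gl_conj (to_blocks g) (to_blocks s).
Proof.
move=> gB st; have [gu gD] := gB; have tu := to_blocks_unit gB.
have mE : (fun v => gl_conj g s v *m g v) = fun v => g v *m s v.
  by apply: functional_extensionality_dep => v; rewrite /gl_conj mulmxKV.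
have := congr1 to_blocks mE.
rewrite (to_blocksM (or_introl gD)) (to_blocksM (or_intror gD)).
move=> /(congr1 (fun f => fun v => f v *m invmx (to_blocks g v))) mE'.
rewrite /gl_conj -[RHS]mE'; apply: functional_extensionality_dep => v.
by rewrite mulmxK.
Qed.

Definition moduli_beta : space K := moduli to_blocks.

Definition weyl_beta_act (v : weyl_beta) : moduli_beta -> moduli_beta :=
  weyl_act (to_blocks_unit (svalP v)) (fun s => to_blocks_conj (svalP v)).

(* v.(x, w) = (v.x, v w), where the pair (x, w) is existT _ w x. *)
Definition bundle_rel
    (u u' : sum_space (fun _ : weyl alpha => moduli_beta)) : Prop :=
  exists v : weyl_beta,
    u' = existT _ (wmul (sval v) (tag u)) (weyl_beta_act v (tagged u)).

Lemma weyl_beta_actE (v v1 v2 : weyl_beta) (p : moduli_beta) :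
  sval v = wmul (sval v1) (sval v2) ->
  weyl_beta_act v1 (weyl_beta_act v2 p) = weyl_beta_act v p.
Proof.
move=> vE; apply: character_eq => f /=; congr (ev p _); apply: eq_exist.
apply/funext => x /=; congr (sval f _); apply: eq_exist.
have wE : wdot K (sval v) = fun i => wdot K (sval v1) i *m wdot K (sval v2) i.
  by apply: functional_extensionality_dep => i; rewrite vE /wdot perm_mxM.
have [_ v1D] := svalP v1.
have u1 := to_blocks_unit (svalP v1); have u2 := to_blocks_unit (svalP v2).
have u := to_blocks_unit (svalP v).
have bE i : to_blocks (wdot K (sval v)) i =
    to_blocks (wdot K (sval v1)) i *m to_blocks (wdot K (sval v2)) i.
  by rewrite wE (to_blocksM (or_introl v1D)).
rewrite /weyl_triple /=; congr Triple; apply: functional_extensionality_dep => i.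
  apply: (can_inj (mulmxK (u i))).
  by rewrite mulmxKV // bE mulmxA mulmxKV // mulmxKV.
by apply/matrixP => k l; rewrite !gl_conj_wdotE vE !permM.
Qed.

Lemma in_GL_beta1 (w : weyl alpha) : w = (fun i => 1%g) -> in_GL_beta (wdot K w).
Proof.
move=> ->; split; first exact: wdot_GL.
apply: block_diagonal_t => i; rewrite /wdot perm_mx1.
exact: scalar_mx_is_diag.
Qed.

Lemma in_GL_betaM (v w : weyl alpha) : in_GL_beta (wdot K v) ->
  in_GL_beta (wdot K w) -> in_GL_beta (wdot K (wmul v w)).
Proof.
move=> [_ vD] [_ wD]; split; first exact: wdot_GL.
move=> i chi chi' k l chiN; rewrite /wdot perm_mxM !mxE big1 // => m _.
have [[chi2 m'] [/= <- _]] := block_bij D m.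
have [chiE|chiN'] := eqVneq chi chi2; last by rewrite [X in X * _]vD ?mul0r.
by rewrite [X in _ * X]wD ?mulr0 // -chiE.
Qed.

Lemma in_GL_betaV (w : weyl alpha) : in_GL_beta (wdot K w) ->
  in_GL_beta (wdot K (winv w)).
Proof.
move=> [_ wD]; split; first exact: wdot_GL.
move=> i chi chi' k l chiN; rewrite /wdot /winv !mxE.
have := wD i chi' chi l k; rewrite eq_sym => /(_ chiN); rewrite /wdot !mxE.
by rewrite -(can_eq (permK (w i)) _ (block D l)) permKV eq_sym.
Qed.

Lemma weyl_beta_act1 (v : weyl_beta) (p : moduli_beta) :
  sval v = (fun i => 1%g) -> weyl_beta_act v p = p.
Proof.
move=> vE; apply: character_eq => -[f fP] /=; congr (ev p _); apply: eq_exist.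
apply/funext => -[x xP] /=; congr f; apply: eq_exist => /=.
have bE i : to_blocks (wdot K (sval v)) i = 1%:M.
  rewrite -[RHS]/((fun i => 1%:M) i) -to_blocks1; congr (to_blocks _ i).
  by apply: functional_extensionality_dep => j; rewrite vE /wdot perm_mx1.
case: x xP => a a' h s _; rewrite /weyl_triple /=; congr Triple.
  by apply: functional_extensionality_dep => i; rewrite bE invmx1 mulmx1.
apply: functional_extensionality_dep => i; apply/matrixP => k l.
by rewrite !gl_conj_wdotE vE !perm1.
Qed.

Lemma bundle_rel_refl u : bundle_rel u u.
Proof.
exists (WeylBeta (in_GL_beta1 erefl)); case: u => w p /=.
rewrite weyl_beta_act1 //; congr existT.
by apply: functional_extensionality_dep => i; rewrite /wmul mul1g.
Qed.

Lemma bundle_rel_sym u u' : bundle_rel u u' -> bundle_rel u' u.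
Proof.
case=> v ->; pose v' : weyl_beta := WeylBeta (in_GL_betaV (svalP v)).
exists v'; case: u => w p /=.
rewrite (@weyl_beta_actE (WeylBeta (in_GL_betaM (svalP v') (svalP v)))) //.
rewrite weyl_beta_act1 /=; last first.
  by apply: functional_extensionality_dep => i; rewrite /wmul /winv mulVg.
congr existT; apply: functional_extensionality_dep => i.
by rewrite /wmul /winv mulKg.
Qed.

Lemma bundle_rel_trans u u' u'' :
  bundle_rel u u' -> bundle_rel u' u'' -> bundle_rel u u''.
Proof.
case=> v -> [v' ->]; exists (WeylBeta (in_GL_betaM (svalP v') (svalP v))).
case: u => w p /=.
rewrite (@weyl_beta_actE (WeylBeta (in_GL_betaM (svalP v') (svalP v)))) //.
by congr existT; apply: functional_extensionality_dep => i; rewrite /wmul mulgA.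
Qed.

Lemma bundle_cls u u' : bundle_rel u u' -> cls bundle_rel u = cls bundle_rel u'.
Proof.
move=> uu'; apply: eq_exist; apply/predeqP => z; split; apply: bundle_rel_trans.
  exact: bundle_rel_sym.
exact: uu'.
Qed.

Lemma bundle_crepr u : bundle_rel u (crepr (cls bundle_rel u)).
Proof.
have /(congr1 sval) /= <- := creprK (cls bundle_rel u); exact: bundle_rel_refl.
Qed.

Definition bundle_space : space K := quot_space bundle_rel.

(* w'.[x, w] = [x, w w'^-1] and [x, w] |-> w^-1 pi(x) w; independence of the
   representative is bundle_actE and bundle_projE. *)
Definition bundle_act (w : weyl alpha) (c : bundle_space) : bundle_space :=
  cls bundle_rel
    (existT _ (wmul (tag (crepr c)) (winv w)) (tagged (crepr c))).

Definition bundle_proj (c : bundle_space) : gl K alpha :=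
  gl_conj (wdot K (winv (tag (crepr c)))) (moduli_proj (tagged (crepr c))).

Lemma bundle_actE w v x : bundle_act w (cls bundle_rel (existT _ v x)) =
  cls bundle_rel (existT _ (wmul v (winv w)) x).
Proof.
apply/esym/bundle_cls; have [z ->] := bundle_crepr (existT _ v x).
exists z => /=; congr existT; apply: functional_extensionality_dep => i.
by rewrite /wmul mulgA.
Qed.

Lemma bundle_projE v x : bundle_proj (cls bundle_rel (existT _ v x)) =
  gl_conj (wdot K (winv v)) (moduli_proj x).
Proof.
rewrite /bundle_proj; have [z ->] /= := bundle_crepr (existT _ v x).
apply: functional_extensionality_dep => i; apply/matrixP => k l.
rewrite !gl_conj_wdotE !mxE /=; congr (ev x _).
apply: eq_exist; apply/funext => y /=; rewrite gl_conj_wdotE /winv /wmul.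
by rewrite !invMg !permM !permKV.
Qed.

Definition bundle : wspace K alpha := WSpace bundle_act bundle_proj.

End Block.

Section FixedLocus.
Variable K : fieldType.

Definition moduli_alpha : space K :=
  moduli (Q := G) (d := alpha) (fun g : gl K alpha => g).

Definition torus_alpha_act (t : farr G -> K) (t_neq0 : forall b, t b != 0) :
    moduli_alpha -> moduli_alpha :=
  torus_act (Q := G) (t := t) t_neq0.

Definition weyl_alpha_act (w : weyl alpha) : moduli_alpha -> moduli_alpha :=
  weyl_act (Q := G) (d := alpha) (blk := fun g : gl K alpha => g)
    (@wdot_GL K _ _ w) (fun s _ => erefl).

Definition fixed (p : moduli_alpha) : Prop :=
  forall t (t_neq0 : forall b : farr G, t b != 0), torus_alpha_act t_neq0 p = p.

Lemma fixed_weyl w p : fixed p -> fixed (weyl_alpha_act w p).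
Proof.
move=> pf t t_neq0.
by rewrite /torus_alpha_act /weyl_alpha_act weyl_torus_commute [torus_act _ p]pf.
Qed.

Definition fixed_locus : wspace K alpha :=
  @WSpace _ _ _ (subspace fixed)
    (fun w p => exist _ (weyl_alpha_act w (sval p)) (fixed_weyl w (svalP p)))
    (fun p => moduli_proj (sval p)).

End FixedLocus.

Definition covering_union (K : fieldType) (B : set covering_dim)
    (D : forall b : {beta | B beta}, decomposition (sval b)) : wspace K alpha :=
  @WSpace _ _ _ (sum_space (fun b => bundle K (D b)))
    (fun w u => existT _ (tag u) (wact w (tagged u)))
    (fun u => wproj (tagged u)).

End Covering.

(* Main.v *)
Require Import Defs.
From mathcomp Require Import all_boot all_order all_algebra all_fingroup.
From mathcomp Require Import finmap boolp classical_sets fsbigop.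
From mathcomp Require Import reals complex.
From mathcomp Require mxred.
From mathcomp Require Import ring.

Set Implicit Arguments.
Unset Strict Implicit.
Unset Printing Implicit Defensive.

Import GRing.Theory.

Local Open Scope classical_set_scope.
Local Open Scope ring_scope.

(** Write C for the set of all coordinates of C^alpha. Using the frame h, a point
    (phi, h, sigma) of the family is described by the matrix coefficients of
    h^-1 phi h, one for each arrow a and each pair of coordinates at its end
    points. They are invariant under GL_alpha, and for each edge the coefficients
    of phi_a and phi_a^* have opposite weights under T_alpha. Since no partial sum
    of sigma over a proper non-empty S in C vanishes, and this sum only involves
    products phi_a(l, k) phi_a^*(k, l) over edges between S and its complement
    (sig_crossing), the edges at which a point y of the moduli space does not
    vanish connect C (active_connected). Products along paths of such edges give
    functions u_c whose weights identify each coordinate c with a base point; they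
    normalise representations near y. This yields a representation (normal_form)
    at which y is the evaluation (chi_normal), and turns fractions of polynomials
    into fractions of invariants (approximate_fraction).

    Each coefficient also has a weight under T, namely e_a or -e_a. If y is
    fixed by T, an invariant function on which y does not vanish has weight zero,
    because a field element of infinite order separates the characters of T. The
    T-weights of the functions u_c therefore form a labelling of C by Z^(arrows)
    that every non-zero coefficient of the normal form respects
    (fixed_supported): y comes from a representation of the covering quiver. By
    connectedness such a labelling is unique up to a common shift (rigid).
    Its fibres have the sizes given by a dimension vector beta of the covering,
    compatible with alpha and defined up to equivalence, and two labellings with
    the same fibre sizes differ by an element of W. This gives the bijection of
    points: fixed_translate for surjectivity and translate_inj for injectivity.
    The stabiliser of a labelling up to shift is W_beta, since a permutation that
    shifts all labels by xi preserves their sum, so that xi = 0.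

    It remains to compare topologies and functions. Gluing blocks gives a map
    cover_map from the moduli space of beta into the fixed locus. Its image is
    open there, because the edges active at one point determine the labelling at
    the fixed points near it (cover_map_open), and every regular function
    on the source is locally a fraction of functions from the target
    (cover_map_lift), which also makes the map injective. *)

(** * Regular functions *)

Section Regular.
Variables (K : fieldType) (E : Type) (coord : set (E -> K)) (X : set E).

Definition regular_on (f : {x | X x} -> K) : Prop :=
  sect (s := locally_closed_space coord X) setT f.

Lemma regular_polyfun p : polyfun coord p -> regular_on (p \o sval).
Proof.
move=> pP x _; exists (p \o sval), (fun=> 1); split=> //=.
- by exists p.
- by exists (fun=> 1) => //; apply: polyfun_cst.
- exact: oner_neq0.
- by move=> y _ _; rewrite divr1.
Qed.

Lemma regular_coord f : coord f -> regular_on (f \o sval).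
Proof. by move=> fc; apply: regular_polyfun; apply: polyfun_coord. Qed.

Lemma regular_cst c : regular_on (fun=> c).
Proof. exact: (regular_polyfun (polyfun_cst coord c)). Qed.

Lemma regular_add f g :
  regular_on f -> regular_on g -> regular_on (fun x => f x + g x).
Proof.
move=> fr gr x _.
have [_ [_ [[p pP ->] [q qP ->] qx fE]]] := fr x I.
have [_ [_ [[p' pP' ->] [q' qP' ->] qx' gE]]] := gr x I.
exists ((fun y => p y * q' y + p' y * q y) \o sval),
  ((fun y => q y * q' y) \o sval); split=> //=.
- eexists; last reflexivity.
  by apply: polyfun_add; apply: polyfun_mul.
- by eexists; last reflexivity; apply: polyfun_mul.
- by rewrite mulf_neq0.
- move=> y _; rewrite mulf_eq0 negb_or => /andP[qy qy'].
  by rewrite fE // gE // addf_div.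
Qed.

Lemma regular_mul f g :
  regular_on f -> regular_on g -> regular_on (fun x => f x * g x).
Proof.
move=> fr gr x _.
have [_ [_ [[p pP ->] [q qP ->] qx fE]]] := fr x I.
have [_ [_ [[p' pP' ->] [q' qP' ->] qx' gE]]] := gr x I.
exists ((fun y => p y * p' y) \o sval), ((fun y => q y * q' y) \o sval).
split=> //=.
- by eexists; last reflexivity; apply: polyfun_mul.
- by eexists; last reflexivity; apply: polyfun_mul.
- by rewrite mulf_neq0.
- move=> y _; rewrite mulf_eq0 negb_or => /andP[qy qy'].
  by rewrite fE // gE // mulf_div.
Qed.

Lemma regular_inv f : (forall x, f x != 0) ->
  regular_on f -> regular_on (fun x => (f x)^-1).
Proof.
move=> f0 fr x _; have [p [q [pA qA qx fE]]] := fr x I.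
have px : p x != 0.
  by apply: contra_neq (f0 x) => px; rewrite fE // px mul0r.
have [[p' pP pE] [q' qP qE]] := (pA, qA).
exists (fun y => q y * q y), (fun y => p y * q y); split.
- exists (fun y => q' y * q' y); first exact: polyfun_mul.
  by rewrite qE.
- exists (fun y => p' y * q' y); first exact: polyfun_mul.
  by rewrite qE pE.
- by rewrite mulf_neq0.
- move=> y _; rewrite mulf_eq0 negb_or => /andP[py qy].
  by rewrite fE // invf_div -mulf_div divff // mulr1.
Qed.

Lemma regular_sum (I : finType) (P : pred I) (F : I -> {x | X x} -> K) :
  (forall i, regular_on (F i)) -> regular_on (fun x => \sum_(i | P i) F i x).
Proof.
move=> Fr; elim: (index_enum I) => [|i r IH].
  rewrite (_ : (fun x => _) = fun=> 0); first exact: regular_cst.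
  by apply/funext => x; rewrite big_nil.
rewrite (_ : (fun x => _) = fun x => (P i)%:R * F i x + \sum_(j <- r | P j) F j x).
  by apply: regular_add => //; apply: regular_mul => //; apply: regular_cst.
apply/funext => x; rewrite big_cons.
by case: (P i); rewrite ?mul1r ?mul0r ?add0r.
Qed.

Lemma regular_prod (I : finType) (P : pred I) (F : I -> {x | X x} -> K) :
  (forall i, regular_on (F i)) -> regular_on (fun x => \prod_(i | P i) F i x).
Proof.
move=> Fr; elim: (index_enum I) => [|i r IH].
  rewrite (_ : (fun x => _) = fun=> 1); first exact: regular_cst.
  by apply/funext => x; rewrite big_nil.
rewrite (_ : (fun x => _) =
    fun x => (if P i then F i x else 1) * \prod_(j <- r | P j) F j x).
  by apply: regular_mul => //; case: (P i) => //; apply: regular_cst.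
by apply/funext => x; rewrite big_cons; case: (P i); rewrite ?mul1r.
Qed.

Definition regular_mx m n (M : {x | X x} -> 'M[K]_(m, n)) : Prop :=
  forall i j, regular_on (fun x => M x i j).

Lemma regular_mulmx m n r (M : {x | X x} -> 'M[K]_(m, n))
    (N : {x | X x} -> 'M[K]_(n, r)) :
  regular_mx M -> regular_mx N -> regular_mx (fun x => M x *m N x).
Proof.
move=> Mr Nr i j.
rewrite (_ : (fun x => _) = fun x => \sum_k M x i k * N x k j).
  by apply: regular_sum => k; apply: regular_mul.
by apply/funext => x; rewrite mxE.
Qed.

Lemma regular_det n (M : {x | X x} -> 'M[K]_n) :
  regular_mx M -> regular_on (fun x => \det (M x)).
Proof.
move=> Mr; apply: regular_sum => s; apply: regular_mul.
  exact: regular_cst.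
exact: regular_prod.
Qed.

Lemma regular_invmx n (M : {x | X x} -> 'M[K]_n) :
  (forall x, M x \in unitmx) -> regular_mx M ->
  regular_mx (fun x => invmx (M x)).
Proof.
move=> Mu Mr i j.
rewrite (_ : (fun x => _) = fun x => (\det (M x))^-1 * cofactor (M x) j i).
  apply: regular_mul.
    apply: regular_inv => [x|]; last exact: regular_det.
    by have := Mu x; rewrite unitmxE unitfE.
  apply: regular_mul; first exact: regular_cst.
  apply: regular_det => k l.
  rewrite (_ : (fun x => _) = fun x => M x (lift j k) (lift i l)) //.
  by apply/funext => x; rewrite !mxE.
by apply/funext => x; rewrite /invmx Mu !mxE.
Qed.

End Regular.

(** * Characters *)

Section Characters.
Variables (K : fieldType) (P : Type) (A : set (P -> K)).

(** Total version of the evaluation of a character, which spares the proofs of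
    membership in the algebra inside formulas. *)
Definition chi_at (c : character A) (f : P -> K) : K :=
  if pselect (A f) is left h then ev c (exist _ f h) else 0.

Variable c : character A.

Lemma evE (f : {f | A f}) : ev c f = chi_at c (sval f).
Proof.
case: f => f fA; rewrite /chi_at /=; case: pselect => // h.
by congr (ev c _); apply: eq_exist.
Qed.

Lemma chi_cst k : A (fun=> k) -> chi_at c (fun=> k) = k.
Proof.
by move=> h; rewrite -[fun=> k]/(sval (exist A _ h)) -evE; apply: ev_cst.
Qed.

Lemma chi_add f g : A f -> A g -> A (fun x => f x + g x) ->
  chi_at c (fun x => f x + g x) = chi_at c f + chi_at c g.
Proof.
move=> fA gA h; rewrite -[fun x => _]/(sval (exist A _ h)) -evE.
rewrite -[f]/(sval (exist A _ fA)) -[g]/(sval (exist A _ gA)) -!evE.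
exact: ev_add.
Qed.

Lemma chi_mul f g : A f -> A g -> A (fun x => f x * g x) ->
  chi_at c (fun x => f x * g x) = chi_at c f * chi_at c g.
Proof.
move=> fA gA h; rewrite -[fun x => _]/(sval (exist A _ h)) -evE.
rewrite -[f]/(sval (exist A _ fA)) -[g]/(sval (exist A _ gA)) -!evE.
exact: ev_mul.
Qed.

End Characters.

Lemma character_ext (K : fieldType) P (A : set (P -> K)) (p q : character A) :
  (forall f, A f -> chi_at p f = chi_at q f) -> p = q.
Proof.
by move=> pq; apply: character_eq => -[f fA]; rewrite !evE; apply: pq.
Qed.

Lemma chi_spec_map (K : fieldType) (P Q : Type) (A : set (P -> K))
    (B : set (Q -> K)) (g : P -> Q) (gBA : forall f, B f -> A (f \o g))
    (p : spec A) f :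
  B f -> chi_at (spec_map gBA p) f = chi_at p (f \o g).
Proof.
move=> fB; rewrite -[f]/(sval (exist B _ fB)) -evE /= evE //.
Qed.

(** * Finitely supported sums *)

Lemma fsum_finite (J : finType) (V : zmodType) (f : J -> V) :
  \sum_(b \in [set: J]) f b = \sum_a f a.
Proof.
apply: etrans (fsbig_fwiden (enum J) _ _ _ _ _) _.
- by move=> a _ /=; rewrite mem_enum.
- exact: enum_uniq.
- by move=> a [_ []].
- by rewrite big_enum.
Qed.

Lemma fsum_image (J : choiceType) (J0 : finType) (V : zmodType) (h : J0 -> J)
    (f : J -> V) : injective h -> (forall b, f b != 0 -> exists a, b = h a) ->
  \sum_(b \in [set: J]) f b = \sum_a f (h a).
Proof.
move=> hi fh; transitivity (\sum_(b \in h @` [set: J0]) f b).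
  apply/esym/fsbig_widen => // b [_ nb] /=.
  by apply: contra_notP nb => /eqP/fh[a ->]; exists a.
rewrite fsbig_image ?fsum_finite // => a a' _ _; exact: hi.
Qed.

(** The two families live on different finite sets, so both are first summed over
    the union of these. *)
Lemma fsum_sub (J : choiceType) (J0 : finType) (V : zmodType) (h h' : J0 -> J)
    (f f' : J -> V) : injective h -> injective h' ->
  (forall b, f b != 0 -> exists a, b = h a) ->
  (forall b, f' b != 0 -> exists a, b = h' a) ->
  \sum_(b \in [set: J]) (f b - f' b) = \sum_a (f (h a) - f' (h' a)).
Proof.
move=> hi hi' fh fh'; rewrite [RHS]sumrB -!fsum_image //.
pose r := undup ([seq h a | a : J0] ++ [seq h' a | a : J0]).
have rE (g : J -> V) : (forall b, b \notin r -> g b = 0) ->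
    \sum_(b \in [set: J]) g b = \sum_(b <- r) g b.
  move=> gr; rewrite [RHS]fsbig_seq ?undup_uniq //.
  by apply/esym/fsbig_widen => // b [_ /negP nb]; apply: gr.
have fr b : b \notin r -> f b = 0.
  apply: contraNeq => /fh[a ->]; rewrite mem_undup mem_cat.
  by rewrite map_f ?mem_enum.
have fr' b : b \notin r -> f' b = 0.
  apply: contraNeq => /fh'[a ->]; rewrite mem_undup mem_cat orbC.
  by rewrite map_f ?mem_enum.
rewrite !rE ?sumrB // => b br.
by rewrite fr // fr' // subr0.
Qed.

(** * Regular generic elements *)

Section Generic.
Variables (K : fieldType) (I : finType) (alpha : I -> nat).

Definition coordinates : Type := {i : I & 'I_(alpha i)}.

Local Notation crd k := (Tagged (fun i => 'I_(alpha i)) k).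

Definition entry (s : gl K alpha) (c : coordinates) : K :=
  s (tag c) (tagged c) (tagged c).

(** The trace of f on the row space of an idempotent p that commutes with f does
    not depend on the chosen basis of that space. *)
Lemma trace_idempotent n (U p f : 'M[K]_n) :
  (U <= p)%MS -> (p <= U)%MS -> stablemx U f ->
  p *m p = p -> p *m f = f *m p ->
  \tr (mxred.restrictmx U f) = \tr (p *m f).
Proof.
move=> Up pU stU pp pf; rewrite -stablemx_row_base in stU.
rewrite (@trace_conjmx _ _ _ _ _ p f) ?eq_row_base //.
rewrite /mxred.conjmx.
have pK : p *m pinvmx p *m p = p by apply: mulmxKpV.
have pfp : p *m f = p *m f *m p by rewrite -mulmxA -pf mulmxA pp.
  by rewrite {1}pfp -[X in \tr X]mulmxA mxtrace_mulC mulmxA pK.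
by rewrite (eq_row_base U) in stU.
Qed.

Definition coord_proj (S : pred coordinates) : gl K alpha :=
  fun v => diag_mx (\row_k (S (crd k))%:R).

Lemma coord_projE (S : pred coordinates) v k l :
  coord_proj S v k l = (S (crd k) && (k == l))%:R.
Proof. by rewrite !mxE; case: eqP => [->|]; case: S. Qed.

Lemma coord_proj_mul (S : pred coordinates) v n (M : 'M[K]_(alpha v, n)) k l :
  (coord_proj S v *m M) k l = (S (crd k))%:R * M k l.
Proof. by rewrite mul_diag_mx !mxE. Qed.

Lemma mul_coord_proj (S : pred coordinates) v n (M : 'M[K]_(n, alpha v)) k l :
  (M *m coord_proj S v) k l = M k l * (S (crd l))%:R.
Proof. by rewrite mul_mx_diag !mxE. Qed.

Lemma coord_proj_idem S v : coord_proj S v *m coord_proj S v = coord_proj S v.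
Proof.
by apply/matrixP => k l; rewrite coord_proj_mul coord_projE; case: S; rewrite ?mul1r ?mul0r.
Qed.

Lemma in_tP (s : gl K alpha) : in_t s -> forall v k l, k != l -> s v k l = 0.
Proof. by move=> st v k l kl; have /is_diag_mxP := st v; apply. Qed.

Lemma coord_proj_comm S (s : gl K alpha) v : in_t s ->
  coord_proj S v *m s v = s v *m coord_proj S v.
Proof.
move=> st; apply/matrixP => k l; rewrite coord_proj_mul mul_coord_proj.
have [->|kl] := eqVneq k l; first by rewrite mulrC.
by rewrite (in_tP st) // mulr0 mul0r.
Qed.

Lemma trace_coord_proj S (s : gl K alpha) :
  \sum_v \tr (coord_proj S v *m s v) = \sum_(c | S c) entry s c.
Proof.
pose F v (k : 'I_(alpha v)) := if S (crd k) then s v k k else 0.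
transitivity (\sum_v \sum_k F v k).
  apply: eq_bigr => v _; apply: eq_bigr => k _; rewrite coord_proj_mul /F {F}.
  by case: S; rewrite ?mul1r ?mul0r.
rewrite [RHS]big_mkcond /= sig_big_dep /=.
by apply: eq_bigr => -[].
Qed.

Section FromGeneric.
Variables (s : gl K alpha) (sgen : in_tgen s).

(** If two entries agreed, the transposition matrix of their positions would
    centralise s without being diagonal. *)
Lemma tgen_distinct v k l : k != l -> s v k k != s v l l.
Proof.
move=> kl; have [st sr _] := sgen; apply/eqP => skl.
pose w : weyl alpha := dfwith (fun u => 1%g : 'S_(alpha u)) (tperm k l).
have gu : in_GL (wdot K w) by apply: wdot_GL.
have [_ wt] : in_T (wdot K w).
  apply/(sr _ gu) => u; have uu := gu u.
  apply: (can_inj (mulmxKV uu)); rewrite -[LHS]/(gl_conj (wdot K w) s u).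
  rewrite mulmxK //; apply/matrixP => i j; rewrite gl_conj_wdotE /w.
  have [uv|uv] := eqVneq v u; last by rewrite dfwith_out // !perm1.
  case: _ / uv i j => i j; rewrite dfwith_in.
  have [->|ij] := eqVneq i j; last first.
    by rewrite !(in_tP st) // (inj_eq perm_inj).
  by case: tpermP => [->|->|].
have := in_tP wt kl; rewrite /wdot /w dfwith_in !mxE tpermL eqxx => /eqP.
by rewrite oner_eq0.
Qed.

Lemma tgen_trace : \sum_c entry s c = 0.
Proof.
have [_ _ [s0 _]] := sgen; rewrite -[RHS]s0.
have <- := trace_coord_proj predT s; apply: eq_bigr => v _; congr (\tr _).
by apply/matrixP => k l; rewrite coord_proj_mul mul1r.
Qed.

(** The coordinates in S span a graded subspace stable under s. *)
Lemma tgen_subset (S : pred coordinates) c0 c1 : S c0 -> ~~ S c1 ->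
  \sum_(c | S c) entry s c != 0.
Proof.
move=> Sc0 Sc1; have [st _ [_ sg]] := sgen.
have stab v : stablemx (coord_proj S v) (s v).
  by rewrite coord_proj_comm // submxMl.
have := sg (coord_proj S) stab.
have -> : \sum_v \tr (mxred.restrictmx (coord_proj S v) (s v)) =
          \sum_(c | S c) entry s c.
  rewrite -trace_coord_proj; apply: eq_bigr => v _; apply: trace_idempotent => //.
    exact: coord_proj_idem.
  exact: coord_proj_comm.
apply=> [U0|U1].
  have /matrixP/(_ (tagged c0) (tagged c0)) := U0 (tag c0).
  rewrite coord_projE mxE eqxx andbT; case: c0 Sc0 => i k /= -> /eqP.
  by rewrite oner_eq0.
case: c1 Sc1 => i k Sc1; have /row_fullP[M /matrixP/(_ k k)] := U1 i.
rewrite mul_coord_proj mxE eqxx (negPf Sc1) mulr0 => /eqP.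
by rewrite eq_sym oner_eq0.
Qed.

End FromGeneric.

(** Applying the product of the f - f l l with l != k to a row of U leaves a
    non-zero multiple of the k-th unit vector. *)
Lemma stable_coordinate n (U f : 'M[K]_n) :
  (forall k l, k != l -> f k l = 0) ->
  (forall k l, k != l -> f k k != f l l) ->
  stablemx U f ->
  forall k i, U i k != 0 -> ((delta_mx 0 k : 'rV_n) <= U)%MS.
Proof.
move=> fd fN stU k i Uik.
have stab (r : seq 'I_n) : k \notin r ->
    exists2 u : 'rV_n, (u <= U)%MS & u 0 k != 0 /\ forall l, l \in r -> u 0 l = 0.
  elim: r => [|m r IH] /=.
    by move=> _; exists (row i U); [exact: row_sub|rewrite mxE].
  rewrite inE negb_or => /andP[km /IH[u uU [uk ur]]].
  have uE l : (u *m f - f m m *: u) 0 l = (f l l - f m m) * u 0 l.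
    rewrite !mxE (bigD1 l) //= big1 ?addr0 => [|j jl].
      by rewrite mulrBl mulrC.
    by rewrite fd ?mulr0.
  exists (u *m f - f m m *: u); last first.
    split=> [|l]; first by rewrite uE mulf_neq0 // subr_eq0 fN.
    rewrite inE uE => /predU1P[->|/ur ->]; first by rewrite subrr mul0r.
    by rewrite mulr0.
  rewrite addmx_sub ?eqmx_opp ?scalemx_sub //.
  by rewrite (submx_trans _ stU) ?submxMr.
have [u uU [uk ur]] := stab [seq l <- enum 'I_n | l != k] ltac:(by rewrite mem_filter eqxx).
rewrite (_ : delta_mx 0 k = (u 0 k)^-1 *: u) ?scalemx_sub //.
apply/rowP => l; rewrite !mxE eqxx /=; have [->|lk] := eqVneq l k.
  by rewrite mulVf.
have -> : u 0 l = 0 by apply: ur; rewrite mem_filter lk mem_enum.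
by rewrite mulr0.
Qed.

(** Distinct entries force a stable graded subspace to be spanned by coordinates,
    so that only finitely many partial sums matter for genericity. *)
Lemma tgen_criterion (s : gl K alpha) : in_t s ->
  (forall v k l, k != l -> s v k k != s v l l) ->
  \sum_c entry s c = 0 ->
  (forall (S : pred coordinates) c0 c1, S c0 -> ~~ S c1 ->
    \sum_(c | S c) entry s c != 0) ->
  in_tgen s.
Proof.
move=> st sN s0 sS; split=> //.
  move=> g gu; split=> [gs|[_ gt] v]; last first.
    apply/matrixP => k l; rewrite !mxE (bigD1 k) //= [RHS](bigD1 k) //=.
    rewrite !big1 ?addr0 => [|j jk|j jk].
    - have [->|kl] := eqVneq k l; first by rewrite mulrC.
      by rewrite (in_tP st) // mulr0 (in_tP gt) // mulr0.
    - by rewrite (in_tP st) 1?eq_sym // mul0r.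
    - by rewrite (in_tP gt) 1?eq_sym // mul0r.
  split=> // v; apply/is_diag_mxP => k l kl.
  have /matrixP/(_ k l) := gs v.
  rewrite !mxE (bigD1 l) //= [RHS](bigD1 k) //=.
  rewrite !big1 ?addr0 => [|j jk|j jl].
  - move=> /eqP; rewrite mulrC -subr_eq0 -mulrBl mulf_eq0 subr_eq0.
    by rewrite (negPf (sN _ _ _ _)) 1?eq_sym //= => /eqP.
  - by rewrite (in_tP st) 1?eq_sym // mul0r.
  - by rewrite (in_tP st) // mulr0.
split.
  transitivity (\sum_(c | predT c) entry s c); last exact: s0.
  rewrite -trace_coord_proj.
  apply: eq_bigr => v _; congr (\tr _).
  by apply/matrixP => k l; rewrite coord_proj_mul mul1r.
move=> U stU U0 U1.
pose S : pred coordinates :=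
  fun c => [exists i, U (tag c) i (tagged c) != 0].
have SU c : S c -> ((delta_mx 0 (tagged c) : 'rV_(alpha (tag c))) <= U (tag c))%MS.
  case/existsP => i; apply: stable_coordinate (stU (tag c)) _ i => k l.
    exact: in_tP.
  exact: sN.
have PU v : (coord_proj S v <= U v)%MS.
  apply/row_subP => k; have -> : row k (coord_proj S v) =
      (S (crd k))%:R *: (delta_mx 0 k : 'rV_(alpha v)).
    apply/rowP => l; rewrite [LHS]mxE coord_projE !mxE eqxx /= eq_sym.
    by case: (S _); rewrite ?mul1r ?mul0r.
  have [/SU kU|_] := boolP (S _); last by rewrite scale0r sub0mx.
  by rewrite scale1r.
have UP v : (U v <= coord_proj S v)%MS.
  have {1}-> : U v = U v *m coord_proj S v; last exact: submxMl.
  apply/matrixP => i k; rewrite mul_coord_proj.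
  have [->|Uik] := eqVneq (U v i k) 0; first by rewrite mul0r.
  have -> : S (crd k) by apply/existsP; exists i.
  by rewrite mulr1.
have -> : \sum_v \tr (mxred.restrictmx (U v) (s v)) = \sum_(c | S c) entry s c.
  rewrite -trace_coord_proj; apply: eq_bigr => v _; apply: trace_idempotent => //.
    exact: coord_proj_idem.
  exact: coord_proj_comm.
have [c0 Sc0] : exists c, S c.
  apply: contrapT => nS; apply: U0 => v; apply/matrixP => i k; rewrite mxE.
  apply: contra_notP nS => /eqP Uik.
  by exists (crd k); apply/existsP; exists i.
have [c1 Sc1] : exists c, ~~ S c.
  apply: contrapT => nS; apply: U1 => v; rewrite -sub1mx.
  have -> // : 1%:M = coord_proj S v.
  apply/matrixP => i k; rewrite coord_projE mxE.
  have -> // : S (crd i).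
  by apply: contrapT => /negP nSi; apply: nS; exists (crd i).
exact: sS Sc0 Sc1.
Qed.

End Generic.

(** * The invariant algebra *)

Section Invariants.
Variables (K : fieldType) (I : finType) (alpha : I -> nat).
Variables (Q : quiver) (d : vert Q -> nat) (blk : gl K alpha -> gl K d).

Local Notation family := {x : triple K alpha d | in_family blk x}.
Local Notation A := (invariants (blk := blk)).
Implicit Types f g : family -> K.

Lemma invariants_cst c : A (fun=> c).
Proof. by split=> //; apply: regular_cst. Qed.

Lemma invariants_add f g : A f -> A g -> A (fun x => f x + g x).
Proof.
move=> [fr fi] [gr gi]; split; first exact: regular_add.
by move=> h t x y hu tT yE; rewrite (fi h t x y) // (gi h t x y).
Qed.

Lemma invariants_mul f g : A f -> A g -> A (fun x => f x * g x).
Proof.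
move=> [fr fi] [gr gi]; split; first exact: regular_mul.
by move=> h t x y hu tT yE; rewrite (fi h t x y) // (gi h t x y).
Qed.

Lemma invariants_inv f : (forall x, f x != 0) -> A f -> A (fun x => (f x)^-1).
Proof.
move=> f0 [fr fi]; split; first exact: regular_inv.
by move=> h t x y hu tT yE; rewrite (fi h t x y).
Qed.

Lemma invariants_sum (J : finType) (P : pred J) (F : J -> family -> K) :
  (forall j, A (F j)) -> A (fun x => \sum_(j | P j) F j x).
Proof.
move=> FA; split; first by apply: regular_sum => j; case: (FA j).
move=> h t x y hu tT yE; apply: eq_bigr => j _.
by have [_ /(_ h t x y)->] := FA j.
Qed.

Lemma invariants_prod (J : finType) (P : pred J) (F : J -> family -> K) :
  (forall j, A (F j)) -> A (fun x => \prod_(j | P j) F j x).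
Proof.
move=> FA; split; first by apply: regular_prod => j; case: (FA j).
move=> h t x y hu tT yE; apply: eq_bigr => j _.
by have [_ /(_ h t x y)->] := FA j.
Qed.

Variable y : character A.

Lemma chiC c : chi_at y (fun=> c) = c.
Proof. by apply: chi_cst; apply: invariants_cst. Qed.

Lemma chiD f g : A f -> A g ->
  chi_at y (fun x => f x + g x) = chi_at y f + chi_at y g.
Proof. by move=> fA gA; apply: chi_add => //; apply: invariants_add. Qed.

Lemma chiM f g : A f -> A g ->
  chi_at y (fun x => f x * g x) = chi_at y f * chi_at y g.
Proof. by move=> fA gA; apply: chi_mul => //; apply: invariants_mul. Qed.

Lemma chiZ c f : A f -> chi_at y (fun x => c * f x) = c * chi_at y f.
Proof. by move=> fA; rewrite chiM ?chiC //; apply: invariants_cst. Qed.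

Lemma chiN f : A f -> chi_at y (fun x => - f x) = - chi_at y f.
Proof.
move=> fA; rewrite -mulN1r -chiZ //; congr (chi_at y _).
by apply/funext => x; rewrite mulN1r.
Qed.

Lemma invariants_opp f : A f -> A (fun x => - f x).
Proof.
move=> fA; rewrite (_ : (fun x => _) = fun x => -1 * f x).
  by apply: invariants_mul => //; apply: invariants_cst.
by apply/funext => x; rewrite mulN1r.
Qed.

Lemma chi_sum (J : finType) (P : pred J) (F : J -> family -> K) :
  (forall j, A (F j)) ->
  chi_at y (fun x => \sum_(j | P j) F j x) = \sum_(j | P j) chi_at y (F j).
Proof.
move=> FA.
have ind (r : seq J) : A (fun x => \sum_(j <- r | P j) F j x) /\
  chi_at y (fun x => \sum_(j <- r | P j) F j x) = \sum_(j <- r | P j) chi_at y (F j).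
  elim: r => [|j r [IHA IH]].
    rewrite big_nil (_ : (fun x => _) = fun=> 0).
      by split; [exact: invariants_cst | exact: chiC].
    by apply/funext => x; rewrite big_nil.
  rewrite big_cons; case Pj: (P j); last first.
    rewrite (_ : (fun x => _) = fun x => \sum_(j <- r | P j) F j x) //.
    by apply/funext => x; rewrite big_cons Pj.
  rewrite (_ : (fun x => _) = fun x => F j x + \sum_(j <- r | P j) F j x).
    by rewrite chiD // IH; split=> //; apply: invariants_add.
  by apply/funext => x; rewrite big_cons Pj.
by case: (ind (index_enum J)).
Qed.

Lemma chi_unit f g : A f -> A g -> (forall x, f x * g x = 1) -> chi_at y f != 0.
Proof.
move=> fA gA fg; apply/eqP => f0; have := chiM fA gA.
rewrite (_ : (fun x => _) = fun=> 1); last exact/funext.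
by rewrite chiC f0 mul0r => /eqP; rewrite oner_eq0.
Qed.

(** A character does not vanish on a unit, and a regular function without zeros
    has a regular inverse. *)
Lemma chi_neq0 f : A f -> (forall x, f x != 0) -> chi_at y f != 0.
Proof.
move=> fA f0; apply: (chi_unit fA (invariants_inv f0 fA)) => x.
exact: mulfV.
Qed.

Lemma chi_prod_neq0 (J : finType) (P : pred J) (F : J -> family -> K) :
  (forall j, A (F j)) -> (forall j, P j -> chi_at y (F j) != 0) ->
  chi_at y (fun x => \prod_(j | P j) F j x) != 0.
Proof.
move=> FA F0.
suff ind (r : seq J) : A (fun x => \prod_(j <- r | P j) F j x) /\
  chi_at y (fun x => \prod_(j <- r | P j) F j x) != 0.
  by case: (ind (index_enum J)).
elim: r => [|j r [IHA IH]].
  rewrite (_ : (fun x => _) = fun=> 1).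
    by rewrite chiC oner_neq0; split=> //; apply: invariants_cst.
  by apply/funext => x; rewrite big_nil.
case Pj: (P j); last first.
  rewrite (_ : (fun x => _) = fun x => \prod_(j <- r | P j) F j x) //.
  by apply/funext => x; rewrite big_cons Pj.
rewrite (_ : (fun x => _) = fun x => F j x * \prod_(j <- r | P j) F j x).
  by rewrite chiM // mulf_neq0 ?F0 //; split=> //; apply: invariants_mul.
by apply/funext => x; rewrite big_cons Pj.
Qed.

End Invariants.

(** * Matrix coefficients in the moving frame *)

Section Quiver.
Variables (K : fieldType) (G : finite_quiver) (alpha : fvert G -> nat).

Definition rep : Type := triple K alpha (Q := G) alpha.
Definition in_fam (x : rep) : Prop :=
  in_family (Q := G) (d := alpha) (fun g : gl K alpha => g) x.
Definition fam : Type := {x : rep | in_fam x}.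
Definition inv_alg : set (fam -> K) :=
  invariants (Q := G) (d := alpha) (blk := fun g : gl K alpha => g).

Local Notation A := inv_alg.
Local Notation lattice := {ffun farr G -> int}.
Local Notation crd k := (Tagged (fun i => 'I_(alpha i)) k).
Local Notation coord := (coordinates alpha).

Implicit Types (x : fam) (a : farr G) (xi : lattice).

Definition weight (c : coord) : gl K alpha -> K := fun t => entry t c.

(** Conjugation by the frame makes the coefficients invariant under GL_alpha; the
    torus T_alpha still acts on them. *)
Definition arrow_mx (x : rep) a : 'M[K]_(alpha (ftgt a), alpha (fsrc a)) :=
  invmx (frm x (ftgt a)) *m @phi K _ alpha G alpha x a *m frm x (fsrc a).

Definition coarrow_mx (x : rep) a : 'M[K]_(alpha (fsrc a), alpha (ftgt a)) :=
  invmx (frm x (fsrc a)) *m @phis K _ alpha G alpha x a *m frm x (ftgt a).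

Definition arrow a l k x : K := arrow_mx (sval x) a l k.
Definition coarrow a k l x : K := coarrow_mx (sval x) a k l.

Arguments arrow : clear implicits.
Arguments coarrow : clear implicits.

Definition torus_char (t : farr G -> K) xi : K := \prod_a t a ^ xi a.

Lemma torus_charD t xi ze : (forall a, t a != 0) ->
  torus_char t (xi + ze) = torus_char t xi * torus_char t ze.
Proof.
move=> t0; rewrite -big_split /=; apply: eq_bigr => a _.
by rewrite ffunE expfzDr.
Qed.

Lemma torus_charN t xi : torus_char t (- xi) = (torus_char t xi)^-1.
Proof.
rewrite -prodfV; apply: eq_bigr => a _.
by rewrite ffunE invr_expz.
Qed.

Lemma torus_char0 t : torus_char t 0 = 1.
Proof. by apply: big1 => a _; rewrite ffunE expr0z. Qed.

Lemma torus_char_unit t a : torus_char t (unit_vector a) = t a.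
Proof.
rewrite /torus_char (bigD1 a) //= big1 => [|b ba]; rewrite ffunE.
  by rewrite eqxx mulr1 expr1z.
by rewrite (negPf ba) expr0z.
Qed.

(** Functions carry two weights for T_alpha and not only their quotient, so that
    they compose like the arrows of a path: the coefficients of a path of
    arrows are graded by its two end points. Arbitrary functions are allowed as
    weights because a frame needs a base weight even when there are no
    coordinates. *)
Record graded (p q : gl K alpha -> K) xi (F : fam -> K) : Prop := Graded {
  graded_regular : regular_on (@coordinate K _ alpha G alpha) F;
  graded_gauge : forall g t x y, in_GL g -> in_T t ->
    sval y = gauge (Q := G) (d := alpha) (fun g : gl K alpha => g) g t (sval x) ->
    F y = (p t)^-1 * F x * q t;
  graded_torus : forall t x y, (forall a, t a != 0) ->
    sval y = torus_triple (Q := G) t (sval x) -> F y = torus_char t xi * F x }.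

Definition nonzero_weight (q : gl K alpha -> K) : Prop :=
  forall t, in_T t -> q t != 0.

Lemma entry_nonzero c : nonzero_weight (weight c).
Proof.
move=> t [tu tt]; case: c => v k; rewrite /weight /entry /=.
have := tu v; rewrite unitmxE unitfE.
have -> : \det (t v) = \prod_i t v i i.
  have /is_diag_mxP tv := tt v.
  rewrite det_trig; first by [].
  by apply/is_trig_mxP => i j ij; apply: tv; rewrite neq_ltn ij.
by move/prodf_neq0; apply.
Qed.

Lemma graded_mul p q r xi ze F H : nonzero_weight q ->
  graded p q xi F -> graded q r ze H ->
  graded p r (xi + ze) (fun x => F x * H x).
Proof.
move=> q0 [Fr Fg Ft] [Hr Hg Ht]; split; first exact: regular_mul.
  move=> g t x y gu tT yE; rewrite (Fg g t x y) // (Hg g t x y) //.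
  by rewrite -!mulrA; congr (_ * (_ * _)); rewrite mulVKf ?q0.
move=> t x y t0 yE; rewrite (Ft t x y) // (Ht t x y) // torus_charD //.
by rewrite mulrACA.
Qed.

Lemma graded1 p : nonzero_weight p -> graded p p 0 (fun=> 1).
Proof.
move=> p0; split; first exact: regular_cst.
  by move=> g t x y _ tT _; rewrite mulr1 mulVf ?p0.
by move=> t x y _ _; rewrite torus_char0 mulr1.
Qed.

Lemma graded_invariant p xi F : nonzero_weight p -> graded p p xi F -> A F.
Proof.
move=> p0 [Fr Fg _]; split=> // g t x y gu tT yE.
by rewrite (Fg g t x y) // mulrAC mulVf ?mul1r ?p0.
Qed.

Lemma frm_unit x : in_GL (frm (sval x)).
Proof. by case: x => x []. Qed.

Lemma invmx_mul n (g h : 'M[K]_n) : g \in unitmx -> h \in unitmx ->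
  invmx (g *m h) = invmx h *m invmx g.
Proof.
move=> gu hu; have ghu : g *m h \in unitmx by rewrite unitmx_mul gu.
apply: (can_inj (mulKmx ghu)); rewrite mulmxV // -!mulmxA.
by rewrite (mulmxA h) mulmxV // mul1mx mulmxV.
Qed.

(** The group element g cancels against the frame, and only t remains. *)
Lemma gauge_arrow g t x (y : rep) a : in_GL g -> in_T t ->
  y = gauge (Q := G) (d := alpha) (fun g : gl K alpha => g) g t (sval x) ->
  arrow_mx y a = invmx (t (ftgt a)) *m arrow_mx (sval x) a *m t (fsrc a).
Proof.
move=> gu [tu _] ->; have hu := frm_unit x; rewrite /arrow_mx /=.
rewrite !invmx_mul ?unitmx_mul ?gu ?hu ?tu // !mulmxA.
by rewrite !mulmxKV ?gu.
Qed.

Lemma gauge_coarrow g t x (y : rep) a : in_GL g -> in_T t ->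
  y = gauge (Q := G) (d := alpha) (fun g : gl K alpha => g) g t (sval x) ->
  coarrow_mx y a = invmx (t (fsrc a)) *m coarrow_mx (sval x) a *m t (ftgt a).
Proof.
move=> gu [tu _] ->; have hu := frm_unit x; rewrite /coarrow_mx /=.
rewrite !invmx_mul ?unitmx_mul ?gu ?hu ?tu // !mulmxA.
by rewrite !mulmxKV ?gu.
Qed.

Lemma diag_conjE m n (s : 'M[K]_m) (t : 'M[K]_n) (M : 'M[K]_(m, n)) k l :
  s \in unitmx -> is_diag_mx s -> is_diag_mx t ->
  (invmx s *m M *m t) k l = (s k k)^-1 * M k l * t l l.
Proof.
move=> su /is_diag_mxP sd /is_diag_mxP td; rewrite !mxE (bigD1 l) //= big1 ?addr0.
  congr (_ * _); set N := invmx s *m M.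
  have -> : M = s *m N by rewrite mulKVmx.
  have sk : s k k != 0.
    have := mulmxV su; move/matrixP/(_ k k); rewrite !mxE (bigD1 k) //= big1.
      rewrite addr0 eqxx => h; apply/eqP => s0; move/eqP: h.
      by rewrite s0 mul0r eq_sym oner_eq0.
    by move=> i ik; rewrite sd ?mul0r // eq_sym.
  rewrite [(s *m N) k l]mxE (bigD1 k) //= big1 ?addr0.
    by rewrite mulKf.
  by move=> i ik; rewrite sd ?mul0r // eq_sym.
by move=> i il; rewrite td ?mulr0.
Qed.

Lemma regular_arrow_mx a : regular_mx (@coordinate K _ alpha G alpha)
  (fun x : fam => arrow_mx (sval x) a).
Proof.
apply: regular_mulmx; last first.
  move=> i j; apply: (regular_coord (f := fun x : rep => frm x (fsrc a) i j)).
  by apply: Or43; exists (fsrc a), i, j.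
apply: regular_mulmx; last first.
  move=> i j; apply: (regular_coord (f := fun x : rep => @phi K _ alpha G alpha x a i j)).
  by apply: Or41; exists a, i, j.
apply: regular_invmx => [x|i j]; first exact: frm_unit.
apply: (regular_coord (f := fun x : rep => frm x (ftgt a) i j)).
by apply: Or43; exists (ftgt a), i, j.
Qed.

Lemma graded_arrow a l k : graded (weight (crd l)) (weight (crd k))
  (unit_vector a) (arrow a l k).
Proof.
split.
- exact: regular_arrow_mx.
- move=> g t x y gu tT yE; rewrite /arrow (gauge_arrow a gu tT yE).
  by have [tu tt] := tT; rewrite diag_conjE.
- move=> t x y t0 yE; rewrite torus_char_unit /arrow /arrow_mx yE /=.
  by rewrite -scalemxAr -scalemxAl mxE.
Qed.

Arguments graded_arrow : clear implicits.

Lemma regular_coarrow_mx a : regular_mx (@coordinate K _ alpha G alpha)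
  (fun x : fam => coarrow_mx (sval x) a).
Proof.
apply: regular_mulmx; last first.
  move=> i j; apply: (regular_coord (f := fun x : rep => frm x (ftgt a) i j)).
  by apply: Or43; exists (ftgt a), i, j.
apply: regular_mulmx; last first.
  move=> i j; apply: (regular_coord (f := fun x : rep => @phis K _ alpha G alpha x a i j)).
  by apply: Or42; exists a, i, j.
apply: regular_invmx => [x|i j]; first exact: frm_unit.
apply: (regular_coord (f := fun x : rep => frm x (fsrc a) i j)).
by apply: Or43; exists (fsrc a), i, j.
Qed.

Lemma graded_coarrow a k l : graded (weight (crd k)) (weight (crd l))
  (- unit_vector a) (coarrow a k l).
Proof.
split.
- exact: regular_coarrow_mx.
- move=> g t x y gu tT yE; rewrite /coarrow (gauge_coarrow a gu tT yE).
  by have [tu tt] := tT; rewrite diag_conjE.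
- move=> t x y t0 yE; rewrite torus_charN torus_char_unit /coarrow /coarrow_mx yE /=.
  by rewrite -scalemxAr -scalemxAl mxE.
Qed.

Arguments graded_coarrow : clear implicits.

Lemma invariant_edge a l k : A (fun x => arrow a l k x * coarrow a k l x).
Proof.
apply: (@graded_invariant (weight (crd l))); first exact: entry_nonzero.
apply: graded_mul (graded_arrow a l k) (graded_coarrow a k l).
exact: entry_nonzero.
Qed.

Lemma sig_invariant v i j : A (fun x => sig (sval x) v i j).
Proof. exact: sig_coord. Qed.

End Quiver.

Arguments arrow {K G alpha} a l k x.
Arguments coarrow {K G alpha} a k l x.
Arguments graded_arrow {K G alpha} a l k.
Arguments graded_coarrow {K G alpha} a k l.
Arguments invariant_edge {K G alpha} a l k.

(** * The moment map and connectedness *)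

Section Moment.
Variables (K : fieldType) (G : finite_quiver) (alpha : fvert G -> nat).

Local Notation lattice := {ffun farr G -> int}.
Local Notation crd k := (Tagged (fun i => 'I_(alpha i)) k).
Local Notation coord := (coordinates alpha).
Local Notation fam := (fam K alpha).
Local Notation A := (@inv_alg K G alpha).
Local Notation component w := (@in_component K G alpha w).

Implicit Types (x : fam) (a : farr G) (xi : lattice).

Lemma component_conj (h : gl K alpha) w (M : 'M[K]_(alpha w)) v :
  invmx (h v) *m component w M v *m h v = component w (invmx (h w) *m M *m h w) v.
Proof.
rewrite /in_component; have [e|ne] := eqVneq w v.
  by case: _ / e; rewrite !dfwith_in.
by rewrite !dfwith_out // mulmx0 mul0mx.
Qed.

Local Notation phiG := (@phi K _ alpha G alpha).
Local Notation phisG := (@phis K _ alpha G alpha).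

Lemma moment_finite (x : rep K alpha) v : moment x v =
  \sum_a (component (ftgt a) (phiG x a *m phisG x a) v
          - component (fsrc a) (phisG x a *m phiG x a) v).
Proof. exact: fsum_finite. Qed.

(** This is the moment map equation conjugated by the frame. *)
Lemma frame_moment x v : sig (sval x) v =
  \sum_a (component (ftgt a) (arrow_mx (sval x) a *m coarrow_mx (sval x) a) v
          - component (fsrc a) (coarrow_mx (sval x) a *m arrow_mx (sval x) a) v).
Proof.
have [hu _ /(_ v)] := svalP x; rewrite moment_finite /gl_conj => mE.
have {mE} := congr1 (fun M => invmx (frm (sval x) v) *m M *m frm (sval x) v) mE.
rewrite !mulmxA mulVmx // mul1mx mulmxKV // => <-.
rewrite mulmx_sumr mulmx_suml; apply: eq_bigr => a _.
rewrite mulmxBr mulmxBl !component_conj; congr (_ - _).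
  apply: (congr1 (fun M => component (ftgt a) M v)).
  by rewrite /arrow_mx /coarrow_mx !mulmxA mulmxK.
apply: (congr1 (fun M => component (fsrc a) M v)).
by rewrite /arrow_mx /coarrow_mx !mulmxA mulmxK.
Qed.

Lemma component_sum (S : pred coord) w (M : 'M[K]_(alpha w)) :
  \sum_(c | S c) entry (component w M) c = \sum_k (S (crd k))%:R * M k k.
Proof.
rewrite -trace_coord_proj (bigD1 w) //= big1 ?addr0 => [|v vw].
  by apply: eq_bigr => k _; rewrite coord_proj_mul /in_component dfwith_in.
by rewrite /in_component dfwith_out 1?eq_sym // mulmx0 mxtrace0.
Qed.

(** The sum of the entries of sigma over a set S of coordinates only sees the
    arrows between S and its complement, since tr [phi, phi^*] vanishes on the
    part inside S. *)
Lemma sig_crossing (S : pred coord) x : \sum_(c | S c) entry (sig (sval x)) c =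
  \sum_a \sum_l \sum_k ((S (crd l))%:R - (S (crd k))%:R)
    * (arrow a l k x * coarrow a k l x).
Proof.
rewrite (eq_bigr (fun c => \sum_a
  (entry (component (ftgt a) (arrow_mx (sval x) a *m coarrow_mx (sval x) a)) c
  - entry (component (fsrc a) (coarrow_mx (sval x) a *m arrow_mx (sval x) a)) c))).
  rewrite exchange_big /=; apply: eq_bigr => a _.
  rewrite sumrB !component_sum.
  have tE m n (M : 'M[K]_(m, n)) N (z : 'I_m -> K) :
      \sum_l z l * (M *m N) l l = \sum_l \sum_k z l * (M l k * N k l).
    by apply: eq_bigr => l _; rewrite mxE mulr_sumr.
  rewrite !tE [X in _ - X]exchange_big -sumrB; apply: eq_bigr => l _.
  rewrite -sumrB; apply: eq_bigr => k _.
  by rewrite mulrBl [coarrow_mx _ _ _ _ * _]mulrC.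
move=> c _; rewrite /entry frame_moment summxE.
by apply: eq_bigr => a _; rewrite !mxE.
Qed.

Definition edge : Type := {a : farr G & 'I_(alpha (ftgt a)) * 'I_(alpha (fsrc a))}%type.
Definition edge_fun (e : edge) : fam -> K :=
  fun x => arrow (tag e) (tagged e).1 (tagged e).2 x
           * coarrow (tag e) (tagged e).2 (tagged e).1 x.
Definition edge_head (e : edge) : coord := crd (tagged e).1.
Definition edge_tail (e : edge) : coord := crd (tagged e).2.

Lemma invariant_edge_fun e : A (edge_fun e).
Proof. exact: invariant_edge. Qed.

(** Connectedness through boundaries of sets rather than through paths: this is
    what genericity gives, and what arguments with sets closed under edges use. *)
Definition connected_edges (E : edge -> Prop) : Prop :=
  forall (S : pred coord) c0 c1, S c0 -> ~~ S c1 ->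
    exists2 e, E e & S (edge_head e) != S (edge_tail e).

Definition active (y : character A) (e : edge) : Prop :=
  chi_at y (edge_fun e) != 0.

(** The sum of sigma over S has no zeros on the family, so y does not vanish on it,
    hence not on one of the terms of sig_crossing. *)
Lemma active_connected (y : character A) : connected_edges (active y).
Proof.
move=> S c0 c1 Sc0 Sc1; apply: contrapT => noe.
have sA : A (fun x => \sum_(c | S c) entry (sig (sval x)) c).
  by apply: invariants_sum => c; apply: sig_invariant.
have /negP[] : chi_at y (fun x => \sum_(c | S c) entry (sig (sval x)) c) != 0.
  apply: chi_neq0 => // x; have [_ xt _] := svalP x.
  exact: tgen_subset Sc0 Sc1.
rewrite (_ : (fun x => _) = fun x : fam => \sum_a \sum_l \sum_k
    ((S (crd l))%:R - (S (crd k))%:R) * (arrow a l k x * coarrow a k l x)); last first.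
  by apply/funext => x; rewrite sig_crossing.
have eA a l k : A (fun x => ((S (crd l))%:R - (S (crd k))%:R) *
    (arrow a l k x * coarrow a k l x)).
  by apply: invariants_mul; [apply: invariants_cst | apply: invariant_edge].
rewrite chi_sum => [|a]; last by do 2![apply: invariants_sum => ?]; apply: eA.
rewrite big1 // => a _; rewrite chi_sum => [|l]; last by apply: invariants_sum => ?; apply: eA.
rewrite big1 // => l _; rewrite chi_sum => [|k]; last exact: eA.
rewrite big1 // => k _.
rewrite chiZ; last exact: invariant_edge.
have [->|Slk] := eqVneq (S (crd l)) (S (crd k)); first by rewrite subrr mul0r.
apply/eqP; rewrite mulf_eq0; apply/orP; right; apply: contrapT => /negP y0.
by apply: noe; exists (existT _ a (l, k)).
Qed.

(** * Frames *)

(** Functions u c and u' c that identify, near a point y of the moduli space,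
    the weight of each coordinate c with a common weight. They serve to
    normalise representations near y by the action of T_alpha. *)
Record frame (y : character A) := Frame {
  fbase : gl K alpha -> K;
  fu : coord -> fam -> K;
  fu' : coord -> fam -> K;
  fxi : coord -> lattice;
  fxi' : coord -> lattice;
  fbase_neq0 : nonzero_weight fbase;
  fu_graded : forall c, graded fbase (weight c) (fxi c) (fu c);
  fu'_graded : forall c, graded (weight c) fbase (fxi' c) (fu' c);
  fu_neq0 : forall c, chi_at y (fun x => fu c x * fu' c x) != 0 }.

(** Existence of functions that identify the weights of c and c' near y. For an
    edge on which y does not vanish these are its two coefficients, and linked
    coordinates compose along paths. *)
Definition linked (y : character A) (c c' : coord) : Prop :=
  exists u u' xi xi', [/\ graded (weight c) (weight c') xi u,
    graded (weight c') (weight c) xi' u' & chi_at y (fun x => u x * u' x) != 0].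

Lemma linked_trans y c1 c2 c3 : linked y c1 c2 -> linked y c2 c3 -> linked y c1 c3.
Proof.
move=> [u [u' [xi [xi' [ug u'g u0]]]]] [v [v' [ze [ze' [vg v'g v0]]]]].
have nz c := @entry_nonzero K G alpha c.
exists (fun x => u x * v x), (fun x => v' x * u' x), (xi + ze), (ze' + xi').
split; [exact: graded_mul ug vg | exact: graded_mul v'g u'g |].
rewrite (_ : (fun x => _) = fun x => (u x * u' x) * (v x * v' x)); last first.
  by apply/funext => x; ring.
rewrite chiM ?mulf_neq0 //.
  by apply: (graded_invariant (nz c1)) (graded_mul (nz c2) ug u'g).
by apply: (graded_invariant (nz c2)) (graded_mul (nz c3) vg v'g).
Qed.

Lemma linked_all y c c' : linked y c c'.
Proof.
apply: contrapT => ncc'; pose S : pred coord := fun c' => `[< linked y c c' >].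
have Sc : S c.
  apply/asboolP; exists (fun=> 1), (fun=> 1), 0, 0.
  have g1 := graded1 (@entry_nonzero K G alpha c).
  split=> //; rewrite (_ : (fun x => _) = fun=> 1) ?chiC ?oner_neq0 //.
  by apply/funext => x; rewrite mulr1.
have Sc' : ~~ S c' by apply/asboolP.
have [[a [l k]] ea] := active_connected y Sc Sc'; rewrite /edge_head /edge_tail /=.
have lk : linked y (crd l) (crd k).
  exists (arrow a l k), (coarrow a k l), (unit_vector a), (- unit_vector a).
  by split=> //; [apply: graded_arrow | apply: graded_coarrow].
have kl : linked y (crd k) (crd l).
  exists (coarrow a k l), (arrow a l k), (- unit_vector a), (unit_vector a).
  split=> //; [exact: graded_coarrow | exact: graded_arrow|].
  rewrite (_ : (fun x => _) = edge_fun (existT _ a (l, k))) //.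
  by apply/funext => x; rewrite mulrC.
move=> /eqP []; apply/idP/idP => /asboolP cl; apply/asboolP.
  exact: linked_trans cl lk.
exact: linked_trans cl kl.
Qed.

Lemma frame_exists y : inhabited (frame y).
Proof.
have [[c0 _]|nc] := pselect (exists c0 : coord, True).
  pose g c := cid (linked_all y c0 c).
  pose g1 c := cid (svalP (g c)).
  pose g2 c := cid (svalP (g1 c)).
  pose g3 c := cid (svalP (g2 c)).
  split; apply: (@Frame y (weight c0) (fun c => sval (g c))
    (fun c => sval (g1 c)) (fun c => sval (g2 c)) (fun c => sval (g3 c))).
  - exact: entry_nonzero.
  - by move=> c; have [] := svalP (g3 c).
  - by move=> c; have [] := svalP (g3 c).
  - by move=> c; have [] := svalP (g3 c).
split; apply: (@Frame y (fun=> 1) (fun _ _ => 0) (fun _ _ => 0) (fun=> 0) (fun=> 0)).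
- by move=> t _; apply: oner_neq0.
all: by move=> c; case: nc; exists c.
Qed.

End Moment.

(** * Normal forms *)

Section Normal.
Variables (K : fieldType) (G : finite_quiver) (alpha : fvert G -> nat).

Local Notation lattice := {ffun farr G -> int}.
Local Notation crd k := (Tagged (fun i => 'I_(alpha i)) k).
Local Notation coord := (coordinates alpha).
Local Notation fam := (fam K alpha).
Local Notation A := (@inv_alg K G alpha).
Local Notation component w := (@in_component K G alpha w).
Local Notation Rep := (@Triple K _ alpha G alpha).
Local Notation phiG := (@phi K _ alpha G alpha).
Local Notation phisG := (@phis K _ alpha G alpha).
Local Notation gaugeG := (gauge (Q := G) (d := alpha) (fun g : gl K alpha => g)).

Implicit Types (x : fam) (a : farr G) (xi : lattice).

Lemma moduli_projE (y : moduli_alpha alpha K) v i j :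
  moduli_proj y v i j = chi_at y (fun x => sig (sval x) v i j).
Proof. by rewrite mxE evE. Qed.

Variables (y : moduli_alpha alpha K) (F : frame y).
Local Notation u := (fu F).
Local Notation u' := (fu' F).

Lemma invariant_uu c : A (fun x => u c x * u' c x).
Proof.
apply: (graded_invariant (fbase_neq0 F)).
exact: graded_mul (@entry_nonzero K G alpha c) (fu_graded F c) (fu'_graded F c).
Qed.

Lemma invariant_ufu c c' xi f : graded (weight c) (weight c') xi f ->
  A (fun x => u c x * f x * u' c' x).
Proof.
move=> fg; have nz c := @entry_nonzero K G alpha c.
apply: (graded_invariant (fbase_neq0 F)).
apply: graded_mul (nz c') _ (fu'_graded F c').
exact: graded_mul (nz c) (fu_graded F c) fg.
Qed.

(** The value at y of the coefficient f after normalisation by u. Writing 1 / u c'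
    as u' c' / (u c' u' c') makes numerator and denominator invariant. *)
Definition normalized c c' (f : fam -> K) : K :=
  chi_at y (fun x => u c x * f x * u' c' x) / chi_at y (fun x => u c' x * u' c' x).

(** Both sides of the numerator identity are values of y on the same product,
    because the inner factors u c2 and u' c2 only change places. *)
Lemma normalized_mul c1 c2 c3 xi ze f g :
  graded (weight c1) (weight c2) xi f -> graded (weight c2) (weight c3) ze g ->
  normalized c1 c3 (fun x => f x * g x) = normalized c1 c2 f * normalized c2 c3 g.
Proof.
move=> fg gg; have nz c := @entry_nonzero K G alpha c.
have fgg := graded_mul (nz c2) fg gg.
have c0 c := fu_neq0 F c.
have e : chi_at y (fun x => u c1 x * f x * u' c2 x) *
      chi_at y (fun x => u c2 x * g x * u' c3 x) =
    chi_at y (fun x => u c1 x * (f x * g x) * u' c3 x) *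
      chi_at y (fun x => u c2 x * u' c2 x).
  rewrite -!chiM; [|exact: (invariant_ufu fgg)|exact: invariant_uu
    |exact: (invariant_ufu fg)|exact: (invariant_ufu gg)].
  by congr (chi_at y _); apply/funext => x; ring.
by rewrite /normalized mulf_div e invfM mulrA mulfK.
Qed.

Lemma normalized_sum (J : finType) c c' xi (f : J -> fam -> K) :
  (forall j, graded (weight c) (weight c') xi (f j)) ->
  normalized c c' (fun x => \sum_j f j x) = \sum_j normalized c c' (f j).
Proof.
move=> fg; rewrite /normalized -mulr_suml -chi_sum => [|j]; last first.
  exact: invariant_ufu (fg j).
congr (chi_at y _ / _); apply/funext => x.
by rewrite mulr_sumr mulr_suml.
Qed.

Definition graded_mx w w' xi (M : fam -> 'M[K]_(alpha w, alpha w')) : Prop :=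
  forall l k, graded (weight (crd l)) (weight (crd k)) xi (fun x => M x l k).

Definition normalized_mx w w' (M : fam -> 'M[K]_(alpha w, alpha w')) :
    'M[K]_(alpha w, alpha w') :=
  \matrix_(l, k) normalized (crd l) (crd k) (fun x => M x l k).

Lemma normalized_mulmx w w' xi ze (M : fam -> 'M[K]_(alpha w, alpha w'))
    (N : fam -> 'M[K]_(alpha w', alpha w)) k l :
  graded_mx xi M -> graded_mx ze N ->
  normalized (crd k) (crd l) (fun x => (M x *m N x) k l) =
    (normalized_mx M *m normalized_mx N) k l /\
  A (fun x => u (crd k) x * (M x *m N x) k l * u' (crd l) x).
Proof.
move=> Mg Ng; have nz c := @entry_nonzero K G alpha c.
have g j := graded_mul (nz _) (Mg k j) (Ng j l).
have e : (fun x => (M x *m N x) k l) = (fun x => \sum_j M x k j * N x j l).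
  by apply/funext => x; rewrite mxE.
split.
  rewrite e (normalized_sum g) mxE; apply: eq_bigr => j _.
  by rewrite (normalized_mul (Mg k j) (Ng j l)) !mxE.
rewrite (_ : (fun x => _) =
    fun x => \sum_j u (crd k) x * (M x k j * N x j l) * u' (crd l) x).
  by apply: invariants_sum => j; apply: invariant_ufu (g j).
by apply/funext => x; rewrite mxE mulr_sumr mulr_suml.
Qed.

Lemma normalized_component w w' xi ze (M : fam -> 'M[K]_(alpha w, alpha w'))
    (N : fam -> 'M[K]_(alpha w', alpha w)) v (k l : 'I_(alpha v)) :
  graded_mx xi M -> graded_mx ze N ->
  normalized (crd k) (crd l) (fun x => component w (M x *m N x) v k l) =
    component w (normalized_mx M *m normalized_mx N) v k l /\
  A (fun x => u (crd k) x * component w (M x *m N x) v k l * u' (crd l) x).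
Proof.
move=> Mg Ng; rewrite /in_component; have [e|ne] := eqVneq w v.
  case: _ / e k l => k l; rewrite dfwith_in.
  rewrite (_ : (fun x => _) = (fun x => (M x *m N x) k l)); last first.
    by apply/funext => x; rewrite dfwith_in.
  rewrite (_ : (fun x => u _ x * _ * _) =
      (fun x => u (crd k) x * (M x *m N x) k l * u' (crd l) x)); last first.
    by apply/funext => x; rewrite dfwith_in.
  exact: normalized_mulmx Mg Ng.
rewrite dfwith_out // mxE /normalized.
rewrite (_ : (fun x => _) = fun=> 0); last first.
  by apply/funext => x; rewrite dfwith_out // mxE mulr0 mul0r.
by rewrite chiC mul0r; split=> //; apply: invariants_cst.
Qed.

(** The representation with trivial frame that y describes after normalisation
    by u. *)
Definition normal_form : rep K alpha := Rep
  (fun a => normalized_mx (fun x => arrow_mx (sval x) a))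
  (fun a => normalized_mx (fun x => coarrow_mx (sval x) a))
  (fun v => 1%:M) (moduli_proj y).

Lemma chi_entry c : entry (moduli_proj y) c = chi_at y (fun x => entry (sig (sval x)) c).
Proof. by rewrite /entry moduli_projE. Qed.

Lemma chi_subset (S : pred coord) : \sum_(c | S c) entry (moduli_proj y) c =
  chi_at y (fun x => \sum_(c | S c) entry (sig (sval x)) c).
Proof.
rewrite chi_sum => [|c]; last exact: sig_invariant.
by apply: eq_bigr => c _; apply: chi_entry.
Qed.

Lemma in_tgen_sig x : in_tgen (sig (sval x)).
Proof. by case: x => x []. Qed.

(** Each inequality that defines t_alpha^gen says that some invariant function has
    no zeros on the family, which y respects by chi_neq0. *)
Lemma tgen_moduli_proj : in_tgen (moduli_proj y).
Proof.
apply: tgen_criterion.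
- move=> v; apply/is_diag_mxP => k l kl; rewrite moduli_projE.
  rewrite (_ : (fun x => _) = fun=> 0) ?chiC //; apply/funext => x.
  by have [st _ _] := in_tgen_sig x; rewrite (in_tP st).
- move=> v k l kl; rewrite -subr_eq0 !moduli_projE.
  have sA i j : A (fun x => sig (sval x) v i j) by apply: sig_invariant.
  have dA : A (fun x => - sig (sval x) v l l) by exact: invariants_opp (sA l l).
  rewrite -(chiN _ (sA l l)) -(chiD _ (sA k k) dA).
  apply: chi_neq0 => [|x]; first exact: invariants_add (sA k k) dA.
  by rewrite subr_eq0; apply: tgen_distinct kl; apply: in_tgen_sig.
- rewrite (chi_subset predT) (_ : (fun x => _) = fun=> 0) ?chiC //.
  by apply/funext => x; apply: tgen_trace; apply: in_tgen_sig.
- move=> S c0 c1 Sc0 Sc1; rewrite chi_subset; apply: chi_neq0.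
    by apply: invariants_sum => c; apply: sig_invariant.
  by move=> x; apply: tgen_subset Sc0 Sc1; apply: in_tgen_sig.
Qed.

(** The moment map equation is polynomial, and normalisation commutes with matrix
    products and sums; the equation holds for y because it holds on the family. *)
Lemma normal_form_in_fam : in_fam normal_form.
Proof.
split; [by move=> v; apply: unitmx1 | exact: tgen_moduli_proj |] => v.
rewrite moment_finite /gl_conj /= mul1mx invmx1 mulmx1.
apply/matrixP => k l.
have arrow_g a := graded_arrow (K := K) (alpha := alpha) a.
have coarrow_g a := fun k l => graded_coarrow (K := K) (alpha := alpha) a k l.
have mE : moduli_proj y v k l = normalized (crd k) (crd l)
    (fun x => sig (sval x) v k l).
  rewrite moduli_projE /normalized; have [->|kl] := eqVneq k l.
    rewrite (_ : (fun x => _ * _) = fun x => sig (sval x) v l l *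
        (u (crd l) x * u' (crd l) x)); last by apply/funext => x; ring.
    rewrite chiM ?mulfK ?fu_neq0 //; [exact: sig_invariant|exact: invariant_uu].
  have s0 x : sig (sval x) v k l = 0.
    by have [st _ _] := in_tgen_sig x; rewrite (in_tP st).
  rewrite (_ : (fun x => _) = fun=> 0); last exact/funext.
  rewrite (_ : (fun x => _ * _) = fun=> 0) ?chiC ?mul0r //.
  by apply/funext => x; rewrite s0 mulr0 mul0r.
rewrite mE summxE.
pose P a x := component (ftgt a) (arrow_mx (sval x) a *m coarrow_mx (sval x) a) v k l.
pose N a x := component (fsrc a) (coarrow_mx (sval x) a *m arrow_mx (sval x) a) v k l.
have [PE PA] : (forall a, normalized (crd k) (crd l) (P a) = component (ftgt a)
    (phiG normal_form a *m phisG normal_form a) v k l) /\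
    forall a, A (fun x => u (crd k) x * P a x * u' (crd l) x).
  by split=> a; have [] := normalized_component k l (arrow_g a) (coarrow_g a).
have [NE NA] : (forall a, normalized (crd k) (crd l) (N a) = component (fsrc a)
    (phisG normal_form a *m phiG normal_form a) v k l) /\
    forall a, A (fun x => u (crd k) x * N a x * u' (crd l) x).
  by split=> a; have [] := normalized_component k l (coarrow_g a) (arrow_g a).
transitivity (\sum_a (normalized (crd k) (crd l) (P a)
                      - normalized (crd k) (crd l) (N a))).
  by apply: eq_bigr => a _; rewrite PE NE !mxE.
rewrite /normalized; under eq_bigr do rewrite -mulrBl; rewrite -mulr_suml.
congr (_ / _); rewrite (_ : (fun x => _ * sig _ _ _ _ * _) = fun x => \sum_a
    (u (crd k) x * P a x * u' (crd l) x - u (crd k) x * N a x * u' (crd l) x)).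
  have NA' a := invariants_opp (NA a).
  rewrite chi_sum => [|a]; last exact: invariants_add (PA a) (NA' a).
  by apply: eq_bigr => a _; rewrite (chiD _ (PA a) (NA' a)) (chiN _ (NA a)).
apply/funext => x; rewrite frame_moment summxE mulr_sumr mulr_suml.
by apply: eq_bigr => a _; rewrite !mxE -mulrBl -mulrBr.
Qed.

Definition normal_point : fam := exist _ normal_form normal_form_in_fam.

(** The gauge transformation that makes the frame of a representation trivial
    and the functions u equal to one another. *)
Definition normalize x : rep K alpha := gaugeG
  (fun v => diag_mx (\row_k u (crd k) x) *m invmx (frm (sval x) v))
  (fun v => diag_mx (\row_k (u (crd k) x)^-1)) (sval x).

Lemma component_conjV (g : gl K alpha) w (M : 'M[K]_(alpha w)) v :
  g v *m component w M v *m invmx (g v) = component w (g w *m M *m invmx (g w)) v.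
Proof. by have := component_conj (fun v => invmx (g v)) M v; rewrite !invmxK. Qed.

Lemma gauge_in_fam g t x : in_GL g -> in_T t -> in_fam (gaugeG g t (sval x)).
Proof.
move=> gu [tu tt]; have [hu xt xm] := svalP x; split=> //= v.
  by rewrite !unitmx_mul gu hu tu.
transitivity (g v *m moment (sval x) v *m invmx (g v)).
  rewrite !moment_finite mulmx_sumr mulmx_suml; apply: eq_bigr => a _ /=.
  rewrite mulmxBr mulmxBl !component_conjV; congr (_ - _).
    apply: (congr1 (fun M => component (ftgt a) M v)).
    by rewrite !mulmxA mulmxKV.
  apply: (congr1 (fun M => component (fsrc a) M v)).
  by rewrite !mulmxA mulmxKV.
have [st sr _] := xt; have ts : t v *m sig (sval x) v = sig (sval x) v *m t v.
  by move: v; apply/(sr t tu).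
rewrite xm /gl_conj /= !invmx_mul ?unitmx_mul ?gu ?hu ?tu // !mulmxA.
by rewrite -(mulmxA _ (t v)) ts !mulmxA mulmxK.
Qed.

Lemma diag_inv n (d : 'rV[K]_n) : (forall k, d 0 k != 0) ->
  diag_mx d \in unitmx /\ invmx (diag_mx d) = diag_mx (\row_k (d 0 k)^-1).
Proof.
move=> d0; have dd : diag_mx d *m diag_mx (\row_k (d 0 k)^-1) = 1%:M.
  apply/matrixP => k l; rewrite mul_diag_mx !mxE.
  by case: eqP => [->|]; rewrite ?mulr0 // mulr1n mulfV.
have [du _] := mulmx1_unit dd; split=> //.
by apply: (can_inj (mulKmx du)); rewrite mulmxV.
Qed.

Section Normalize.
Variables (x : fam) (ux : forall c, u c x != 0).

Let d v : 'rV[K]_(alpha v) := \row_k u (crd k) x.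
Let D v : 'M[K]_(alpha v) := diag_mx (d v).

Let d_neq0 v k : d v 0 k != 0.
Proof. by rewrite mxE. Qed.

Let D_unit v : D v \in unitmx.
Proof. by have [] := diag_inv (@d_neq0 v). Qed.

Let D_inv v : invmx (D v) = diag_mx (\row_k (u (crd k) x)^-1).
Proof.
have [_ ->] := diag_inv (@d_neq0 v).
by congr diag_mx; apply/rowP => k; rewrite !mxE.
Qed.

Lemma normalize_gauge_unit :
  in_GL (fun v => diag_mx (\row_k u (crd k) x) *m invmx (frm (sval x) v)) /\
  in_T (fun v => diag_mx (\row_k (u (crd k) x)^-1) : 'M_(alpha v)).
Proof.
split; first by move=> v; rewrite unitmx_mul D_unit unitmx_inv frm_unit.
split=> v; first by rewrite -D_inv unitmx_inv D_unit.
exact: diag_mx_is_diag.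
Qed.

Lemma normalize_phi a l k : phiG (normalize x) a l k =
  u (crd l) x * arrow a l k x * (u (crd k) x)^-1.
Proof.
have -> : phiG (normalize x) a = D (ftgt a) *m arrow_mx (sval x) a *m
    diag_mx (\row_k (u (crd k) x)^-1).
  rewrite -D_inv /normalize /= invmx_mul ?unitmx_inv ?D_unit ?frm_unit //.
  by rewrite invmxK /arrow_mx !mulmxA.
by rewrite mul_mx_diag mxE mul_diag_mx mxE; congr (_ * _ * _); rewrite mxE.
Qed.

Lemma normalize_phis a k l : phisG (normalize x) a k l =
  u (crd k) x * coarrow a k l x * (u (crd l) x)^-1.
Proof.
have -> : phisG (normalize x) a = D (fsrc a) *m coarrow_mx (sval x) a *m
    diag_mx (\row_k (u (crd k) x)^-1).
  rewrite -D_inv /normalize /= invmx_mul ?unitmx_inv ?D_unit ?frm_unit //.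
  by rewrite invmxK /coarrow_mx !mulmxA.
by rewrite mul_mx_diag mxE mul_diag_mx mxE; congr (_ * _ * _); rewrite mxE.
Qed.

Lemma normalize_frm : frm (normalize x) = fun v => 1%:M.
Proof.
apply: functional_extensionality_dep => v /=.
by rewrite mulmxKV ?frm_unit // -D_inv mulmxV ?D_unit.
Qed.

Lemma normalize_in_fam : in_fam (normalize x).
Proof. by have [gu tT] := normalize_gauge_unit; exact: gauge_in_fam gu tT. Qed.

Lemma normalize_invariant f : A f -> f (exist _ _ normalize_in_fam) = f x.
Proof.
have [gu tT] := normalize_gauge_unit; case=> _ fi.
exact: (fi _ _ x (exist _ _ normalize_in_fam) gu tT erefl).
Qed.

End Normalize.

End Normal.

(** * Characters are evaluations *)

Section Evaluation.
Variables (K : fieldType) (G : finite_quiver) (alpha : fvert G -> nat).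

Local Notation lattice := {ffun farr G -> int}.
Local Notation crd k := (Tagged (fun i => 'I_(alpha i)) k).
Local Notation coord := (coordinates alpha).
Local Notation fam := (fam K alpha).
Local Notation A := (@inv_alg K G alpha).
Local Notation component w := (@in_component K G alpha w).
Local Notation Rep := (@Triple K _ alpha G alpha).
Local Notation phiG := (@phi K _ alpha G alpha).
Local Notation phisG := (@phis K _ alpha G alpha).
Local Notation gaugeG := (gauge (Q := G) (d := alpha) (fun g : gl K alpha => g)).

Implicit Types (x : fam) (a : farr G) (xi : lattice).

Variables (y : moduli_alpha alpha K) (F : frame y).
Local Notation u := (fu F).
Local Notation u' := (fu' F).
Local Notation coordG := (@coordinate K _ alpha G alpha).
Local Notation z := (normal_point F).

(** A polynomial p is approximable if near y its value at the normalised
    representation is a fraction of invariants, and if y maps this fraction to the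
    value of p at the normal form. *)
Definition approximable (p : rep K alpha -> K) : Prop := exists P D,
  [/\ A P, A D, chi_at y D != 0,
      forall x, D x != 0 ->
        (forall c, u c x != 0) /\ p (normalize F x) = P x / D x
    & p (normal_form F) = chi_at y P / chi_at y D].

(** The functions u c and u' c may be assumed not to vanish: multiply numerator
    and denominator by their product. *)
Lemma approximableI p P D : A P -> A D -> chi_at y D != 0 ->
  (forall x, (forall c, u c x != 0) -> (forall c, u' c x != 0) -> D x != 0 ->
    p (normalize F x) = P x / D x) ->
  p (normal_form F) = chi_at y P / chi_at y D -> approximable p.
Proof.
move=> PA DA D0 pE pz; pose N x := \prod_c (u c x * u' c x).
have NA : A N by apply: invariants_prod => c; apply: invariant_uu.
have N0 : chi_at y N != 0.
  apply: chi_prod_neq0 => [c|c _]; [exact: invariant_uu | exact: fu_neq0].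
exists (fun x => P x * N x), (fun x => D x * N x); split.
- exact: invariants_mul.
- exact: invariants_mul.
- by rewrite chiM // mulf_neq0.
- move=> x; rewrite mulf_eq0 negb_or => /andP[Dx Nx].
  have uu c : (u c x != 0) && (u' c x != 0).
    by move/prodf_neq0/(_ c isT): Nx; rewrite mulf_eq0 negb_or.
  split=> [c|]; first by case/andP: (uu c).
  rewrite pE // => [|c|c]; [|by case/andP: (uu c)..].
  by rewrite -mulf_div divff // mulr1.
- by rewrite !chiM // -mulf_div divff // mulr1.
Qed.

Lemma approximable_coordinate p : coordG p -> approximable p.
Proof.
have A1 : A (fun=> 1) by apply: invariants_cst.
have one0 : chi_at y (fun=> 1) != 0 by rewrite chiC oner_neq0.
case=> [] [b [i [j ->]]].
- apply: (approximableI (P := fun x => u (crd i) x * arrow b i j x * u' (crd j) x)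
    (D := fun x => u (crd j) x * u' (crd j) x)).
  + exact: invariant_ufu (graded_arrow b i j).
  + exact: invariant_uu.
  + exact: fu_neq0.
  + by move=> x ux u'x _; rewrite normalize_phi // -mulf_div divff ?mulr1.
  + by rewrite mxE.
- apply: (approximableI (P := fun x => u (crd i) x * coarrow b i j x * u' (crd j) x)
    (D := fun x => u (crd j) x * u' (crd j) x)).
  + exact: invariant_ufu (graded_coarrow b i j).
  + exact: invariant_uu.
  + exact: fu_neq0.
  + by move=> x ux u'x _; rewrite normalize_phis // -mulf_div divff ?mulr1.
  + by rewrite mxE.
- apply: (approximableI (P := fun=> (1%:M : 'M_(alpha b)) i j) (D := fun=> 1)) => //.
  + exact: invariants_cst.
  + by move=> x ux _ _; rewrite normalize_frm // divr1.
  + by rewrite !chiC divr1.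
- apply: (approximableI (P := fun x => sig (sval x) b i j) (D := fun=> 1)) => //.
  + exact: sig_invariant.
  + by move=> x ux _ _; rewrite divr1.
  + by rewrite chiC divr1 moduli_projE.
Qed.

Lemma approximable_polyfun p : polyfun coordG p -> approximable p.
Proof.
elim=> {p} [c|f /approximable_coordinate //|f g _ fa _ ga|f g _ fa _ ga].
- apply: (approximableI (P := fun=> c) (D := fun=> 1)).
  + exact: invariants_cst.
  + exact: invariants_cst.
  + by rewrite chiC oner_neq0.
  + by move=> x _ _ _; rewrite divr1.
  + by rewrite !chiC divr1.
- have [P [D [PA DA D0 fE fz]]] := fa; have [P' [D' [PA' DA' D0' gE gz]]] := ga.
  have PD' := invariants_mul PA DA'; have P'D := invariants_mul PA' DA.
  have DD' := invariants_mul DA DA'.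
  exists (fun x => P x * D' x + P' x * D x), (fun x => D x * D' x); split=> //.
  + exact: invariants_add.
  + by rewrite chiM // mulf_neq0.
  + move=> x; rewrite mulf_eq0 negb_or => /andP[Dx D'x].
    have [ux fx] := fE x Dx; have [_ gx] := gE x D'x.
    by split=> //; rewrite fx gx addf_div.
  + by rewrite fz gz chiD // !chiM // addf_div.
- have [P [D [PA DA D0 fE fz]]] := fa; have [P' [D' [PA' DA' D0' gE gz]]] := ga.
  exists (fun x => P x * P' x), (fun x => D x * D' x); split=> //.
  + exact: invariants_mul.
  + exact: invariants_mul.
  + by rewrite chiM // mulf_neq0.
  + move=> x; rewrite mulf_eq0 negb_or => /andP[Dx D'x].
    have [ux fx] := fE x Dx; have [_ gx] := gE x D'x.
    by split=> //; rewrite fx gx mulf_div.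
  + by rewrite fz gz !chiM // mulf_div.
Qed.

(** The fraction P / Q inherits its non-vanishing from that of q at the normal form;
    the extra factor of Q is the denominator of q, which keeps all three
    conditions on x in the single inequality for Q. *)
Lemma approximate_fraction p q : polyfun coordG p -> polyfun coordG q ->
  q (normal_form F) != 0 -> exists P Q,
  [/\ A P, A Q, chi_at y Q != 0,
      chi_at y P / chi_at y Q = p (normal_form F) / q (normal_form F)
    & forall x, Q x != 0 -> [/\ forall c, u c x != 0, q (normalize F x) != 0
      & p (normalize F x) / q (normalize F x) = P x / Q x]].
Proof.
move=> pP qP qz; have [P [D [PA DA D0 pE pz]]] := approximable_polyfun pP.
have [P' [D' [PA' DA' D0' qE qz']]] := approximable_polyfun qP.
have P'0 : chi_at y P' != 0.
  by apply: contraNneq qz => P'0; rewrite qz' P'0 mul0r.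
have PD' := invariants_mul PA DA'; have DP' := invariants_mul DA PA'.
exists (fun x => P x * D' x * D' x), (fun x => D x * P' x * D' x); split.
- exact: invariants_mul.
- exact: invariants_mul.
- by rewrite !chiM // !mulf_neq0.
- by rewrite !chiM // pz qz'; field; rewrite D0 D0' P'0.
- move=> x; rewrite !mulf_eq0 !negb_or => /andP[/andP[Dx P'x] D'x].
  have [ux px] := pE x Dx; have [_ qx] := qE x D'x.
  split=> //; first by rewrite qx mulf_neq0 // invr_neq0.
  by rewrite px qx; field; rewrite Dx D'x P'x.
Qed.

(** A regular function is a fraction p / q near the normal point, so that
    Q f = P on the whole family for invariant P and Q; applying y to this
    identity computes the value of y at f without the Nullstellensatz. *)
Theorem chi_normal f : A f -> chi_at y f = f z.
Proof.
move=> fA; have [fr _] := fA.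
have [_ [_ [[p pP ->] [q qP ->] qz fE]]] := fr z I.
have [P [Q [PA QA Q0 PQ xE]]] := approximate_fraction pP qP qz.
rewrite fE // -PQ; apply: (canRL (mulfK Q0)).
suff e : (fun x => Q x * (f x * Q x)) = fun x => Q x * P x.
  have := congr1 (chi_at y) e; rewrite !chiM //; last exact: invariants_mul.
  by move/(mulfI Q0).
apply/funext => x; have [->|Qx] := eqVneq (Q x) 0; first by rewrite !mul0r.
have [ux qx pqE] := xE x Qx; congr (_ * _); apply: (canLR (mulfVK _)) => //.
have e := @normalize_invariant _ _ _ _ F x ux f fA.
by rewrite -e fE //= pqE.
Qed.

Lemma active_normal e : active y e <-> edge_fun e z != 0.
Proof. by rewrite /active chi_normal //; exact: invariant_edge_fun. Qed.

End Evaluation.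

(** * Fixed points and labellings *)

Section Fixed.
Variables (K : fieldType) (G : finite_quiver) (alpha : fvert G -> nat).
Variable (r : K).
Hypotheses (r_neq0 : r != 0) (r_free : forall n : int, r ^ n = 1 -> n = 0).

Local Notation lattice := {ffun farr G -> int}.
Local Notation crd k := (Tagged (fun i => 'I_(alpha i)) k).
Local Notation coord := (coordinates alpha).
Local Notation fam := (fam K alpha).
Local Notation A := (@inv_alg K G alpha).
Local Notation phiG := (@phi K _ alpha G alpha).
Local Notation phisG := (@phis K _ alpha G alpha).

Definition labelling : Type := forall i, 'I_(alpha i) -> lattice.

Definition coord_label (la : labelling) (c : coord) : lattice := la (tag c) (tagged c).

(** Consistent labellings of the edges at which a representation does not vanish
    are gradings for which it comes from the covering quiver. *)
Definition consistent (la : labelling) (E : edge alpha -> Prop) : Prop :=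
  forall e, E e ->
    coord_label la (edge_head e) = coord_label la (edge_tail e) + unit_vector (tag e).

Definition supported (la : labelling) (x : rep K alpha) : Prop :=
  (forall a l k, phiG x a l k != 0 -> la _ l = la _ k + unit_vector a) /\
  (forall a k l, phisG x a k l != 0 -> la _ l = la _ k + unit_vector a).

(** The coordinates on which two labellings differ by a given amount form a set
    that no edge leaves. *)
Lemma rigid (E : edge alpha -> Prop) la mu : connected_edges E ->
  consistent la E -> consistent mu E ->
  exists xi, forall i k, mu i k = la i k + xi.
Proof.
move=> Ec laE muE; have [[c0 _]|nc] := pselect (exists c0 : coord, True); last first.
  by exists 0 => i k; case: nc; exists (crd k).
exists (coord_label mu c0 - coord_label la c0) => i k.
pose S : pred coord := fun c =>
  coord_label mu c - coord_label la c == coord_label mu c0 - coord_label la c0.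
have [/eqP|nS] := boolP (S (crd k)).
  by rewrite /coord_label /= => <-; rewrite addrC subrK.
have [e eE /negP[]] := Ec S c0 (crd k) (eqxx _) nS.
rewrite /S (laE _ eE) (muE _ eE) opprD addrACA subrr addr0; exact: eqxx.
Qed.

(** Test on the one-parameter subgroups of T at the element r of infinite order. *)
Lemma torus_char_free xi :
  (forall t : farr G -> K, (forall a, t a != 0) -> torus_char t xi = 1) -> xi = 0.
Proof.
move=> t1; apply/ffunP => a; rewrite ffunE; apply: r_free.
rewrite -(t1 (fun b => if b == a then r else 1)) => [|b]; last first.
  by case: ifP => // _; apply: oner_neq0.
rewrite /torus_char (bigD1 a) //= eqxx big1 ?mulr1 // => b /negPf->.
exact: exp1rz.
Qed.

(** On the one hand t.y = y, on the other hand t multiplies the value at f by the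
    character xi. *)
Lemma fixed_graded (y : moduli_alpha alpha K) p xi f : fixed y ->
  nonzero_weight p -> graded p p xi f -> chi_at y f != 0 -> xi = 0.
Proof.
move=> yf p0 fg f0; have fA := graded_invariant p0 fg.
apply: torus_char_free => t t0.
have := congr1 (fun y => chi_at y f) (yf t t0).
rewrite chi_spec_map //.
rewrite (_ : f \o _ = fun x => torus_char t xi * f x); last first.
  by apply/funext => x; apply: (graded_torus fg).
by rewrite chiZ // -[RHS]mul1r => /(mulIf f0).
Qed.

Section FixedPoint.
Variables (y : moduli_alpha alpha K) (F : frame y) (yf : fixed y).

(** The T-weight of u c is minus the label of c: the coefficient from k to l of an
    arrow a, of weight e_a, completes u l and u' k to an invariant function. *)
Definition frame_label : labelling := fun i k => - fxi F (crd k).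

Lemma fxi_opp c : fxi' F c = - fxi F c.
Proof.
apply/eqP; rewrite -addr_eq0 addrC; apply/eqP.
apply: (fixed_graded yf (fbase_neq0 F)) (fu_neq0 F c).
exact: graded_mul (@entry_nonzero K G alpha c) (fu_graded F c) (fu'_graded F c).
Qed.

Lemma fixed_normalized c c' xi f : graded (weight c) (weight c') xi f ->
  normalized F c c' f != 0 -> fxi F c + xi - fxi F c' = 0.
Proof.
move=> fg; rewrite mulf_eq0 negb_or => /andP[f0 _].
have nz c := @entry_nonzero K G alpha c.
rewrite -fxi_opp; apply: (fixed_graded yf (fbase_neq0 F)) f0.
apply: graded_mul (nz c') _ (fu'_graded F c').
exact: graded_mul (nz c) (fu_graded F c) fg.
Qed.

Lemma fixed_supported : supported frame_label (normal_form F).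
Proof.
split=> a i j; rewrite mxE => n0.
  rewrite /frame_label -(subr0_eq (fixed_normalized (graded_arrow a i j) n0)).
  by rewrite opprD addrNK.
rewrite /frame_label -(subr0_eq (fixed_normalized (graded_coarrow a i j) n0)).
by rewrite opprB addrC.
Qed.

Lemma supported_active la : supported la (normal_form F) -> consistent la (active y).
Proof.
move=> [sup _] [a [l k]] /(active_normal F).
rewrite mulf_eq0 negb_or => /andP[+ _].
rewrite /arrow /arrow_mx /= invmx1 mul1mx mulmx1; exact: sup.
Qed.

(** The labelling of the frame is consistent along E as well, so that it differs
    from la by a shift only. *)
Lemma fixed_supported_by (E : edge alpha -> Prop) la : connected_edges E ->
  (forall e, E e -> active y e) -> consistent la E -> supported la (normal_form F).
Proof.
move=> Ec Ey laE; have yl := supported_active fixed_supported.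
have [xi laxi] := rigid Ec (fun e eE => yl e (Ey e eE)) laE.
have [s1 s2] := fixed_supported.
by split=> a i j => [/s1|/s2] e; rewrite !laxi e addrAC.
Qed.

End FixedPoint.
End Fixed.

(** * Covering representations inside representations *)

Section Blocks.
Variables (K : fieldType) (G : finite_quiver) (alpha : fvert G -> nat).
Variables (beta : covering_dim G) (D : decomposition alpha beta).

Local Notation lattice := {ffun farr G -> int}.
Local Notation blk v := (@block G alpha beta D v).

Definition block_index i (m : 'I_(alpha i)) : {chi : lattice & 'I_(beta (i, chi))} :=
  sval (cid (block_bij D m)).

Lemma block_indexK i (m : 'I_(alpha i)) :
  blk (i, tag (block_index m)) (tagged (block_index m)) = m.
Proof. by have [] := svalP (cid (block_bij D m)). Qed.

Lemma block_index_block i chi (k : 'I_(beta (i, chi))) :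
  block_index (blk (i, chi) k) = Tagged (fun chi => 'I_(beta (i, chi))) k.
Proof.
by have [_] := svalP (cid (block_bij D (blk (i, chi) k))); apply.
Qed.

Definition block_label : labelling alpha := fun i m => tag (block_index m).

Lemma label_block i chi (k : 'I_(beta (i, chi))) : block_label (blk (i, chi) k) = chi.
Proof. by rewrite /block_label block_index_block. Qed.

Lemma block_surj i chi (m : 'I_(alpha i)) : block_label m = chi ->
  exists k, m = blk (i, chi) k.
Proof. by move=> <-; exists (tagged (block_index m)); rewrite block_indexK. Qed.

(** The shape of the matrices of a representation of the covering quiver: shift e_a
    for phi_a, shift - e_a for phi_a^*, and shift 0 for block diagonal matrices.
    Unlike matrices with blocks, these can be multiplied without casts. *)
Definition shifts (s : lattice) i i' (M : 'M[K]_(alpha i, alpha i')) : Prop :=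
  forall m n, M m n != 0 -> block_label m = block_label n + s.

Lemma shifts_mul s s' i i' i'' (M : 'M[K]_(alpha i, alpha i'))
    (N : 'M[K]_(alpha i', alpha i'')) :
  shifts s M -> shifts s' N -> shifts (s' + s) (M *m N).
Proof.
move=> Ms Ns m n; rewrite mxE => /eqP MN0.
have [k] : exists k, M m k * N k n != 0.
  by apply: contra_notP MN0 => /forallNP kn; apply: big1 => k _; apply/eqP/negPn/negP.
by rewrite mulf_eq0 negb_or => /andP[/Ms -> /Ns ->]; rewrite addrA.
Qed.

(** Blocks of a product are products of blocks when only the block at chi
    contributes to the sum over the middle index. *)
Lemma mxsub_mul_block p q p' q' i chi (M : 'M[K]_(p, alpha i)) (N : 'M[K]_(alpha i, q))
    (f : 'I_p' -> 'I_p) (g : 'I_q' -> 'I_q) :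
  (forall k l m, M (f k) m != 0 -> N m (g l) != 0 -> block_label m = chi) ->
  mxsub f g (M *m N) = mxsub f (blk (i, chi)) M *m mxsub (blk (i, chi)) g N.
Proof.
move=> MN; apply/matrixP => k l; rewrite !mxE.
rewrite (bigID (mem [set blk (i, chi) k' | k' : 'I_(beta (i, chi))]%SET)) /= addrC.
rewrite big1 ?add0r => [|m].
  rewrite big_imset => [|k' l' _ _ /(@block_inj _ _ _ D (i, chi)) //].
  by apply: eq_big => [?|k' _]; rewrite ?mxE // inE.
apply: contraNeq; rewrite mulf_eq0 negb_or => /andP[Mm Nm].
have [k' ->] := block_surj (MN k l m Mm Nm).
exact: imset_f.
Qed.

Lemma block_diagonalP (g : gl K alpha) : block_diagonal D g <-> forall i, shifts 0 (g i).
Proof.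
split=> [gD i m n|gs i chi chi' k l chiN].
  rewrite addr0; apply: contra_neq_eq => mn.
  have [k mE] := block_surj (erefl (block_label m)).
  have [l nE] := block_surj (erefl (block_label n)).
  by rewrite [m in g i m]mE [n in g i _ n]nE; apply: gD.
apply: contraNeq chiN => /gs; rewrite !label_block addr0.
by move=> ->; apply: eqxx.
Qed.

Lemma block_diagonal_inj (g h : gl K alpha) : block_diagonal D g ->
  block_diagonal D h -> to_blocks D g = to_blocks D h -> g = h.
Proof.
move=> gD hD gh; apply: functional_extensionality_dep => i; apply/matrixP => m n.
have [mn|mn] := eqVneq (block_label m) (block_label n); last first.
  have /block_diagonalP/(_ i m n) := gD; have /block_diagonalP/(_ i m n) := hD.
  rewrite addr0 => h0 g0.
  have -> : g i m n = 0 by apply: contra_neq_eq mn => /g0.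
  by apply/esym; apply: contra_neq_eq mn => /h0.
move: mn; move nE: (block_label n) => chi mE.
have [k ->] := block_surj mE; have [l ->] := block_surj nE.
by have /matrixP/(_ k l) := congr1 (@^~ (i, chi)) gh; rewrite !mxE.
Qed.

(** The shift s is a function on labels, so that s chi occurs as it stands in the
    type of the blocks: it is the identity for GL and translation by e_a for the
    arrow a. *)
Definition glue_blocks i i' (s : lattice -> lattice)
    (M : forall chi, 'M[K]_(beta (i, s chi), beta (i', chi))) :
    'M[K]_(alpha i, alpha i') :=
  \matrix_(m, n)
    untag 0 (fun l => M (tag (block_index n)) l (tagged (block_index n))) (block_index m).

Lemma glue_blocksE i i' (s : lattice -> lattice)
    (M : forall chi, 'M[K]_(beta (i, s chi), beta (i', chi))) chi l k :
  glue_blocks M (blk (i, s chi) l) (blk (i', chi) k) = M chi l k.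
Proof.
rewrite mxE !block_index_block.
exact: (untagE (u := Tagged (fun chi => 'I_(beta (i, chi))) l) 0 _ erefl).
Qed.

Lemma glue_blocks0 i i' (s : lattice -> lattice)
    (M : forall chi, 'M[K]_(beta (i, s chi), beta (i', chi))) m n :
  block_label m != s (block_label n) -> glue_blocks M m n = 0.
Proof. by move=> mn; rewrite mxE untag_dflt. Qed.

Lemma glue_blocks_entry i i' (s : lattice -> lattice) m n :
  (exists chi l k, forall M : (forall chi, 'M[K]_(beta (i, s chi), beta (i', chi))),
    glue_blocks M m n = M chi l k) \/
  forall M : (forall chi, 'M[K]_(beta (i, s chi), beta (i', chi))), glue_blocks M m n = 0.
Proof.
have [mn|mn] := eqVneq (block_label m) (s (block_label n)); last first.
  by right=> M; apply: glue_blocks0.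
move: mn; move nE: (block_label n) => chi mE; left; exists chi.
have [l ->] := block_surj mE; have [k ->] := block_surj nE.
exists l, k => M; exact: glue_blocksE.
Qed.

Definition glue_diagonal (g : gl K (V := vert (covering G)) beta) : gl K alpha :=
  fun i => glue_blocks (s := id) (fun chi => g (i, chi)).

Lemma glue_diagonal_blocks g : block_diagonal D (glue_diagonal g).
Proof.
apply/block_diagonalP => i m n; rewrite addr0; apply: contra_neq_eq.
exact: glue_blocks0.
Qed.

Lemma glue_diagonalK g : to_blocks D (glue_diagonal g) = g.
Proof.
apply: functional_extensionality_dep => -[i chi]; apply/matrixP => k l.
by rewrite mxE (@glue_blocksE i i id).
Qed.

Lemma block_diagonal_mul (g h : gl K alpha) : block_diagonal D g ->
  block_diagonal D h -> block_diagonal D (fun i => g i *m h i).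
Proof.
move=> /block_diagonalP gD /block_diagonalP hD; apply/block_diagonalP => i.
by rewrite -[0](addr0 0); apply: shifts_mul.
Qed.

Lemma block_diagonal1 : block_diagonal D (fun i => 1%:M : 'M[K]_(alpha i)).
Proof. by apply: block_diagonal_t => i; apply: scalar_mx_is_diag. Qed.

Lemma glue_diagonal_mulV (g : gl K alpha) (h : gl K (V := vert (covering G)) beta) :
  block_diagonal D g -> (forall v, to_blocks D g v *m h v = 1%:M) ->
  forall i, g i *m glue_diagonal h i = 1%:M.
Proof.
move=> gD gh i.
suff e : (fun i => g i *m glue_diagonal h i) = (fun i => 1%:M) by exact: (congr1 (@^~ i) e).
apply: block_diagonal_inj.
- by apply: block_diagonal_mul => //; apply: glue_diagonal_blocks.
- exact: block_diagonal1.
- rewrite to_blocksM ?to_blocks1; last by left.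
  by apply: functional_extensionality_dep => v; rewrite glue_diagonalK gh.
Qed.

Lemma glue_diagonal_unit g : in_GL g -> in_GL_beta D (glue_diagonal g).
Proof.
move=> gu; split; last exact: glue_diagonal_blocks.
move=> i; have gi v : to_blocks D (glue_diagonal g) v *m invmx (g v) = 1%:M.
  by rewrite glue_diagonalK mulmxV.
by have /mulmx1_unit[] := glue_diagonal_mulV (glue_diagonal_blocks g) gi i.
Qed.

Lemma block_diagonal_inv (g : gl K alpha) : in_GL_beta D g ->
  block_diagonal D (fun i => invmx (g i)) /\
  to_blocks D (fun i => invmx (g i)) = fun v => invmx (to_blocks D g v).
Proof.
move=> gB; have [gu gD] := gB.
have gi v : to_blocks D g v *m invmx (to_blocks D g v) = 1%:M.
  by rewrite mulmxV ?to_blocks_unit.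
have iE : (fun i => invmx (g i)) = glue_diagonal (fun v => invmx (to_blocks D g v)).
  apply: functional_extensionality_dep => i.
  by rewrite -[RHS](mulKmx (gu i)) (glue_diagonal_mulV gD gi) mulmx1.
by rewrite iE glue_diagonalK; split=> //; apply: glue_diagonal_blocks.
Qed.

End Blocks.

Section Glue.
Variables (K : fieldType) (G : finite_quiver) (alpha : fvert G -> nat).
Variables (beta : covering_dim G) (D : decomposition alpha beta).

Local Notation lattice := {ffun farr G -> int}.
Local Notation blk v := (@block G alpha beta D v).
Local Notation label := (block_label D).
Local Notation component w := (@in_component K G alpha w).
Local Notation Rep := (@Triple K _ alpha G alpha).
Local Notation phiG := (@phi K _ alpha G alpha).
Local Notation phisG := (@phis K _ alpha G alpha).
Local Notation gaugeG := (gauge (Q := G) (d := alpha) (fun g : gl K alpha => g)).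
Local Notation rep := (rep K alpha).

Definition cover_rep : Type := triple K alpha (Q := covering G) beta.
Definition in_cover_fam (x : cover_rep) : Prop := in_family (to_blocks D) x.
Definition cover_fam : Type := {x : cover_rep | in_cover_fam x}.
Definition cover_inv_alg : set (cover_fam -> K) := invariants (blk := to_blocks (K := K) D).

Local Notation cphi := (@phi K _ alpha (covering G) beta).
Local Notation cphis := (@phis K _ alpha (covering G) beta).

Local Notation glue_arrow a :=
  (@glue_blocks K G alpha beta D (ftgt a) (fsrc a) (fun chi => chi + unit_vector a)).

(** The blocks of phi_a^* have their labels raised from rows to columns, hence the
    transposes. *)
Definition glue_rep (x : cover_rep) : rep := Rep
  (fun a => glue_arrow a (fun chi => cphi x (a, chi)))
  (fun a => (glue_arrow a (fun chi => (cphis x (a, chi))^T))^T)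
  (glue_diagonal D (frm x)) (sig x).

(** Inverse of glue_rep on blocked representations. Since to_blocks only takes
    submatrices, cutting is easier to compute with than gluing: statements about
    glue_rep are obtained from cut_rep. *)
Definition cut_rep (x : rep) : cover_rep := @Triple K _ alpha (covering G) beta
  (fun b : arr (covering G) => mxsub (blk (tgt b)) (blk (src b)) (phiG x b.1))
  (fun b : arr (covering G) => mxsub (blk (src b)) (blk (tgt b)) (phisG x b.1))
  (to_blocks D (frm x)) (sig x).

Record blocked (x : rep) : Prop := Blocked {
  blocked_phi : forall a, shifts D (unit_vector a) (phiG x a);
  blocked_phis : forall a, shifts D (- unit_vector a) (phisG x a);
  blocked_frm : block_diagonal D (frm x) }.

Lemma triple_eq (Q : quiver) (d : vert Q -> nat) (x y : triple K alpha d) :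
  (forall b, phi x b = phi y b) -> (forall b, phis x b = phis y b) ->
  frm x = frm y -> sig x = sig y -> x = y.
Proof.
case: x y => a a' h s [b b' h' s'] /= ab ab' -> ->.
by congr Triple; apply: functional_extensionality_dep.
Qed.

Lemma glue_repK (x : cover_rep) : cut_rep (glue_rep x) = x.
Proof.
apply: triple_eq => //=; last exact: glue_diagonalK.
  case=> a chi; apply/matrixP => l k; rewrite mxE.
  exact: (@glue_blocksE _ _ _ _ D (ftgt a) (fsrc a) (fun chi => chi + unit_vector a)).
case=> a chi; apply/matrixP => l k; rewrite [LHS]mxE [LHS]mxE.
by rewrite (@glue_blocksE _ _ _ _ D (ftgt a) (fsrc a) (fun chi => chi + unit_vector a)) mxE.
Qed.

Lemma glue_rep_blocked (x : cover_rep) : blocked (glue_rep x).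
Proof.
split=> [a|a|] /=; last exact: glue_diagonal_blocks.
  by move=> m n; apply: contra_neq_eq; apply: glue_blocks0.
move=> m n; rewrite mxE => g0.
suff -> : label n = label m + unit_vector a by rewrite addrK.
by move: g0; apply: contra_neq_eq; apply: glue_blocks0.
Qed.

Lemma shifts_eq i i' s (M N : 'M[K]_(alpha i, alpha i')) :
  shifts D s M -> shifts D s N ->
  (forall chi (l : 'I_(beta (i, chi + s))) (k : 'I_(beta (i', chi))),
    M (blk (i, chi + s) l) (blk (i', chi) k) = N (blk (i, chi + s) l) (blk (i', chi) k)) ->
  M = N.
Proof.
move=> Ms Ns MN; apply/matrixP => m n.
have [mn|mn] := eqVneq (label m) (label n + s); last first.
  transitivity (0 : K); first by move: mn; apply: contra_neq_eq => /Ms.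
  by apply/esym; move: mn; apply: contra_neq_eq => /Ns.
move: mn; move nE: (label n) => chi mE.
by have [k ->] := block_surj mE; have [l ->] := block_surj nE.
Qed.

Lemma cut_repK (x : rep) : blocked x -> glue_rep (cut_rep x) = x.
Proof.
move=> xb; have gb := glue_rep_blocked (cut_rep x).
have e := glue_repK (cut_rep x).
apply: triple_eq => //=.
- move=> a; apply: (@shifts_eq (ftgt a) (fsrc a) (unit_vector a) _ _
    (@blocked_phi _ gb a) (@blocked_phi _ xb a)) => chi l k.
  by have /matrixP/(_ l k) := congr1 (fun z => cphi z (a, chi)) e; rewrite !mxE.
- move=> a; apply: trmx_inj.
  have tr (z : rep) : blocked z -> shifts D (unit_vector a) (phisG z a)^T.
    move=> zb m n; rewrite mxE => /(blocked_phis zb) ->.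
    by rewrite addrNK.
  apply: (@shifts_eq (ftgt a) (fsrc a) (unit_vector a) _ _ (tr _ gb) (tr _ xb)) => chi l k.
  by have /matrixP/(_ k l) := congr1 (fun z => cphis z (a, chi)) e; rewrite !mxE.
- apply: block_diagonal_inj; [exact: glue_diagonal_blocks|exact: blocked_frm|].
  exact: glue_diagonalK.
Qed.

Lemma component_cut w (M : 'M[K]_(alpha w.1)) v (k l : 'I_(beta v)) :
  w.1 != v.1 \/ w = v ->
  in_component (mxsub (blk w) (blk w) M) v k l =
  component w.1 M v.1 (blk v k) (blk v l).
Proof.
rewrite /in_component => -[wv|e]; last by case: _ / e k l => k l; rewrite !dfwith_in mxE.
rewrite !dfwith_out ?mxE //; by apply: contraNneq wv => ->.
Qed.

(** At the vertex (i, chi) the only arrows of the covering that contribute are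
    those over (a, chi - e_a) and (a, chi), which match the arrows a of the
    quiver that end and start at i. *)
Lemma cut_moment (x : rep) : blocked x -> to_blocks D (moment x) = moment (cut_rep x).
Proof.
move=> [xp xs _]; apply: functional_extensionality_dep => -[i chi].
pose F1 (b : arr (covering G)) :=
  in_component (cphi (cut_rep x) b *m cphis (cut_rep x) b) (i, chi).
pose F2 (b : arr (covering G)) :=
  in_component (cphis (cut_rep x) b *m cphi (cut_rep x) b) (i, chi).
pose h a : arr (covering G) := (a, chi - unit_vector a).
pose h' a : arr (covering G) := (a, chi).
have -> : moment (cut_rep x) (i, chi) = \sum_a (F1 (h a) - F2 (h' a)).
  apply: fsum_sub => [a a' []//|a a' []//|[a chi']|[a chi']].
    rewrite /F1 /in_component => F0; exists a; congr pair.
    have [[_ /(canRL (addrK _)) //]|n] := eqVneq (tgt ((a, chi') : arr (covering G))) (i, chi).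
    by rewrite dfwith_out // eqxx in F0.
  rewrite /F2 /in_component => F0; exists a.
  have [[_ -> //]|n] := eqVneq (src ((a, chi') : arr (covering G))) (i, chi).
  by rewrite dfwith_out // eqxx in F0.
apply/matrixP => k l; rewrite mxE moment_finite !summxE; apply: eq_bigr => a _.
rewrite !mxE /F1 /F2; congr (_ - _).
  have <- : mxsub (blk (tgt (h a))) (blk (tgt (h a))) (phiG x a *m phisG x a) =
      cphi (cut_rep x) (h a) *m cphis (cut_rep x) (h a).
    apply: (mxsub_mul_block (chi := chi - unit_vector a)) => k' l' m _ /xs.
    by rewrite label_block addrK.
  rewrite (@component_cut (tgt (h a)) _ (i, chi)) //=.
  have [->|ne] := eqVneq (ftgt a) i; [right|by left].
  by rewrite subrK.
have <- : mxsub (blk (src (h' a))) (blk (src (h' a))) (phisG x a *m phiG x a) =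
    cphis (cut_rep x) (h' a) *m cphi (cut_rep x) (h' a).
  apply: (mxsub_mul_block (chi := chi + unit_vector a)) => k' l' m _ /xp.
  by rewrite label_block.
rewrite (@component_cut (src (h' a)) _ (i, chi)) //=.
by have [->|ne] := eqVneq (fsrc a) i; [right|left].
Qed.

Lemma moment_blocked (x : rep) : blocked x -> block_diagonal D (moment x).
Proof.
move=> [xp xs _]; apply/block_diagonalP => i.
have cs w (M : 'M[K]_(alpha w)) : shifts D 0 M -> shifts D 0 (component w M i).
  move=> Ms; rewrite /in_component; have [e|ne] := eqVneq w i.
    by case: _ / e; rewrite dfwith_in.
  by rewrite dfwith_out // => m n; rewrite mxE eqxx.
rewrite moment_finite; apply: (big_ind (@shifts K G alpha beta D 0 i i)).
- by move=> m n; rewrite mxE eqxx.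
- move=> M N Ms Ns m n; rewrite mxE; have [->|/Ms //] := eqVneq (M m n) 0.
  by rewrite add0r => /Ns.
- move=> a _ m n; rewrite !mxE; set M := component _ _ _; set N := component _ _ _.
  have [->|+ _] := eqVneq (M m n) 0.
    rewrite add0r oppr_eq0; apply: (cs _ _ _ m n).
    by rewrite -(subrr (unit_vector a)); apply: shifts_mul.
  apply: (cs _ _ _ m n).
  by rewrite -(addNr (unit_vector a)); apply: shifts_mul.
Qed.

Lemma frm_GL_beta (x : cover_rep) : in_GL (frm x) -> in_GL_beta D (frm (glue_rep x)).
Proof. exact: glue_diagonal_unit. Qed.

Lemma glue_rep_in_fam (x : cover_rep) : in_fam (glue_rep x) <-> in_cover_fam x.
Proof.
have xb := glue_rep_blocked x; have xK := glue_repK x.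
have mE : in_GL (frm x) -> in_tgen (sig x) ->
    ((forall v, moment (glue_rep x) v = gl_conj (frm (glue_rep x)) (sig x) v) <->
    (forall v, moment x v = gl_conj (frm x) (to_blocks D (sig x)) v)).
  move=> xu [st _ _]; have hB := frm_GL_beta xu; have [hu hD] := hB.
  have cD : block_diagonal D (gl_conj (frm (glue_rep x)) (sig x)).
    apply: block_diagonal_mul; last by have [] := block_diagonal_inv hB.
    by apply: block_diagonal_mul => //; apply: block_diagonal_t.
  have bE : to_blocks D (gl_conj (frm (glue_rep x)) (sig x)) =
      gl_conj (frm x) (to_blocks D (sig x)).
    by rewrite to_blocks_conj // glue_diagonalK.
  have mB := cut_moment xb; rewrite xK in mB.
  rewrite -mB -bE; split=> e v.
    by congr (to_blocks _ _ v); apply: functional_extensionality_dep.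
  have em := block_diagonal_inj (moment_blocked xb) cD (functional_extensionality_dep e).
  exact: (congr1 (@^~ v) em).
split=> -[xu xt]; last first.
  move=> xm; split=> //; last exact/mE.
  by have [] := frm_GL_beta xu.
have xu' : in_GL (frm x).
  rewrite -xK; apply: to_blocks_unit; split=> //; exact: blocked_frm.
by move/(mE xu' xt) => xm; split.
Qed.

Lemma cut_rep_in_cover_fam (x : rep) : blocked x -> in_fam x -> in_cover_fam (cut_rep x).
Proof. by move=> xb xf; apply/glue_rep_in_fam; rewrite cut_repK. Qed.

Lemma mxsub_invmx (g : gl K alpha) v : in_GL_beta D g ->
  mxsub (blk v) (blk v) (invmx (g v.1)) = invmx (to_blocks D g v).
Proof. by case/block_diagonal_inv => _ /(congr1 (@^~ v)). Qed.

Lemma shifts0 (g : gl K alpha) i : block_diagonal D g -> shifts D 0 (g i).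
Proof. by move/block_diagonalP. Qed.

Lemma gauge_blocked (x : rep) g t : blocked x -> in_GL_beta D g -> in_T t ->
  blocked (gaugeG g t x).
Proof.
move=> [xp xs xh] gB [_ tt]; have [gu gD] := gB.
have [/block_diagonalP gi _] := block_diagonal_inv gB.
split=> [a|a|] /=.
- rewrite -[unit_vector a]add0r; apply: shifts_mul (gi _).
  by rewrite -[unit_vector a]addr0; apply: shifts_mul => //; apply: shifts0.
- rewrite -[- unit_vector a]add0r; apply: shifts_mul (gi _).
  by rewrite -[- unit_vector a]addr0; apply: shifts_mul => //; apply: shifts0.
- apply: block_diagonal_mul; last exact: block_diagonal_t.
  exact: block_diagonal_mul.
Qed.

Lemma cut_gauge (x : rep) g t : blocked x -> in_GL_beta D g -> in_T t ->
  cut_rep (gaugeG g t x) = gauge (to_blocks D) (to_blocks D g) t (cut_rep x).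
Proof.
move=> [xp xs xh] gB [_ tt]; have [gu gD] := gB.
have gs i : shifts D 0 (g i) by apply: shifts0.
have tD : block_diagonal D t by apply: block_diagonal_t.
have [/block_diagonalP gi _] := block_diagonal_inv gB.
apply: triple_eq => //=.
- case=> a chi /=.
  rewrite (mxsub_mul_block (D := D) (chi := chi)); last first.
    by move=> k l m _ /gi; rewrite addr0 label_block.
  rewrite (mxsub_mul_block (D := D) (chi := chi + unit_vector a)); last first.
    by move=> k l m _ /xp; rewrite label_block.
  congr (_ *m _); exact: (mxsub_invmx (fsrc a, chi) gB).
- case=> a chi /=.
  rewrite (mxsub_mul_block (D := D) (chi := chi + unit_vector a)); last first.
    by move=> k l m _ /gi; rewrite addr0 label_block.
  rewrite (mxsub_mul_block (D := D) (chi := chi)); last first.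
    by move=> k l m _ /xs; rewrite label_block addrK.
  congr (_ *m _); exact: (mxsub_invmx (ftgt a, chi + unit_vector a) gB).
- rewrite (to_blocksM (g := fun v => g v *m frm x v)); last by right.
  by rewrite (to_blocksM (g := g)) //; left.
Qed.

Lemma glue_gauge (x : cover_rep) g t : in_GL g -> in_T t ->
  glue_rep (gauge (to_blocks D) g t x) = gaugeG (glue_diagonal D g) t (glue_rep x).
Proof.
move=> gu tT; have xb := glue_rep_blocked x; have gB := glue_diagonal_unit D gu.
rewrite -[RHS]cut_repK; last exact: gauge_blocked.
by rewrite cut_gauge // glue_repK glue_diagonalK.
Qed.

End Glue.

(** * The map of moduli spaces *)

Section CoverMap.
Variables (K : fieldType) (G : finite_quiver) (alpha : fvert G -> nat).
Variables (beta : covering_dim G) (D : decomposition alpha beta).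

Local Notation lattice := {ffun farr G -> int}.
Local Notation blk v := (@block G alpha beta D v).
Local Notation label := (block_label D).
Local Notation component w := (@in_component K G alpha w).
Local Notation Rep := (@Triple K _ alpha G alpha).
Local Notation phiG := (@phi K _ alpha G alpha).
Local Notation phisG := (@phis K _ alpha G alpha).
Local Notation gaugeG := (gauge (Q := G) (d := alpha) (fun g : gl K alpha => g)).
Local Notation rep := (rep K alpha).

Local Notation cover_rep := (@cover_rep K G alpha beta).
Local Notation cover_fam := (@cover_fam K G alpha beta D).
Local Notation cover_inv_alg := (@cover_inv_alg K G alpha beta D).
Local Notation cphi := (@phi K _ alpha (covering G) beta).
Local Notation cphis := (@phis K _ alpha (covering G) beta).
Local Notation coordG := (@coordinate K _ alpha G alpha).
Local Notation coordC := (@coordinate K _ alpha (covering G) beta).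
Local Notation fam := (fam K alpha).
Local Notation A := (@inv_alg K G alpha).
Local Notation glue_rep := (glue_rep D).
Local Notation cut_rep := (cut_rep D).

Definition glue_fam (x : cover_fam) : fam :=
  exist _ (glue_rep (sval x)) (proj2 (glue_rep_in_fam D (sval x)) (svalP x)).

Lemma glue_coordinate c : coordG c -> polyfun coordC (c \o glue_rep).
Proof.
have zero (p : cover_rep -> K) : (forall x, p x = 0) -> polyfun coordC p.
  by move=> p0; rewrite (_ : p = fun=> 0); [exact: polyfun_cst | exact/funext].
case=> [] [b [i [j ->]]].
- have [[chi [l [k e]]]|e] :=
    @glue_blocks_entry K G alpha beta D (ftgt b) (fsrc b) (fun chi => chi + unit_vector b) i j.
    rewrite (_ : _ \o _ = fun x => cphi x (b, chi) l k); last by apply/funext => x; apply: e.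
    by apply: polyfun_coord; apply: Or41; exists (b, chi), l, k.
  by apply: zero => x; apply: e.
- have [[chi [l [k e]]]|e] :=
    @glue_blocks_entry K G alpha beta D (ftgt b) (fsrc b) (fun chi => chi + unit_vector b) j i.
    rewrite (_ : _ \o _ = fun x => cphis x (b, chi) k l); last first.
      by apply/funext => x; rewrite /= mxE e mxE.
    by apply: polyfun_coord; apply: Or42; exists (b, chi), k, l.
  by apply: zero => x; rewrite /= mxE e.
- have [[chi [l [k e]]]|e] := @glue_blocks_entry K G alpha beta D b b id i j.
    rewrite (_ : _ \o _ = fun x : cover_rep => frm x (b, chi) l k); last first.
      by apply/funext => x; apply: e.
    by apply: polyfun_coord; apply: Or43; exists (b, chi), l, k.
  by apply: zero => x; apply: e.
- by apply: polyfun_coord; apply: Or44; exists b, i, j.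
Qed.

Lemma cut_coordinate c : coordC c -> polyfun coordG (c \o cut_rep).
Proof.
case=> [] [b [i [j ->]]]; apply: polyfun_coord.
- apply: Or41; exists b.1, (blk (tgt b) i), (blk (src b) j).
  by apply/funext => x; rewrite /= mxE.
- apply: Or42; exists b.1, (blk (src b) i), (blk (tgt b) j).
  by apply/funext => x; rewrite /= mxE.
- apply: Or43; exists b.1, (blk b i), (blk b j).
  by apply/funext => x; rewrite /= mxE.
- by apply: Or44; exists b, i, j.
Qed.

Lemma glue_invariant f : A f -> cover_inv_alg (f \o glue_fam).
Proof.
case=> fr fi; split.
  exact: (regular_comp (fun x => proj2 (glue_rep_in_fam D x)) glue_coordinate fr).
move=> g t x y gu tT yE; have [eu _] := glue_diagonal_unit D gu.
apply: (fi (glue_diagonal D g) t (glue_fam x) (glue_fam y)) => //=.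
by rewrite yE glue_gauge.
Qed.

Definition cover_map : moduli_beta K D -> moduli_alpha alpha K := spec_map glue_invariant.

Lemma chi_cover_map p f : A f -> chi_at (cover_map p) f = chi_at p (f \o glue_fam).
Proof. exact: chi_spec_map. Qed.

(** The element of GL_alpha is diagonal with the entry t^chi at a coordinate with
    label chi. *)
Lemma torus_gauge_blocked t (x : rep) : (forall a, t a != 0) -> blocked D x ->
  exists g, [/\ in_GL g, in_T (fun i => invmx (g i)) &
    torus_triple (Q := G) t x = gaugeG g (fun i => invmx (g i)) x].
Proof.
move=> t0 [xp xs xh]; have tc0 xi : torus_char t xi != 0.
  by apply/prodf_neq0 => a _; rewrite expfz_neq0.
pose d i : 'rV[K]_(alpha i) := \row_k torus_char t (label k).
have d0 i k : d i 0 k != 0 by rewrite mxE.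
pose g : gl K alpha := fun i => diag_mx (d i).
have gE m n (M : 'M[K]_(alpha m, alpha n)) s : shifts D s M ->
    g m *m M *m invmx (g n) = torus_char t s *: M.
  move=> Ms; have [_ ->] := diag_inv (d0 n).
  apply/matrixP => k l; rewrite mul_mx_diag mxE mul_diag_mx !mxE.
  have [->|/Ms ->] := eqVneq (M k l) 0; first by rewrite !mulr0 mul0r.
  by rewrite torus_charD // [_ * M k l]mulrC mulrC; field; apply: tc0.
exists g; split.
- by move=> i; have [] := diag_inv (d0 i).
- split=> i; have [gu ->] := diag_inv (d0 i); last exact: diag_mx_is_diag.
  by have [_ <-] := diag_inv (d0 i); rewrite unitmx_inv.
- apply: triple_eq => //= [a|a|].
  + by rewrite (gE _ _ _ _ (@xp a)) torus_char_unit.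
  + by rewrite (gE _ _ _ _ (@xs a)) torus_charN torus_char_unit.
  + apply: functional_extensionality_dep => i.
    by rewrite (gE _ _ _ _ (shifts0 (i := i) xh)) torus_char0 scale1r.
Qed.

Lemma weyl_invariant (w : weyl alpha) f : A f -> A (f \o
  family_map (weyl_family (Q := G) (d := alpha) (blk := fun g : gl K alpha => g)
    (@wdot_GL K _ _ w) (fun s _ => erefl))).
Proof.
exact: (family_map_invariants
  (weyl_family (Q := G) (d := alpha) (blk := fun g : gl K alpha => g)
    (@wdot_GL K _ _ w) (fun s _ => erefl))
  (weyl_coord (Q := G) (d := alpha) (fun g : gl K alpha => g) w)
  (weyl_gauge (Q := G) (d := alpha) (blk := fun g : gl K alpha => g)
    (@wdot_GL K _ _ w) (fun s _ => erefl))).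
Qed.

Lemma cover_map_fixed p : fixed (cover_map p).
Proof.
move=> t t0; apply: character_ext => f fA; have [_ fi] := fA.
rewrite chi_spec_map //; rewrite [RHS]chi_cover_map // chi_cover_map; last first.
  exact: (family_map_invariants (torus_family (Q := G) t0)
    (torus_coord (Q := G) t) (torus_gauge (Q := G) _ t) fA).
congr (chi_at p _); apply/funext => x /=.
have [g [gu gT gE]] := torus_gauge_blocked t0 (glue_rep_blocked D (sval x)).
by apply: fi gu gT _.
Qed.

Lemma cover_map_weyl (v : weyl_beta K D) p :
  cover_map (weyl_beta_act v p) = weyl_alpha_act (sval v) (cover_map p).
Proof.
have [vu vD] := svalP v.
apply: character_ext => f fA; rewrite chi_cover_map // chi_spec_map; last exact: glue_invariant.
rewrite chi_spec_map // chi_cover_map; last first.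
  exact: (weyl_invariant (sval v) fA).
congr (chi_at p _); apply/funext => x /=; congr f; apply: eq_exist => /=.
apply: triple_eq => //=; apply: (block_diagonal_inj (D := D)).
- exact: glue_diagonal_blocks.
- apply: block_diagonal_mul; first exact: glue_diagonal_blocks.
  by have [] := block_diagonal_inv (svalP v).
- rewrite glue_diagonalK to_blocksM; last by left; apply: glue_diagonal_blocks.
  by have [_ ->] := block_diagonal_inv (svalP v); rewrite glue_diagonalK.
Qed.

Lemma cover_map_proj p : moduli_proj (cover_map p) = moduli_proj p.
Proof.
apply: functional_extensionality_dep => v; apply/matrixP => i j.
by rewrite !mxE !evE /= chi_cover_map //; apply: sig_coord.
Qed.

(** A coefficient between coordinates with the wrong labels restricts to zero on
    representations of the covering. *)
Lemma normal_form_blocked p (F : frame (cover_map p)) : blocked D (normal_form F).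
Proof.
have vanish c c' (f : fam -> K) : A (fun x => fu F c x * f x * fu' F c' x) ->
    (forall x : cover_fam, f (glue_fam x) = 0) -> normalized F c c' f = 0.
  move=> fA f0; rewrite /normalized chi_cover_map //.
  rewrite (_ : _ \o _ = fun=> 0) ?chiC ?mul0r //.
  by apply/funext => x; rewrite /= f0 mulr0 mul0r.
have shifts_conj (x : cover_fam) i i' s (M : 'M[K]_(alpha i, alpha i')) :
    shifts D s M -> shifts D s
      (invmx (frm (sval (glue_fam x)) i) *m M *m frm (sval (glue_fam x)) i').
  move=> Ms; have xu : in_GL (frm (sval x)) by case: x => x [].
  have [/block_diagonalP hi _] := block_diagonal_inv (glue_diagonal_unit D xu).
  have /block_diagonalP h := glue_diagonal_blocks D (frm (sval x)).
  rewrite -[s]add0r; apply: shifts_mul (h _).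
  by rewrite -[s]addr0; apply: shifts_mul (hi _) Ms.
split=> [a m n|a m n|]; last exact: block_diagonal1.
  rewrite mxE; apply: contra_neq_eq => mn; apply: vanish.
    exact: invariant_ufu (graded_arrow a m n).
  move=> x; have sh := shifts_conj x _ _ _ _
    (blocked_phi (glue_rep_blocked D (sval x)) (a := a)).
  by move: mn; apply: contra_neq_eq => /sh.
rewrite mxE; apply: contra_neq_eq => mn; apply: vanish.
  exact: invariant_ufu (graded_coarrow a m n).
move=> x; have sh := shifts_conj x _ _ _ _
  (blocked_phis (glue_rep_blocked D (sval x)) (a := a)).
by move: mn; apply: contra_neq_eq => /sh.
Qed.

Lemma normalize_blocked y (F : frame y) (x : fam) : (forall c, fu F c x != 0) ->
  blocked D (sval x) -> exists g t, [/\ in_GL g, in_T t, blocked D (normalize F x) &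
    cut_rep (normalize F x) = gauge (to_blocks D) g t (cut_rep (sval x))].
Proof.
move=> ux xb; have [gu tT] := normalize_gauge_unit ux.
set g := fun v => _ in gu; set t := fun v => _ in tT.
have gB : in_GL_beta D g.
  split=> //; apply: block_diagonal_mul.
    by apply: block_diagonal_t => i; apply: diag_mx_is_diag.
  have hB : in_GL_beta D (frm (sval x)) by split; [exact: frm_unit|exact: blocked_frm].
  by have [] := block_diagonal_inv hB.
exists (to_blocks D g), t; split=> //.
- exact: to_blocks_unit.
- exact: gauge_blocked.
- exact: cut_gauge.
Qed.

(** Functions on the covering moduli space are locally restrictions of fractions
    of functions on the moduli space: near the normal form a regular function is
    a fraction of polynomials in coordinates, which extend. *)
Lemma cover_map_lift (p : moduli_beta K D) f : cover_inv_alg f -> exists P Q,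
  [/\ A P, A Q, chi_at (cover_map p) Q != 0 & forall x, Q (glue_fam x) * f x = P (glue_fam x)].
Proof.
move=> [fr fi]; have [F] := frame_exists (cover_map p).
have nb := normal_form_blocked F.
pose z : cover_fam := exist _ _ (cut_rep_in_cover_fam nb (normal_form_in_fam F)).
have [_ [_ [[q qP ->] [r rP ->] rz fE]]] := fr z I.
have qc := polyfun_comp cut_coordinate qP; have rc := polyfun_comp cut_coordinate rP.
have [P [Q [PA QA Q0 _ xE]]] := approximate_fraction qc rc rz.
exists (fun x => P x * Q x), (fun x => Q x * Q x); split.
- exact: invariants_mul.
- exact: invariants_mul.
- by rewrite chiM // mulf_neq0.
move=> x; have [->|Qx] := eqVneq (Q (glue_fam x)) 0; first by rewrite !mulr0 mul0r.
have [ux rx qrE] := xE _ Qx; rewrite mulrAC; congr (_ * _).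
rewrite mulrC; apply: (canLR (mulfVK Qx)); rewrite -qrE.
have [g [t [gu tT xb e]]] := normalize_blocked ux (glue_rep_blocked D (sval x)).
have xf : in_cover_fam D (cut_rep (normalize F (glue_fam x))).
  by apply: cut_rep_in_cover_fam => //; apply: normalize_in_fam.
have <- : f (exist _ _ xf) = f x.
  by apply: (fi g t) => //=; rewrite e glue_repK.
by rewrite fE.
Qed.

(** Two points with the same image agree on f because f is a fraction of functions
    from the target near that image. *)
Lemma cover_map_inj : injective cover_map.
Proof.
move=> p p' pp'; apply: character_ext => f fA.
have [P [Q [PA QA Q0 e]]] := cover_map_lift p fA.
have Q0' : chi_at (cover_map p') Q != 0 by rewrite -pp'.
have QG := glue_invariant QA.
have fE r : chi_at (cover_map r) Q != 0 ->
      chi_at r f = chi_at (cover_map r) P / chi_at (cover_map r) Q.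
  move=> Qr; apply: (canRL (mulfK Qr)); rewrite !chi_cover_map // mulrC -chiM //.
  by congr (chi_at r _); apply/funext => x; apply: e.
by rewrite !fE // pp'.
Qed.

Definition eval_character (x : cover_fam) : character cover_inv_alg.
Proof. by exists (fun f => sval f x) => // c f ->. Defined.

Lemma chi_eval x f : cover_inv_alg f -> chi_at (eval_character x) f = f x.
Proof. by move=> fA; rewrite -[f]/(sval (exist cover_inv_alg _ fA)) -evE. Qed.

Lemma cover_map_image (y : moduli_alpha alpha K) (F : frame y) :
  blocked D (normal_form F) -> exists p, y = cover_map p.
Proof.
move=> nb; have cF := cut_rep_in_cover_fam nb (normal_form_in_fam F).
exists (eval_character (exist _ _ cF)).
apply: character_ext => f fA; rewrite chi_cover_map // chi_eval; last exact: glue_invariant.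
by rewrite (chi_normal F) //=; congr f; apply: eq_exist; rewrite /= cut_repK.
Qed.

Lemma supported_blocked (x : rep) : supported label x -> frm x = (fun v => 1%:M) ->
  blocked D x.
Proof.
move=> [xp xs] xh; split; [exact: xp| |by rewrite xh; exact: block_diagonal1].
by move=> a m n /xs ->; rewrite addrK.
Qed.

Lemma blocked_supported (x : rep) : blocked D x -> supported label x.
Proof.
case=> xp xs _; split; first exact: xp.
by move=> a k l /xs ->; rewrite addrNK.
Qed.

Lemma cover_map_consistent p : consistent label (active (cover_map p)).
Proof.
have [F] := frame_exists (cover_map p).
exact: (supported_active (blocked_supported (normal_form_blocked F))).
Qed.

Section Free.
Variable r : K.
Hypotheses (r_neq0 : r != 0) (r_free : forall n : int, r ^ n = 1 -> n = 0).

(** The set E carries the comparison of the labelling of y with that of the blocks;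
    it may be smaller than the set of all active edges of y. *)
Lemma cover_map_image_consistent (y : moduli_alpha alpha K) (E : edge alpha -> Prop) :
  fixed y -> connected_edges E -> (forall e, E e -> active y e) ->
  consistent label E -> exists p, y = cover_map p.
Proof.
move=> yf Ec Ey lE; have [F] := frame_exists y.
apply: (@cover_map_image _ F); apply: supported_blocked => //.
exact: (fixed_supported_by r_neq0 r_free F yf Ec Ey lE).
Qed.

(** The fixed points at which all edges active at cover_map p are active lie in the
    image of cover_map; hence the image is open in the fixed locus. *)
Lemma cover_map_open p : exists f, [/\ A f, chi_at (cover_map p) f != 0 &
  forall y, fixed y -> chi_at y f != 0 -> exists p', y = cover_map p'].
Proof.
pose f (x : fam) := \prod_(e | `[< active (cover_map p) e >]) edge_fun e x.
have eA := @invariant_edge_fun K G alpha.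
exists f; split.
- exact: invariants_prod.
- by apply: chi_prod_neq0 => // e /asboolP.
- move=> y yf fy; apply: (@cover_map_image_consistent y (active (cover_map p))) => //.
  + exact: active_connected.
  + move=> e ea; apply: contraNneq fy => ye.
    pose g (x : fam) := \prod_(e' | `[< active (cover_map p) e' >] && (e' != e)) edge_fun e' x.
  have gA : A g by apply: invariants_prod.
  have -> : f = fun x => edge_fun e x * g x.
    by apply/funext => x; rewrite /f (bigD1 e) //; exact/asboolP.
  by rewrite (chiM _ (eA e) gA) ye mul0r.
  + exact: cover_map_consistent.
Qed.

End Free.
End CoverMap.

(** * Weyl group and labellings *)

Section WeylAction.
Variables (K : fieldType) (G : finite_quiver) (alpha : fvert G -> nat).

Local Notation lattice := {ffun farr G -> int}.
Local Notation fam := (fam K alpha).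
Local Notation A := (@inv_alg K G alpha).
Implicit Types (w v : weyl alpha) (y : moduli_alpha alpha K).

Definition weyl_fam w : fam -> fam :=
  family_map (weyl_family (Q := G) (d := alpha) (blk := fun g : gl K alpha => g)
    (@wdot_GL K _ _ w) (fun s _ => erefl)).

Lemma chi_weyl w y f : A f -> chi_at (weyl_alpha_act w y) f = chi_at y (f \o weyl_fam w).
Proof. exact: chi_spec_map. Qed.

Lemma weyl_actM v w y :
  weyl_alpha_act v (weyl_alpha_act w y) = weyl_alpha_act (wmul v w) y.
Proof.
apply: character_ext => f fA.
rewrite chi_weyl // chi_weyl ?chi_weyl //; last exact: weyl_invariant.
congr (chi_at y _); apply/funext => x /=; congr f; apply: eq_exist => /=.
apply: triple_eq => //=; apply: functional_extensionality_dep => i.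
  rewrite -mulmxA -invmx_mul ?unitmx_perm //; congr (_ *m invmx _).
  by rewrite /wdot perm_mxM.
by apply/matrixP => k l; rewrite !gl_conj_wdotE !permM.
Qed.

Lemma weyl_act1 y : weyl_alpha_act (fun i => 1%g) y = y.
Proof.
apply: character_ext => f fA; rewrite chi_weyl //; congr (chi_at y _).
apply/funext => x /=; congr f; case: x => x xf; apply: eq_exist => /=.
apply: triple_eq => //=; apply: functional_extensionality_dep => i.
  by rewrite /wdot perm_mx1 invmx1 mulmx1.
by apply/matrixP => k l; rewrite !gl_conj_wdotE !perm1.
Qed.

Lemma wmulVw w : wmul (winv w) w = (fun i => 1%g).
Proof. by apply: functional_extensionality_dep => i; rewrite /wmul /winv mulVg. Qed.

Lemma wmulwV w : wmul w (winv w) = (fun i => 1%g).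
Proof. by apply: functional_extensionality_dep => i; rewrite /wmul /winv mulgV. Qed.

Lemma weyl_actK w y : weyl_alpha_act (winv w) (weyl_alpha_act w y) = y.
Proof. by rewrite weyl_actM wmulVw weyl_act1. Qed.

Lemma weyl_actVK w y : weyl_alpha_act w (weyl_alpha_act (winv w) y) = y.
Proof. by rewrite weyl_actM wmulwV weyl_act1. Qed.

Lemma proj_weyl w y :
  moduli_proj (weyl_alpha_act w y) = gl_conj (wdot K w) (moduli_proj y).
Proof.
apply: functional_extensionality_dep => v; apply/matrixP => i j.
rewrite gl_conj_wdotE !moduli_projE chi_weyl; last exact: sig_invariant.
by congr (chi_at y _); apply/funext => x /=; rewrite gl_conj_wdotE.
Qed.

Definition weyl_edge w (e : edge alpha) : edge alpha :=
  existT _ (tag e) (w _ (tagged e).1, w _ (tagged e).2).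

Lemma perm_conjE m n (s : 'S_m) (t : 'S_n) (M : 'M[K]_(m, n)) k l :
  (perm_mx s *m M *m invmx (perm_mx t)) k l = M (s k) (t l).
Proof.
have -> : invmx (perm_mx t) = perm_mx t^-1 :> 'M[K]_n.
  apply: (can_inj (mulKmx (unitmx_perm K t))).
  by rewrite mulmxV ?unitmx_perm // -perm_mxM mulgV perm_mx1.
by rewrite -row_permE -col_permE !mxE.
Qed.

Lemma edge_fun_weyl w e : edge_fun e \o weyl_fam w = edge_fun (K := K) (weyl_edge w e).
Proof.
apply/funext => x; case: e => a [l k]; rewrite /edge_fun /=.
have hu := frm_unit x.
congr (_ * _); rewrite /arrow /coarrow -perm_conjE; congr (fun_of_matrix _ _ _).
  rewrite /arrow_mx /= invmx_mul ?unitmx_inv ?unitmx_perm //.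
  by rewrite invmxK !mulmxA.
rewrite /coarrow_mx /= invmx_mul ?unitmx_inv ?unitmx_perm //.
by rewrite invmxK !mulmxA.
Qed.

Lemma active_weyl w y e : active (weyl_alpha_act w y) e <-> active y (weyl_edge w e).
Proof.
rewrite /active chi_weyl; last exact: invariant_edge_fun.
by rewrite edge_fun_weyl.
Qed.

Lemma consistent_weyl w y (la : labelling alpha) : consistent la (active y) ->
  consistent (fun i k => la i (w i k)) (active (weyl_alpha_act w y)).
Proof. by move=> lay e /active_weyl/lay. Qed.

End WeylAction.

(** * Dimension vectors and labellings *)

Section Counting.

Lemma perm_of_counts n (T : eqType) (f g : 'I_n -> T) :
  (forall x, #|[pred k | f k == x]| = #|[pred k | g k == x]|) ->
  exists s : 'S_n, forall k, f k = g (s k).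
Proof.
move=> fg; have /tuple_permP[s sE] : perm_eq (codom f) (mktuple g).
  have cE (h : 'I_n -> T) x : count_mem x (codom h) = #|[pred k | h k == x]|.
    by rewrite count_map cardE size_filter enumT.
  by apply/allP => x _; rewrite /= (cE f) fg -cE.
exists s => k; have := congr1 (fun q => nth (f k) q k) sE.
by rewrite (nth_map k) ?size_enum_ord // nth_ord_enum -tnth_nth !tnth_mktuple.
Qed.

Variables (G : finite_quiver) (alpha : fvert G -> nat).
Local Notation lattice := {ffun farr G -> int}.

Lemma card_label (beta : covering_dim G) (D : decomposition alpha beta) i chi :
  #|[pred k : 'I_(alpha i) | block_label D k == chi]| = beta (i, chi).
Proof.
rewrite -[RHS]card_ord -(card_codom (@block_inj _ _ _ D (i, chi))).
apply: eq_card => k; apply/idP/idP => [/eqP kE|/codomP[k' ->]].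
  by have [k' ->] := block_surj kE; apply: codom_f.
by rewrite inE label_block.
Qed.

Definition label_dim (la : labelling alpha) : covering_dim G :=
  [fsfun v in [fset (tag c, coord_label la c) | c in {: {i : fvert G & 'I_(alpha i)}}]%fset
    => #|[pred k | la v.1 k == v.2]|].

Lemma label_dimE la i chi : label_dim la (i, chi) = #|[pred k | la i k == chi]|.
Proof.
rewrite fsfunE; case: ifPn => // /imfsetP nS; apply/esym/eqP.
rewrite -leqn0 leqNgt; apply/negP => /card_gt0P[k /eqP kE].
by apply: nS; exists (existT _ i k) => //=; rewrite /coord_label /= kE.
Qed.

Lemma label_dim_compatible la : compatible alpha (label_dim la).
Proof.
move=> i; transitivity (\sum_(k : 'I_(alpha i)) 1)%N; last by rewrite sum1_card card_ord.
rewrite (eq_bigr (fun v => \sum_(k : 'I_(alpha i)) ((i, la i k) == v : nat)))%N; last first.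
  case=> j chi /= /eqP ->; rewrite label_dimE -sum1_card big_mkcond /=.
  by apply: eq_bigr => k _; rewrite xpair_eqE eqxx inE; case: eqP.
rewrite exchange_big /=; apply: eq_bigr => k _.
have kin : (i, la i k) \in finsupp (label_dim la).
  rewrite mem_finsupp label_dimE -lt0n; apply/card_gt0P; exists k.
  by rewrite inE.
rewrite big_mkcond (bigD1_seq (i, la i k)) ?fset_uniq //= !eqxx big1 ?addn0 // => v.
by rewrite eq_sym => /negPf ->; case: ifP.
Qed.

End Counting.

(** * The fixed locus as a union of translates *)

Section Spaces.
Variable K : fieldType.

Lemma spec_openP (P : Type) (B : set (P -> K)) (U : set (spec B)) : zopen U <->
  forall x, U x -> exists f, [/\ B f, chi_at x f != 0 & forall y, chi_at y f != 0 -> U y].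
Proof.
split=> Uo x Ux.
  have [_ [[f ->] fx fU]] := Uo x Ux; exists (sval f).
  by split=> [||y]; [exact: svalP | rewrite -evE | rewrite -evE => /fU].
have [f [fB fx fU]] := Uo x Ux; exists (fun y => ev y (exist _ f fB)).
by split=> [||y]; [exists (exist _ f fB) | rewrite evE | rewrite evE => /fU].
Qed.

Lemma spec_sectP (P : Type) (B : set (P -> K)) (U : set (spec B)) g : sect U g <->
  forall x, U x -> exists p q, [/\ B p, B q, chi_at x q != 0 &
    forall y, U y -> chi_at y q != 0 -> g y = chi_at y p / chi_at y q].
Proof.
split=> gU x Ux.
  have [_ [_ [[p ->] [q ->] qx gE]]] := gU x Ux; exists (sval p), (sval q).
  split; [exact: svalP | exact: svalP | by rewrite -evE |].
  by move=> y Uy; rewrite -!evE; apply: gE.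
have [p [q [pB qB qx gE]]] := gU x Ux.
exists (fun y => ev y (exist _ p pB)), (fun y => ev y (exist _ q qB)).
split; [by exists (exist _ p pB) | by exists (exist _ q qB) | by rewrite evE |].
by move=> y Uy; rewrite !evE; apply: gE.
Qed.

Lemma isomorphism_inverse (S S' : Defs.space K) (f : S -> S') (f' : S' -> S) :
  cancel f f' -> cancel f' f -> is_isomorphism f -> is_isomorphism f'.
Proof.
move=> fK f'K [_ fo fs].
have pK (U : set S) : f @^-1` (f' @^-1` U) = U.
  by apply/funext => x; rewrite /preimage /= fK.
split; first by exists f.
  by move=> U; rewrite fo pK.
move=> U g Uo; have Uo' : zopen (f' @^-1` U) by rewrite fo pK.
rewrite (fs _ _ Uo') pK; suff -> : (fun x => g (f' (f x))) = g by [].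
by apply/funext => x; rewrite fK.
Qed.

End Spaces.

Section Main.
Variables (K : fieldType) (r : K).
Hypotheses (r_neq0 : r != 0) (r_free : forall n : int, r ^ n = 1 -> n = 0).
Variables (G : finite_quiver) (alpha : fvert G -> nat).
Variables (B : set (covering_dim G)) (hB : representatives alpha B).
Variable D : forall b : {beta | B beta}, decomposition alpha (sval b).

Local Notation A := (@inv_alg K G alpha).
Local Notation fixed_locus := (fixed_locus alpha K).
Local Notation index := {beta | B beta}.
Local Notation lattice := {ffun farr G -> int}.
Local Notation label b := (block_label (D b)).
Local Notation cover_map_of b := (@cover_map K G alpha (sval b) (D b)).
Local Notation moduli_of b := (moduli_beta K (D b)).
Local Notation union := (covering_union K D).

(** Equal up to a shift means equivalent, and B contains one element of each class. *)
Lemma B_inj (b b' : {beta | B beta}) xi :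
  (forall i chi, sval b (i, chi) = sval b' (i, chi + xi)) -> b = b'.
Proof.
case: b b' => [b Bb] [b' Bb'] /= bb'; have [Bc Bu] := hB.
have [b0 [_ b0u]] := Bu b' (Bc _ Bb').
apply: eq_exist; rewrite -(b0u b); last first.
  by split=> //; exists xi.
by apply: b0u; split=> //; exists 0 => i chi; rewrite addr0.
Qed.

(** The values f (s k) and f k have the same sum over k, so alpha i times xi is 0. *)
Lemma shift_eq0 i (f : 'I_(alpha i) -> lattice) (s : 'S_(alpha i)) xi :
  (forall k, f (s k) = f k + xi) -> 'I_(alpha i) -> xi = 0.
Proof.
move=> fs k0; apply/ffunP => a; rewrite ffunE.
have e : \sum_k f (s k) a = \sum_k f k a + (xi a) *+ alpha i.
  rewrite -[X in _ *+ X]card_ord -sumr_const -big_split /=.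
  by apply: eq_bigr => k _; rewrite fs ffunE.
have e' : \sum_k f k a = \sum_k f (s k) a by apply: reindex_inj; apply: perm_inj.
move: e; rewrite -e' -[LHS]addr0 => /addrI/esym/eqP; rewrite Num.Theory.mulrn_eq0.
by case/orP=> [/eqP ai0|/eqP //]; case: k0; rewrite ai0.
Qed.

Definition translate (b : index) (w : weyl alpha) (p : moduli_of b) : fixed_locus :=
  exist _ (weyl_alpha_act (winv w) (cover_map_of b p))
    (fixed_weyl (winv w) (cover_map_fixed p)).

Definition union_map (x : union) : fixed_locus :=
  translate (tag (crepr (tagged x))) (tagged (crepr (tagged x))).

Definition bundle_point (b : index) (w : weyl alpha) (p : moduli_of b) : union :=
  existT _ b (cls (@bundle_rel G alpha K _ (D b)) (existT _ w p)).

(** The active edges of the common point are consistent with the labellings of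
    both blocks, up to v = w w'^-1. These differ by a shift xi, so b' = b; then
    xi = 0, and v lies in W_beta. *)
Lemma translate_inj b b' w w' (p : moduli_of b) (p' : moduli_of b') :
  translate w p = translate w' p' -> bundle_point w p = bundle_point w' p'.
Proof.
move/(congr1 sval)/(congr1 (weyl_alpha_act w)); rewrite /= weyl_actVK weyl_actM.
set v := wmul w (winv w') => pE.
have lc := @cover_map_consistent K G alpha _ (D b) p.
have lc' : consistent (fun i k => label b' (v i k)) (active (cover_map_of b p)).
  by rewrite pE; apply: consistent_weyl; apply: cover_map_consistent.
have [xi lE] := rigid (active_connected (cover_map_of b p)) lc lc'.
have e : b' = b.
  apply/esym/(@B_inj _ _ xi) => i chi; rewrite -(card_label (D b)) -(card_label (D b')).
  rewrite -(card_imset _ (@perm_inj _ (v i))); apply: eq_card => k.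
  apply/imsetP/idP => [[k' + ->]|]; rewrite !inE.
    by move/eqP => <-; rewrite lE eqxx.
  move=> /eqP kE; exists ((v i)^-1 k)%g; last by rewrite permKV.
  by rewrite inE -(inj_eq (addIr xi)) -lE permKV kE.
case: _ / e p pE lc lc' lE => p pE lc lc' lE.
have lv i k : label b' (v i k) = label b' k.
  by rewrite lE (shift_eq0 (lE i) k) addr0.
have vB : in_GL_beta (D b') (wdot K v).
  split; first exact: wdot_GL.
  apply/block_diagonalP => i m n; rewrite !mxE addr0.
  by case: (v i m =P n) => [<- _|_]; [rewrite lv | rewrite eqxx].
apply/esym; rewrite /bundle_point; congr existT; apply: bundle_cls.
exists (WeylBeta vB); congr existT => /=.
  apply: functional_extensionality_dep => i.
  by rewrite /v /wmul /winv mulgKV.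
by apply: (@cover_map_inj K G alpha _ (D b')); rewrite cover_map_weyl.
Qed.

(** The dimension vector of a labelling of y is equivalent to one in B; a permutation
    w takes the labelling, shifted, to the one of the blocks. *)
Lemma fixed_translate y : fixed y ->
  exists b (w : weyl alpha) p, y = weyl_alpha_act (winv w) (cover_map_of b p).
Proof.
move=> yf; have [F] := frame_exists y; pose la := frame_label F.
have lay : consistent la (active y).
  exact: (supported_active (fixed_supported r_neq0 r_free F yf)).
have [Bc Bu] := hB.
have [be [[Bbe [xi beE]] _]] := Bu _ (label_dim_compatible la).
pose b : {beta | B beta} := exist _ be Bbe; exists b.
have wP i : exists s : 'S_(alpha i), forall k, label b k = la i (s k) - xi.
  apply: (@perm_of_counts _ _ (@block_label _ _ _ (D b) i) (fun k => la i k - xi)) => chi.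
  rewrite card_label /= beE label_dimE; apply: eq_card => k.
  by rewrite !inE subr_eq.
pose w : weyl alpha := fun i => sval (cid (wP i)); exists w.
have wE i k : label b k = la i (w i k) - xi by exact: (svalP (cid (wP i))).
suff [p pE] : exists p, weyl_alpha_act w y = cover_map_of b p.
  by exists p; rewrite -pE weyl_actK.
apply: (@cover_map_image_consistent K G alpha _ (D b) r r_neq0 r_free _
  (active (weyl_alpha_act w y))) => //.
- exact: fixed_weyl.
- exact: active_connected.
- move=> e /(consistent_weyl lay); rewrite /coord_label => e'.
  by rewrite !wE e' addrAC.
Qed.

Lemma translate_bundle b (u u' : sum_space (fun _ : weyl alpha => moduli_of b)) :
  bundle_rel u u' -> translate (tag u) (tagged u) = translate (tag u') (tagged u').
Proof.
case=> v -> /=; apply: eq_exist => /=; rewrite cover_map_weyl weyl_actM.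
congr (weyl_alpha_act _ _); apply: functional_extensionality_dep => i.
by rewrite /wmul /winv invMg mulgKV.
Qed.

Lemma union_mapE b w (p : moduli_of b) : union_map (bundle_point w p) = translate w p.
Proof. exact/esym/(translate_bundle (bundle_crepr (existT _ w p))). Qed.

Lemma bundle_pointP (x : union) : exists b w (p : moduli_of b), x = bundle_point w p.
Proof.
case: x => b c; exists b, (tag (crepr c)), (tagged (crepr c)).
rewrite /bundle_point; congr existT; rewrite -[LHS]creprK.
by case: (crepr c).
Qed.

Lemma union_map_inj : injective union_map.
Proof.
move=> x y; have [b [w [p ->]]] := bundle_pointP x.
have [b' [w' [p' ->]]] := bundle_pointP y.
by rewrite !union_mapE => /translate_inj.
Qed.

Lemma union_map_surj (y : fixed_locus) : exists x, union_map x = y.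
Proof.
case: y => y yf; have [b [w [p yE]]] := fixed_translate yf.
by exists (bundle_point w p); rewrite union_mapE; apply: eq_exist.
Qed.

Lemma union_map_act w x : union_map (wact w x) = wact w (union_map x).
Proof.
have [b [v [p ->]]] := bundle_pointP x.
have -> : wact w (bundle_point v p) = bundle_point (wmul v (winv w)) p.
  by rewrite /bundle_point /= bundle_actE.
rewrite !union_mapE.
apply: eq_exist; rewrite /= weyl_actM; congr (weyl_alpha_act _ _).
apply: functional_extensionality_dep => i.
by rewrite /wmul /winv invMg invgK.
Qed.

Lemma union_map_proj x : wproj (union_map x) = wproj x.
Proof.
have [b [v [p ->]]] := bundle_pointP x.
rewrite [in LHS]union_mapE /= proj_weyl cover_map_proj.
by rewrite bundle_projE.
Qed.

Definition piece (U : set fixed_locus) b w : set (moduli_of b) :=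
  [set p | U (translate w p)].

Lemma union_open (U : set fixed_locus) :
  zopen (union_map @^-1` U) <-> forall b w, zopen (piece U (b := b) w).
Proof.
have pE b w : @piece U b w = [set p | U (union_map (bundle_point w p))].
  by apply/funext => p; rewrite /piece /= union_mapE.
by split=> Uo b w; have := Uo b w; rewrite pE.
Qed.

Lemma union_sect (U : set fixed_locus) (g : fixed_locus -> K) :
  sect (union_map @^-1` U) (fun x => g (union_map x)) <->
  forall b w, sect (@piece U b w) (fun p => g (translate w p)).
Proof.
have pE b w : @piece U b w = [set p | U (union_map (bundle_point w p))].
  by apply/funext => p; rewrite /piece /= union_mapE.
have gE b w : (fun p : moduli_of b => g (translate w p)) =
    fun p => g (union_map (bundle_point w p)).
  by apply/funext => p; rewrite union_mapE.
by split=> gU b w; have := gU b w; rewrite pE gE.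
Qed.

Lemma translate_pullback b w f : A f -> exists f', cover_inv_alg f' /\
  forall p : moduli_of b, chi_at p f' = chi_at (sval (translate w p)) f.
Proof.
move=> fA; have wA := weyl_invariant (winv w) fA.
exists ((f \o weyl_fam (winv w)) \o @glue_fam K G alpha _ (D b)).
split=> [|p]; first exact: glue_invariant.
by rewrite chi_weyl // chi_cover_map.
Qed.

Lemma translate_back b w f : A f -> exists f', A f' /\
  forall p : moduli_of b, chi_at (sval (translate w p)) f' = chi_at (cover_map_of b p) f.
Proof.
move=> fA; exists (f \o weyl_fam w); split=> [|p]; first exact: weyl_invariant.
by rewrite -chi_weyl //= weyl_actVK.
Qed.

Lemma translate_lift b w (p0 : moduli_of b) f : cover_inv_alg f -> exists P Q,
  [/\ A P, A Q, chi_at (sval (translate w p0)) Q != 0 & forall p : moduli_of b,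
    chi_at (sval (translate w p)) Q * chi_at p f = chi_at (sval (translate w p)) P].
Proof.
move=> fA; have [P [Q [PA QA Q0 QfP]]] := cover_map_lift p0 fA.
have [P' [PA' P'E]] := translate_back b w PA.
have [Q' [QA' Q'E]] := translate_back b w QA.
exists P', Q'; split=> //; first by rewrite Q'E.
move=> p; rewrite P'E Q'E !chi_cover_map // -chiM //; last exact: glue_invariant.
by congr (chi_at p _); apply/funext => x; apply: QfP.
Qed.

Lemma translate_open b w (p0 : moduli_of b) : exists f,
  [/\ A f, chi_at (sval (translate w p0)) f != 0 & forall y : fixed_locus,
    chi_at (sval y) f != 0 -> exists p : moduli_of b, y = translate w p].
Proof.
have [f [fA f0 fU]] := cover_map_open r_neq0 r_free p0.
have [f' [fA' f'E]] := translate_back b w fA.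
exists (f \o weyl_fam w); split; first exact: weyl_invariant.
  by rewrite -chi_weyl //= weyl_actVK.
case=> y yf /=; rewrite -chi_weyl // => fy.
have [p pE] := fU _ (fixed_weyl w yf) fy.
by exists p; apply: eq_exist; rewrite -pE weyl_actK.
Qed.

(** For the converse, a function f on a piece that cuts out an open set is replaced
    by a function on the whole space: its numerator P times the denominator Q
    times a function h that vanishes on the fixed points outside the piece. *)
Lemma fixed_open (U : set fixed_locus) :
  zopen U <-> forall b w, zopen (@piece U b w).
Proof.
split=> [[V Vo UE] b w|Uo].
  apply/spec_openP => p; rewrite /piece UE => /= Vp.
  have [f [fA fp fV]] := (spec_openP V).1 Vo _ Vp.
  have [f' [fA' f'E]] := translate_pullback b w fA.
  by exists f'; split=> [//||q]; rewrite f'E => // /fV.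
exists [set y | exists f, [/\ A f, chi_at y f != 0 &
    forall y' : fixed_locus, chi_at (sval y') f != 0 -> U y']].
  apply/spec_openP => y [f [fA fy fU]]; exists f; split=> // y' fy'.
  by exists f.
apply/seteqP; split=> y /= => [Uy|[f [_ fy fU]]]; last exact: fU.
have [x xE] := union_map_surj y; have [b [w [p pE]]] := bundle_pointP x.
move: Uy; rewrite -{}xE {}pE union_mapE => Up.
have [f [fA fp fU]] := (spec_openP (piece U w)).1 (Uo b w) p Up.
have [P [Q [PA QA Q0 QfP]]] := translate_lift w p fA.
have [h [hA h0 himg]] := translate_open w p.
exists (fun x => P x * Q x * h x); split.
- by apply: invariants_mul => //; apply: invariants_mul.
- have PQ := invariants_mul PA QA.
  by rewrite (chiM _ PQ hA) (chiM _ PA QA) !mulf_neq0 // -QfP mulf_neq0.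
- move=> y'; have PQ := invariants_mul PA QA.
  rewrite (chiM _ PQ hA) (chiM _ PA QA) !mulf_eq0 !negb_or => /andP[/andP[Py Qy] hy].
  have [p' y'E] := himg _ hy; rewrite y'E; apply: fU.
  by apply: contraNneq Py => fp'; rewrite y'E -QfP fp' mulr0.
Qed.

(** Locally on a piece a section is n / d, and with n = P / Q and d = P' / Q' it
    becomes (P Q') / (Q P'). The function h restricts this to the piece. *)
Lemma fixed_sect (U : set fixed_locus) (g : fixed_locus -> K) :
  sect U g <-> forall b w, sect (@piece U b w) (fun p => g (translate w p)).
Proof.
split=> [gU b w|gU].
  apply/spec_sectP => p Up.
  have [V [g' [Vo Vp gV gE]]] := gU _ Up.
  have [h [hA hp hV]] := (spec_openP V).1 Vo _ Vp.
  have [n [d [nA dA dp g'E]]] := (spec_sectP V g').1 gV _ Vp.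
  have [n' [nA' n'E]] := translate_pullback b w (invariants_mul nA hA).
  have [d' [dA' d'E]] := translate_pullback b w (invariants_mul dA hA).
  exists n', d'; split=> //; first by rewrite d'E (chiM _ dA hA) mulf_neq0.
  move=> q Uq; rewrite d'E n'E (chiM _ dA hA) (chiM _ nA hA).
  rewrite mulf_eq0 negb_or => /andP[dq hq].
  rewrite gE //; last exact: hV.
  rewrite g'E //; last exact: hV.
  by rewrite -mulf_div divff // mulr1.
move=> y Uy; have [x xE] := union_map_surj y; have [b [w [p pE]]] := bundle_pointP x.
move: Uy; rewrite -{}xE {}pE union_mapE => Up.
have [n [d [nA dA dp gE]]] := (spec_sectP (piece U w) _).1 (gU b w) p Up.
have [P [Q [PA QA Q0 QnP]]] := translate_lift w p nA.
have [P' [Q' [PA' QA' Q0' QdP]]] := translate_lift w p dA.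
have [h [hA h0 himg]] := translate_open w p.
have PQ' := invariants_mul PA QA'; have QP' := invariants_mul QA PA'.
have QP'Q' := invariants_mul QP' QA'.
have QPQh := invariants_mul QP'Q' hA.
exists [set y' | chi_at y' (fun x => Q x * P' x * Q' x * h x) != 0].
exists (fun y' => chi_at y' (fun x => P x * Q' x) / chi_at y' (fun x => Q x * P' x)).
have split0 (y' : moduli_alpha alpha K) :
    (chi_at y' (fun x => Q x * P' x * Q' x * h x) != 0) =
    [&& chi_at y' Q != 0, chi_at y' P' != 0, chi_at y' Q' != 0 & chi_at y' h != 0].
  rewrite (chiM _ QP'Q' hA) (chiM _ QP' QA') (chiM _ QA PA').
  by rewrite !mulf_eq0 !negb_or -!andbA.
split.
- apply/spec_openP => y' y'0; exists (fun x => Q x * P' x * Q' x * h x); split=> //.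
- by rewrite /= split0 Q0 Q0' h0 -QdP mulf_neq0.
- apply/spec_sectP => y' /=; rewrite split0 => /and4P[Qy Py Qy' hy].
  exists (fun x => P x * Q' x), (fun x => Q x * P' x); split=> //.
  by rewrite chiM // mulf_neq0.
- move=> y' Uy' /=; rewrite split0 => /and4P[Qy Py Qy' hy].
  have [q y'E] := himg _ hy; move: Uy' Qy Py Qy' {hy}; rewrite {}y'E => Uq Qq Pq Qq'.
  have dq : chi_at q d != 0 by apply: contraNneq Pq => dq; rewrite -QdP dq mulr0.
  rewrite (gE q Uq dq) (chiM _ PA QA') (chiM _ QA PA') -QnP -QdP.
  by field; rewrite Qq Qq' dq.
Qed.

Lemma union_map_isomorphism : is_isomorphism union_map.
Proof.
split.
- pose inv y := sval (cid (union_map_surj y)).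
  have invK : cancel inv union_map by move=> y; apply: (svalP (cid (union_map_surj y))).
  by exists inv => // x; apply: union_map_inj; rewrite invK.
- by move=> U; rewrite fixed_open union_open.
- by move=> U g _; rewrite fixed_sect union_sect.
Qed.

Theorem fixed_locus_union : wspace_isomorphic fixed_locus union.
Proof.
pose inv y := sval (cid (union_map_surj y)).
have invK : cancel inv union_map by move=> y; apply: (svalP (cid (union_map_surj y))).
have mapK : cancel union_map inv by move=> x; apply: union_map_inj; rewrite invK.
exists inv; split.
- exact: isomorphism_inverse mapK invK union_map_isomorphism.
- by move=> w x; apply: union_map_inj; rewrite union_map_act !invK.
- by move=> x; rewrite -[in RHS](invK x) union_map_proj.
Qed.

End Main.

Lemma two_free (K : numFieldType) (n : int) : (2 : K) ^ n = 1 -> n = 0.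
Proof.
have free k : (2 : K) ^+ k = 1 -> k = 0%N.
  by rewrite -natrX => /eqP; rewrite Num.Theory.pnatr_eq1 -(expn0 2) eqn_exp2l // => /eqP.
case: n => [k /free -> //|k].
by rewrite NegzE -invr_expz => /eqP; rewrite invr_eq1 => /eqP/free.
Qed.

Theorem theorem5p1 (R : realType) (G : finite_quiver) (alpha : fvert G -> nat)
    (B : set (covering_dim G)) (hB : representatives alpha B)
    (D : forall b : {beta | B beta}, decomposition alpha (sval b)) :
  wspace_isomorphic (fixed_locus alpha (complex R))
                    (covering_union (complex R) D).
Proof.
apply: (@fixed_locus_union (complex R) 2 _ _ G alpha B hB D).
  by rewrite Num.Theory.pnatr_eq0.
exact: two_free.
Qed.
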